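(* For every $s<t$, every $\varphi\in C_b(X)$ and every $\Phi\in C_b(X;X)$: $$\int_XP_{s,t}\varphi(x)\,\mu_s(dx)=\int_X\varphi(x)\,\mu_t(dx),$$ $$\int_X\overrightarrow{P_{s,t}}\Phi(x)\,\mu_s(dx)=\int_X\Phi(x)\,\mu_t(dx),$$ where $\mu_t:=\mathcal N(0,Q(t,-\infty))$ for $t\in\mathbb R$.
   Context: $X$ is a separable real Hilbert space with inner product $\langle\cdot,\cdot\rangle_X$ and norm $|\cdot|_X$; $\mathcal L(X)$ is the space of bounded linear operators on $X$. $\{A(t)\}_{t\in\mathbb R}$ is a family of linear operators $A(t):D(A(t))\subseteq X\to X$ generating a strongly continuous evolution operator $\{U(t,s):s\le t\}\subseteq\mathcal L(X)$, i.e. $\partial_tU(t,s)=A(t)U(t,s)$ for $s<t$, $U(t,s)=U(t,r)U(r,s)$ for $s\le r\le t$, $U(\tau,\tau)=I$, and $(t,s)\mapsto U(t,s)x$ is continuous on $\{s\le t\}$ for every $x\in X$. The set $\Omega_U:=\{\omega\in\mathbb R:\exists M>0,\ \|U(t,s)\|_{\mathcal L(X)}\le Me^{\omega(t-s)}\ \forall s\le t\}$ is non-empty and $\omega_0:=\inf\Omega_U<0$. $\{B(t)\}_{t\in\mathbb R}\subseteq\mathcal L(X)$ is bounded in operator norm and $t\mapsto B(t)x$ is measurable for every $x\in X$. For $s\le t$ set $Q(t,s):=\int_s^tU(t,r)B(r)B(r)^*U(t,r)^*\,dr$ and $Q(t,-\infty):=\int_{-\infty}^tU(t,r)B(r)B(r)^*U(t,r)^*\,dr$.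 Standing assumptions: every $Q(t,s)$ is trace class and $\sup_{s\le t}\mathrm{tr}\,Q(t,s)<+\infty$ for every $t$ (which implies that $Q(t,-\infty)$ is trace class); controllability: $\mathrm{Im}\,U(t,s)\subseteq \mathrm{Im}\,Q(t,s)^{1/2}$ for all $s<t$. $\mathcal N(a,Q)$ denotes the (possibly degenerate) Gaussian measure on $X$ with mean $a$ and covariance $Q$. $C_b(X)$ and $C_b(X;X)$ are the spaces of bounded continuous real-valued, respectively $X$-valued, functions on $X$. For $s\le t$, $[P_{s,t}\varphi](x):=\int_X\varphi(U(t,s)x+y)\,\mathcal N(0,Q(t,s))(dy)$ for $\varphi\in C_b(X)$ and $[\overrightarrow{P_{s,t}}\Phi](x):=\int_X\Phi(U(t,s)x+y)\,\mathcal N(0,Q(t,s))(dy)$ for $\Phi\in C_b(X;X)$; vector-valued integrals are Bochner integrals. *)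

(* Defs.v *)
From mathcomp Require Import all_boot all_order all_algebra.
From mathcomp Require Import all_classical all_reals all_analysis.
From mathcomp Require Import measurable_realfun.

Set Implicit Arguments.
Unset Strict Implicit.
Unset Printing Implicit Defensive.

Import Order.TTheory GRing.Theory Num.Theory.
Import numFieldNormedType.Exports.

Local Open Scope classical_set_scope.
Local Open Scope ring_scope.

Notation borel X := (g_sigma_algebraType (@open X)).

Definition separable (X : topologicalType) : Prop :=
  exists D : set X, countable D /\ dense D.

Section bochner.
Context {d : measure_display} {T : measurableType d} {R : realType}.
Context {X : completeNormedModType R}.
Variable mu : {measure set T -> \bar R}.

Definition integrable_simple (h : T -> X) : Prop :=
  [/\ finite_set (range h),
      forall x, measurable (h @^-1` [set x]) &
      forall x, x != 0 -> (mu (h @^-1` [set x]) < +oo)%E].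

(* The level set of 0 may have infinite mass: [fine +oo = 0] then gives a
   vanishing term, as it should. *)
Definition simple_integral (h : T -> X) : X :=
  \sum_(x \in range h) fine (mu (h @^-1` [set x])) *: x.

Definition is_bochner_integral (f : T -> X) (v : X) : Prop :=
  exists h_ : nat -> T -> X,
  [/\ forall n, integrable_simple (h_ n),
      {ae mu, forall z, h_ n z @[n --> \oo] --> f z},
      (\int[mu]_z `|f z - h_ n z|%:E)%E @[n --> \oo] --> 0%E &
      simple_integral (h_ n) @[n --> \oo] --> v].

(* 0 when [f] is not Bochner integrable on [D]. [f] is cut off by hand since
   [f \_ D] takes the value [point] outside [D], and [point : X] need not
   be 0. *)
Definition bochner (D : set T) (f : T -> X) : X :=
  xget 0 [set v | is_bochner_integral (fun z => if z \in D then f z else 0) v].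

End bochner.

Section operators.
Context {R : realType} {X : completeNormedModType R}.
Variable ip : {dot X for idfun}.
Implicit Types S T Q : X -> X.

Definition bounded_linear_op T : Prop :=
  linear T /\ exists M : R, forall x, `|T x| <= M * `|x|.

Definition op_norm T : R := sup [set `|T x| | x in [set x | `|x| <= 1]].

Definition is_adjoint T S : Prop := forall x y, ip (T x) y = ip x (S y).

Definition adjoint T : X -> X := xget (fun=> 0) [set S | is_adjoint T S].

Definition nonneg_op T : Prop :=
  [/\ bounded_linear_op T, is_adjoint T T & forall x, 0 <= ip (T x) x].

Definition sqrt_op Q : X -> X :=
  xget (fun=> 0) [set S | nonneg_op S /\ S \o S = Q].

Definition abs_op T : X -> X := sqrt_op (adjoint T \o T).

Definition orthonormal_basis (E : set X) : Prop :=
  [/\ forall e, E e -> ip e e = 1,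
      forall e f, E e -> E f -> e != f -> ip e f = 0 &
      forall x, (forall e, E e -> ip x e = 0) -> x = 0].

(* Meant for nonnegative operators, for which the sum, possibly [+oo], does
   not depend on the orthonormal basis. *)
Definition op_trace T : \bar R :=
  (\esum_(e in xget set0 [set E | orthonormal_basis E]) (ip (T e) e)%:E)%E.

Definition trace_class T : Prop :=
  bounded_linear_op T /\ (op_trace (abs_op T) < +oo)%E.

End operators.

Section gaussian.
Context {R : realType}.

(* [normal_prob m s] takes the standard deviation [s] and is a junk value for
   [s = 0]. *)
Definition gaussian1 (m v : R) (A : set R) : \bar R :=
  if v == 0 then \d_m A else normal_prob m (Num.sqrt v) A.

Context {X : completeNormedModType R}.
Variable ip : {dot X for idfun}.

(* Taking h := h1 + h2 also gives Cov(<x,h1>, <x,h2>) = <Q h1, h2> for a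
   self-adjoint Q. *)
Definition is_gaussian (nu : probability (borel X) R) (a : X) (Q : X -> X) :=
  forall (h : X) (A : set R), measurable A ->
    nu ((fun x => ip x h) @^-1` A) = gaussian1 (ip a h) (ip (Q h) h) A.

(* Total: the Dirac mass is a junk value for the [Q] that are not the
   covariance of a Gaussian measure. *)
Definition gaussian_measure (a : X) (Q : X -> X) : probability (borel X) R :=
  if pselect (exists nu, is_gaussian nu a Q) is left ex then projT1 (cid ex)
  else \d_(a : borel X).

End gaussian.

Section evolution.
Context {R : realType} {X : completeNormedModType R}.
Variable ip : {dot X for idfun}.

Definition partial_linear_op (D : set X) (A : X -> X) : Prop :=
  [/\ D 0,
      forall k x y, D x -> D y -> D (k *: x + y) &
      forall k x y, D x -> D y -> A (k *: x + y) = k *: A x + A y].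

(* [U t s] is only constrained for [s <= t]. The derivative in [t] is the
   strong one, and [A t] has domain [DA t]. *)
Definition generates_evolution (DA : R -> set X) (A : R -> X -> X)
    (U : R -> R -> X -> X) : Prop :=
  (forall t, partial_linear_op (DA t) (A t)) /\
  [/\ forall s t, s <= t -> bounded_linear_op (U t s),
      forall s t x, s < t ->
        DA t (U t s x) /\
        is_derive t 1 (fun r : R => U r s x) (A t (U t s x)),
      forall s r t x, s <= r -> r <= t -> U t s x = U t r (U r s x),
      forall t x, U t t x = x &
      forall x, {within [set p : R * R | p.2 <= p.1],
                 continuous (fun p : R * R => U p.1 p.2 x)}].

Variable U : R -> R -> X -> X.

Definition growth_bounds : set R :=
  [set w | exists2 M : R, 0 < M &
     forall s t, s <= t -> op_norm (U t s) <= M * expR (w * (t - s))].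

(* In [\bar R], as the set may be unbounded below. *)
Definition growth_rate : \bar R := ereal_inf (EFin @` growth_bounds).

Variable B : R -> X -> X.

(* The operator-valued integral is taken in the strong sense. *)
Definition covariance (t : R) (J : set R) (x : X) : X :=
  bochner lebesgue_measure J
    (fun r => U t r (B r (adjoint ip (B r) (adjoint ip (U t r) x)))).

Definition Qcov (t s : R) : X -> X := covariance t `[s, t].

Definition Qcov_ninfty (t : R) : X -> X := covariance t `]-oo, t].

Definition transition (s t : R) (phi : X -> R) (x : X) : R :=
  \int[gaussian_measure ip 0 (Qcov t s)]_y phi (U t s x + y).

Definition vtransition (s t : R) (Phi : X -> X) (x : X) : X :=
  bochner (gaussian_measure ip 0 (Qcov t s)) setT (fun y => Phi (U t s x + y)).

Definition invariant_family (t : R) : probability (borel X) R :=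
  gaussian_measure ip 0 (Qcov_ninfty t).

End evolution.

(* Measurable from R with its Lebesgue sigma-algebra to X with its Borel one. *)
Definition lebesgue_measurable_fun {R : realType} {X : ptopologicalType}
    (f : R -> X) : Prop :=
  measurable_fun
    (setT : set (g_sigma_algebraType (completed_algebra_gen
                   (@lebesgue_measure R))))
    (f : _ -> borel X).

(* Main.v *)
Require Import Defs.
From HB Require Import structures.
From mathcomp Require Import all_boot all_order all_algebra.
From mathcomp Require Import finmap.
From mathcomp Require Import all_classical all_reals all_analysis.
From mathcomp Require Import measurable_realfun ring lra zify.
Set Implicit Arguments.
Unset Strict Implicit.
Unset Printing Implicit Defensive.
Import Order.TTheory GRing.Theory Num.Theory.
Import numFieldNormedType.Exports.
Local Open Scope classical_set_scope.
Local Open Scope ring_scope.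

(** The law [mu_t] is that of the state at time [t] of the linear system driven
    by white noise since time [-oo]. What happened before [s] reaches time [t]
    through [U(t,s)], and what happens between [s] and [t] contributes an
    independent Gaussian vector of covariance [Q(t,s)], so that
<<
    Q(t,-oo) = Q(t,s) + U(t,s) Q(s,-oo) U(t,s)^*.
>>
    Therefore, if [x] has law [mu_s] and [y] is an independent vector of law
    [N(0, Q(t,s))], the vector [U(t,s) x + y] is Gaussian with the covariance of
    [mu_t]: characteristic functionals multiply, and they determine a measure
    ([gaussian_affine_integral], [hilbert_char_unique]). The left-hand sides of
    the two identities are the integrals of [phi (U(t,s) x + y)] and of
    [Phi (U(t,s) x + y)] by Fubini's theorem; the vector-valued identity is
    tested against all vectors ([gaussian_affine_bochner]).

    This argument rests on three constructions.

    Gaussian measures exist for every nonnegative operator of finite trace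
    ([gaussian_measure_exists]). A sequence of independent normal variables is
    obtained from the binary digits of a uniform variable ([iid_normal_exists]).
    A Cholesky factorisation of the covariance form along an orthonormal basis
    turns it into random coordinates with the required covariances; the trace
    bounds the mean of their sum of squares, so they are almost surely the
    coordinates of a vector.

    A characteristic functional determines a measure ([char_unique]). The
    bounded functions that may be multiplied into an integrand without
    distinguishing two measures with equal functionals form an algebra which
    contains the functions [cos (l + c)] and is closed under bounded limits;
    hence it contains the indicators of half-spaces, which generate the Borel
    sets of a separable Hilbert space ([borel_halfspacesE]).

    Bochner integrals are computed weakly: if [f] agrees off a null set with a
    weakly measurable function of integrable norm, then the scalar products of
    its integral are the integrals of its scalar products ([bochner_ip]). As
    [B] is only Lebesgue measurable, the integrands of the covariance operators
    are made Borel off one null set first ([weak_borel_off_null]). The splitting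
    above then is additivity of scalar integrals ([Qcov_ninfty_split]). It also
    bounds the trace of [Q(t,-oo)]: by the exponential decay of [U], the term
    coming from times before [s] tends to [0] as [s] tends to [-oo]
    ([sum_Qcov_ninfty_bounded]). *)

(** * Orthonormal bases of a Hilbert space *)

Section hilbert.
Context {R : realType} {X : completeNormedModType R} (ip : {dot X for idfun}).
Hypothesis ip_norm : forall x : X, ip x x = `|x| ^+ 2.
Implicit Types (x y z : X) (k : R).

Lemma ipC x y : ip x y = ip y x.
Proof. by have := hermC ip x y; rewrite expr0 mul1r. Qed.

Lemma ipDl x y z : ip (x + y) z = ip x z + ip y z.
Proof. exact: linearDl. Qed.

Lemma ipDr x y z : ip x (y + z) = ip x y + ip x z.
Proof. by rewrite !(ipC x) ipDl. Qed.

Lemma ipZl k x y : ip (k *: x) y = k * ip x y.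
Proof. exact: linearZl_LR. Qed.

Lemma ipZr k x y : ip x (k *: y) = k * ip x y.
Proof. by rewrite !(ipC x) ipZl. Qed.

Lemma ip0l x : ip 0 x = 0.
Proof. by rewrite -(scale0r 0) ipZl mul0r. Qed.

Lemma ip0r x : ip x 0 = 0.
Proof. by rewrite ipC ip0l. Qed.

Lemma ipNl x y : ip (- x) y = - ip x y.
Proof. by rewrite -scaleN1r ipZl mulN1r. Qed.

Lemma ipNr x y : ip x (- y) = - ip x y.
Proof. by rewrite !(ipC x) ipNl. Qed.

Lemma ipBl x y z : ip (x - y) z = ip x z - ip y z.
Proof. by rewrite ipDl ipNl. Qed.

Lemma ipBr x y z : ip x (y - z) = ip x y - ip x z.
Proof. by rewrite ipDr ipNr. Qed.

Lemma ip_suml n (f : nat -> X) y :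
  ip (\sum_(i < n) f i) y = \sum_(i < n) ip (f i) y.
Proof.
by elim: n => [|n IH]; rewrite ?big_ord0 ?ip0l// !big_ord_recr/= ipDl IH.
Qed.

Lemma ip_sumr n (f : nat -> X) y :
  ip y (\sum_(i < n) f i) = \sum_(i < n) ip y (f i).
Proof. by rewrite ipC ip_suml; apply: eq_bigr => i _; rewrite ipC. Qed.

Lemma cauchy_schwarz x y : `|ip x y| <= `|x| * `|y|.
Proof.
have [->|y0] := eqVneq y 0; first by rewrite ip0r !normr0 mulr0.
have ny : 0 < `|y| by rewrite normr_gt0.
rewrite -(@ler_pXn2r _ 2)// ?nnegrE ?mulr_ge0// real_normK ?num_real//.
have : 0 <= ip (x - (ip x y / `|y| ^+ 2) *: y) (x - (ip x y / `|y| ^+ 2) *: y).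
  by rewrite ip_norm sqr_ge0.
rewrite ipBl !ipBr !ipZl !ipZr !ip_norm (ipC y x).
have ny2 : 0 < `|y| ^+ 2 by rewrite exprn_gt0.
rewrite -(pmulr_rge0 _ ny2) => h.
rewrite exprMn -subr_ge0 (le_trans h)//.
rewrite le_eqVlt; apply/orP; left; apply/eqP; field.
by rewrite lt0r_neq0.
Qed.

Lemma ip_extl x y : (forall z, ip x z = ip y z) -> x = y.
Proof.
move=> xy; apply/eqP; rewrite -subr_eq0 -normr_eq0.
by rewrite -sqrf_eq0 -ip_norm ipBl xy subrr.
Qed.

Lemma cvg_ipl {T} {F : set_system T} {FF : Filter F} (f : T -> X) x y :
  f z @[z --> F] --> x -> ip (f z) y @[z --> F] --> ip x y.
Proof.
move=> fx; apply/cvgrPdist_lt => e e0.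
have y1 : 0 < `|y| + 1 by rewrite ltr_wpDl.
have ey : 0 < e / (`|y| + 1) by rewrite divr_gt0.
move/cvgrPdist_lt : fx => /(_ _ ey); apply: filterS => z.
rewrite ltr_pdivlMr// => h.
rewrite -ipBl (le_lt_trans (cauchy_schwarz _ _))// (le_lt_trans _ h)//.
by rewrite ler_wpM2l// lerDl.
Qed.

Lemma continuous_ipl y : continuous (fun x => ip x y).
Proof. by move=> x; exact: cvg_ipl. Qed.

Lemma cvg_ip {T} {F : set_system T} {FF : Filter F} (f g : T -> X) x y :
  f z @[z --> F] --> x -> g z @[z --> F] --> y ->
  ip (f z) (g z) @[z --> F] --> ip x y.
Proof.
move=> fx gy.
have polar u v : ip u v = 4^-1 * (`|u + v| ^+ 2 - `|u - v| ^+ 2).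
  rewrite -!ip_norm ipBl !ipBr ipDl !ipDr (ipC v u); by field.
rewrite polar; under eq_fun do rewrite polar.
apply: cvgMr; apply: cvgB.
  by under eq_fun do rewrite expr2; rewrite expr2; apply: cvgM; apply: cvg_norm; exact: cvgD.
by under eq_fun do rewrite expr2; rewrite expr2; apply: cvgM; apply: cvg_norm; exact: cvgB.
Qed.

(** Orthonormal sequences are allowed to vanish at some indices, so that a
    finite basis is enumerated by all of [nat] too. *)
Definition orthonormal_seq (e : nat -> X) : Prop :=
  (forall n, e n = 0 \/ ip (e n) (e n) = 1) /\
  (forall n m, n != m -> ip (e n) (e m) = 0).

Definition total_seq (e : nat -> X) : Prop :=
  forall x, (forall n, ip x (e n) = 0) -> x = 0.

(** A maximal orthonormal set is a basis: a nonzero vector orthogonal to it could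
    be normalised and added. *)
Lemma orthonormal_basis_exists : exists E, orthonormal_basis ip E.
Proof.
pose on (E : set X) := (forall e, E e -> ip e e = 1) /\
  (forall e f, E e -> E f -> e != f -> ip e f = 0).
have [|E [[E1 E2] Emax]] := @Zorn_bigcup X on.
  move=> F /= Fon tF; split=> [e [A FA Ae]|e f [A FA Ae] [B FB Bf] ef].
    exact: (Fon _ FA).1.
  have [AB|BA] := tF _ _ FA FB.
    by apply: (Fon _ FB).2 => //; exact: AB.
  by apply: (Fon _ FA).2 => //; exact: BA.
exists E; split => // x xE; apply/eqP/negPn/negP => x0.
have nx : `|x| != 0 by rewrite normr_eq0.
pose u := `|x|^-1 *: x.
have uu : ip u u = 1.
  by rewrite /u ipZl ipZr ip_norm; field.
have uE f : E f -> ip u f = 0 by move=> Ef; rewrite /u ipZl xE// mulr0.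
have Eu : ~ E u by move=> /uE; rewrite uu => /eqP; rewrite oner_eq0.
apply: (Emax (E `|` [set u])).
  split; first by move=> z Ez; left.
  by move=> /(_ u (or_intror erefl)).
split=> [e [/E1//|->//]|e f [Ee|->] [Ef|->]].
- exact: E2.
- by rewrite ipC uE.
- by rewrite uE.
- by rewrite eqxx.
Qed.

Lemma dist_orthonormal x y :
  ip x x = 1 -> ip y y = 1 -> ip x y = 0 -> `|x - y| ^+ 2 = 2.
Proof.
by move=> xx yy xy; rewrite -ip_norm ipBl !ipBr (ipC y x) xx yy xy; ring.
Qed.

(** Distinct elements of an orthonormal set are at distance [sqrt 2], so points
    of a dense set that approximate them to within [1/2] are distinct. *)
Lemma orthonormal_basis_enum (sepX : separable X) E :
  orthonormal_basis ip E ->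
  exists e : nat -> X, [/\ orthonormal_seq e, total_seq e &
    forall n, e n = 0 \/ E (e n)].
Proof.
move=> [E1 E2 E3]; have [D [cD dD]] := sepX.
have /choice[a aP] : forall x : X, exists d, D d /\ `|x - d| < 2^-1.
  move=> x; have [|d [/= bd Dd]] := dD (ball x (2^-1 : R)) _ (ball_open _ _).
    by exists x; apply: ballxx; rewrite invr_gt0.
  by exists d; split => //; move: bd; rewrite -ball_normE.
have /countable_injP[g ginj] := cD.
pose h := g \o a.
have hinj : {in E &, injective h}.
  move=> x y /set_mem Ex /set_mem Ey xy.
  apply/eqP/negPn/negP => nxy.
  have axy : a x = a y.
    by apply: ginj => //; apply/mem_set; [exact: (aP x).1|exact: (aP y).1].
  have := dist_orthonormal (E1 _ Ex) (E1 _ Ey) (E2 _ _ Ex Ey nxy).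
  have : `|x - y| < 1.
    rewrite (_ : x - y = (x - a x) - (y - a y)); last first.
      by rewrite axy opprB addrA subrK.
    rewrite (le_lt_trans (ler_normB _ _))//.
    have := (aP x).2; have := (aP y).2; lra.
  have := normr_ge0 (x - y); nra.
pose e n : X := xget 0 [set x | E x /\ h x = n].
have eP n : e n = 0 \/ (E (e n) /\ h (e n) = n).
  by rewrite /e; case: xgetP => [x _ /= [Ex hx]|_]; [right|left].
exists e; split.
- split=> [n|n m nm].
    by have [->|[/E1]] := eP n; [left|right].
  have [->|[En hn]] := eP n; first by rewrite ip0l.
  have [->|[Em hm]] := eP m; first by rewrite ip0r.
  by apply: E2 => //; apply: contra_neq nm => enm; rewrite -hn -hm enm.
- move=> x xe; apply: E3 => f Ef.
  have [e0|[Ee hh]] := eP (h f).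
    move: e0; rewrite /e; case: xgetP => [z _ /= [Ez _]/esym z0|/(_ f)[]//].
    by move: (E1 _ Ez); rewrite -z0 ip0l => /eqP; rewrite eq_sym oner_eq0.
  rewrite -(xe (h f)); congr (ip x _); apply: hinj; rewrite ?inE//.
- by move=> n; have [->|[En _]] := eP n; [left|right].
Qed.

End hilbert.

(** * Basis expansions, the Riesz theorem and adjoints *)

Lemma sum_ord_sub (V : zmodType) (f : nat -> V) m n : (m <= n)%N ->
  \sum_(i < n) f i - \sum_(i < m) f i =
  \sum_(i < n) (if (i < m)%N then 0 else f i).
Proof.
move=> mn; rewrite (big_ord_widen _ f mn) [X in _ - X]big_mkcond/= -sumrB.
by apply: eq_bigr => i _; case: ifP; rewrite ?subrr ?subr0.
Qed.

Section hilbert_basis.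
Context {R : realType} {X : completeNormedModType R} (ip : {dot X for idfun}).
Hypothesis ip_norm : forall x : X, ip x x = `|x| ^+ 2.
Context (e : nat -> X).
Hypothesis e_on : orthonormal_seq ip e.
Hypothesis e_total : total_seq ip e.
Implicit Types (x y z : X) (a : nat -> R).

Lemma ip_sum_basis a n m :
  ip (\sum_(i < n) a i *: e i) (e m) =
  if (m < n)%N then a m * ip (e m) (e m) else 0.
Proof.
rewrite (ip_suml ip n (fun i => a i *: e i)).
case: ifPn => [mn|]; last first.
  rewrite -leqNgt => nm; rewrite big1// => i _.
  by rewrite ipZl e_on.2 ?mulr0// ltn_eqF// (leq_trans (ltn_ord i)).
rewrite (bigD1 (Ordinal mn))//= ipZl big1 ?addr0// => i im.
by rewrite ipZl e_on.2 ?mulr0.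
Qed.

Lemma basis_sq_le1 n : 0 <= ip (e n) (e n) <= 1.
Proof. by case: (e_on.1 n) => ->; rewrite ?ip0l ?lexx ler01. Qed.

Lemma norm_sum_basis a n :
  `|\sum_(i < n) a i *: e i| ^+ 2 = \sum_(i < n) a i ^+ 2 * ip (e i) (e i).
Proof.
rewrite -ip_norm (ip_sumr ip n (fun i => a i *: e i)); apply: eq_bigr => i _.
by rewrite ipZr ip_sum_basis ltn_ord; ring.
Qed.

(** By Pythagoras, the squared increments of the partial sums are increments of
    the bounded monotone sequence of the sums of squares. *)
Lemma cvg_sum_basis a (C : R) : (forall n, \sum_(i < n) a i ^+ 2 <= C) ->
  cvgn (fun n => \sum_(i < n) a i *: e i).
Proof.
move=> aC; apply/cauchy_cvgP; apply: cauchy_exP => eps eps0.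
pose s n := \sum_(i < n) a i ^+ 2.
have s_nd : nondecreasing_seq s.
  by apply/nondecreasing_seqP => n; rewrite /s big_ord_recr/= lerDl sqr_ge0.
have s_cvg : s @ \oo --> sup (range s).
  by apply: nondecreasing_cvgn => //; exists C => _ [n _ <-]; exact: aC.
have s_le n : s n <= sup (range s).
  apply: ub_le_sup; last by exists n.
  by exists C => _ [k _ <-]; exact: aC.
have eps2 : 0 < eps ^+ 2 by rewrite exprn_gt0.
move/cvgrPdist_lt : s_cvg => /(_ _ eps2)[N _ sN].
exists (\sum_(i < N) a i *: e i); exists N => // n /= Nn.
rewrite -ball_normE/=.
rewrite distrC (sum_ord_sub (fun i => a i *: e i))// -(@ltr_pXn2r _ 2) ?nnegrE ?(ltW eps0)//.
have -> : \sum_(i < n) (if (i < N)%N then 0 else a i *: e i) =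
    \sum_(i < n) (if (i < N)%N then 0 else a i) *: e i.
  by apply: eq_bigr => i _; case: ifP => // _; rewrite scale0r.
rewrite (norm_sum_basis (fun i => if (i < N)%N then 0 else a i)).
have := sN n Nn; have := sN N (leqnn _) => /=.
rewrite !ger0_norm ?subr_ge0// => h1 h2.
apply: (@le_lt_trans _ _ (s n - s N)); last first.
  by rewrite (le_lt_trans _ h1)// lerD2r.
rewrite /s (sum_ord_sub (fun i => a i ^+ 2))//; apply: ler_sum => i _.
case: ifP => _; first by rewrite expr0n mul0r.
by rewrite ler_piMr ?sqr_ge0//; case/andP: (basis_sq_le1 i).
Qed.

Lemma bessel x n : \sum_(i < n) ip x (e i) ^+ 2 <= `|x| ^+ 2.
Proof.
pose a i := ip x (e i).
have h : 0 <= ip (x - \sum_(i < n) a i *: e i) (x - \sum_(i < n) a i *: e i).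
  by rewrite ip_norm sqr_ge0.
move: h; rewrite ipBl !ipBr [ip (\sum_(i < n) _) x]ipC !ip_norm norm_sum_basis.
rewrite (ip_sumr ip n (fun i => a i *: e i)).
have -> : \sum_(i < n) ip x (a i *: e i) = \sum_(i < n) a i ^+ 2.
  by apply: eq_bigr => i _; rewrite ipZr.
have : \sum_(i < n) a i ^+ 2 * ip (e i) (e i) <= \sum_(i < n) a i ^+ 2.
  by apply: ler_sum => i _; rewrite ler_piMr ?sqr_ge0//; case/andP: (basis_sq_le1 i).
rewrite /a; lra.
Qed.

Lemma cvg_basis_expansion x : (\sum_(i < n) ip x (e i) *: e i) @[n --> \oo] --> x.
Proof.
have /cvg_ex[/= y xy] := @cvg_sum_basis (fun i => ip x (e i)) _ (bessel x).
suff {2}-> : x = y by [].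
apply/eqP; rewrite -subr_eq0; apply/eqP; apply: e_total => m.
apply/eqP; rewrite ipBl subr_eq0; apply/eqP.
have h : ip (\sum_(i < n) ip x (e i) *: e i) (e m) @[n --> \oo] --> ip y (e m).
  exact: cvg_ipl.
apply: cvg_unique h => //; apply: cvg_near_cst; exists m.+1 => // n /= mn.
rewrite (ip_sum_basis (fun i => ip x (e i))) mn.
by case: (e_on.1 m) => [->|->]; rewrite ?ip0r ?mulr1// mulr0.
Qed.

Lemma parseval x y :
  (\sum_(i < n) ip x (e i) * ip y (e i)) @[n --> \oo] --> ip x y.
Proof.
have h : ip (\sum_(i < n) ip x (e i) *: e i) y @[n --> \oo] --> ip x y.
  by apply: cvg_ipl => //; exact: cvg_basis_expansion.
apply: cvg_trans h.
apply: near_eq_cvg; apply: nearW => n.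
by rewrite (ip_suml ip n (fun i => ip x (e i) *: e i)); apply: eq_bigr => i _; rewrite ipZl (ipC _ y).
Qed.

End hilbert_basis.

Section bounded_operators.
Context {R : realType} {X : completeNormedModType R} (ip : {dot X for idfun}).
Hypothesis ip_norm : forall x : X, ip x x = `|x| ^+ 2.
Implicit Types (x y z : X) (T S : X -> X) (k : R).

Lemma bl_add T x y : bounded_linear_op T -> T (x + y) = T x + T y.
Proof. by move=> [lT _]; have := lT 1 x y; rewrite !scale1r. Qed.

Lemma bl0 T : bounded_linear_op T -> T 0 = 0.
Proof.
by move=> bT; have := bl_add 0 0 bT; rewrite addr0 => /esym/eqP; rewrite addrC -subr_eq0 addrK => /eqP.
Qed.

Lemma bl_scale T k x : bounded_linear_op T -> T (k *: x) = k *: T x.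
Proof. by move=> bT; have := bT.1 k x 0; rewrite !addr0 (bl0 bT) addr0. Qed.

Lemma bl_sub T x y : bounded_linear_op T -> T (x - y) = T x - T y.
Proof. by move=> bT; rewrite (bl_add _ _ bT) -scaleN1r (bl_scale _ _ bT) scaleN1r. Qed.

Lemma op_norm_ge0 T : bounded_linear_op T -> 0 <= op_norm T.
Proof.
move=> bT; apply: ub_le_sup; last by exists 0; rewrite /= ?normr0// (bl0 bT) normr0.
have [M TM] := bT.2; exists `|M| => _ [x /= x1 <-].
rewrite (le_trans (TM x))// (le_trans (ler_wpM2r (normr_ge0 _) (ler_norm M)))//.
by rewrite ler_piMr.
Qed.

Lemma op_normP T x : bounded_linear_op T -> `|T x| <= op_norm T * `|x|.
Proof.
move=> bT; have [->|x0] := eqVneq x 0; first by rewrite (bl0 bT) normr0 mulr0.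
have nx : 0 < `|x| by rewrite normr_gt0.
rewrite -ler_pdivrMr//.
have -> : `|T x| / `|x| = `|T (`|x|^-1 *: x)|.
  by rewrite (bl_scale _ _ bT) normrZ mulrC gtr0_norm ?invr_gt0.
apply: ub_le_sup; last first.
  exists (`|x|^-1 *: x) => //=; rewrite normrZ gtr0_norm ?invr_gt0//.
  by rewrite mulVf ?normr_eq0.
have [M TM] := bT.2; exists `|M| => _ [z /= z1 <-].
rewrite (le_trans (TM z))// (le_trans (ler_wpM2r (normr_ge0 _) (ler_norm M)))//.
by rewrite ler_piMr.
Qed.

Lemma bl_continuous T : bounded_linear_op T -> continuous T.
Proof.
move=> bT x; apply/cvgrPdist_lt => eps eps0.
have y1 : 0 < op_norm T + 1 by rewrite ltr_wpDl// op_norm_ge0.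
have : \forall z \near x, `|x - z| < eps / (op_norm T + 1).
  by apply: cvgr_dist_lt; [exact: cvg_id|rewrite divr_gt0].
apply: filterS => z; rewrite ltr_pdivlMr// => h.
rewrite -(bl_sub _ _ bT) (le_lt_trans (op_normP _ bT))// (le_lt_trans _ h)//.
by rewrite mulrC ler_wpM2l// lerDl.
Qed.

(** The functional determines the coordinates of its representing vector; they
    are square summable by testing the functional on their partial sums. *)
Lemma riesz_representation (e : nat -> X) (l : X -> R) (M : R) :
  orthonormal_seq ip e -> total_seq ip e ->
  (forall k x y, l (k *: x + y) = k * l x + l y) ->
  (forall x, `|l x| <= M * `|x|) -> exists v, forall x, l x = ip x v.
Proof.
move=> e_on e_total llin lM.
have l0 : l 0 = 0 by have := lM 0; rewrite normr0 mulr0 normr_le0 => /eqP.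
have lsum (a : nat -> R) n : l (\sum_(i < n) a i *: e i) = \sum_(i < n) a i * l (e i).
  elim: n => [|n IH]; first by rewrite !big_ord0.
  by rewrite !big_ord_recr/= addrC llin IH addrC.
pose a i := l (e i).
have aM n : \sum_(i < n) a i ^+ 2 <= M ^+ 2.
  set s := \sum_(i < n) _.
  have s0 : 0 <= s by apply: sumr_ge0 => i _; rewrite sqr_ge0.
  have ss : s ^+ 2 <= M ^+ 2 * s.
    have := lM (\sum_(i < n) a i *: e i); rewrite lsum.
    rewrite (_ : \sum_(i < n) _ = s)//.
    rewrite -(@ler_pXn2r _ 2) ?nnegrE ?(le_trans _ (lM _))//.
    rewrite real_normK ?num_real// exprMn (norm_sum_basis ip_norm)// => h.
    rewrite (le_trans h)// ler_wpM2l ?sqr_ge0//; apply: ler_sum => i _.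
    by rewrite ler_piMr ?sqr_ge0//; case/andP: (basis_sq_le1 e_on i).
  have := sqr_ge0 M; nra.
have /cvg_ex[/= v av] := cvg_sum_basis ip_norm e_on aM.
exists v => x.
have lcvg : l (\sum_(i < n) ip x (e i) *: e i) @[n --> \oo] --> l x.
  apply/cvgrPdist_lt => eps eps0.
  have M1 : 0 < `|M| + 1 by rewrite ltr_wpDl.
  have epsM : 0 < eps / (`|M| + 1) by rewrite divr_gt0.
  have /cvgrPdist_lt/(_ _ epsM) := @cvg_basis_expansion _ _ _ ip_norm _ e_on e_total x.
  apply: filterS => n; rewrite ltr_pdivlMr// => h.
  set z := \sum_(i < n) _ in h *.
  have -> : l x - l z = l (x - z).
    have -> : x - z = -1 *: z + x by rewrite scaleN1r addrC.
    by rewrite llin mulN1r addrC.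
  rewrite (le_lt_trans (lM _))// (le_lt_trans _ h)// mulrC ler_wpM2l//.
  by rewrite (le_trans (ler_norm M))// lerDl.
have icvg : ip (\sum_(i < n) a i *: e i) x @[n --> \oo] --> ip v x by exact: cvg_ipl.
rewrite (ipC ip x v); apply: cvg_unique lcvg _ => //; apply: cvg_trans icvg.
apply: near_eq_cvg; apply: nearW => n.
rewrite (lsum (fun i => ip x (e i))) (ip_suml ip n (fun i => a i *: e i)); apply: eq_bigr => i _.
by rewrite ipZl (ipC _ x) mulrC.
Qed.

Hypothesis sepX : separable X.

Lemma basis_seq_exists : exists e, orthonormal_seq ip e /\ total_seq ip e.
Proof.
have [E oE] := orthonormal_basis_exists ip_norm.
by have [e [e1 e2 _]] := orthonormal_basis_enum ip_norm sepX oE; exists e.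
Qed.

Lemma adjointP T : bounded_linear_op T -> is_adjoint ip T (adjoint ip T).
Proof.
move=> bT; rewrite /adjoint; case: xgetP => [S _ //|noS].
have [e [e_on e_total]] := basis_seq_exists.
have /choice[S SP] : forall y, exists v, forall x, ip (T x) y = ip x v.
  move=> y; apply: (@riesz_representation e _ (op_norm T * `|y|)) => //.
    by move=> k x z; rewrite (bl_add _ _ bT) (bl_scale _ _ bT) ipDl ipZl.
  move=> x; rewrite (le_trans (cauchy_schwarz ip_norm _ _))// mulrAC.
  by rewrite ler_wpM2r// op_normP.
by case: (noS S) => x y; rewrite SP.
Qed.

Lemma norm_adjoint_le T y : bounded_linear_op T ->
  `|adjoint ip T y| <= op_norm T * `|y|.
Proof.
move=> bT; have aT := adjointP bT.
have [->|y0] := eqVneq (adjoint ip T y) 0.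
  by rewrite normr0 mulr_ge0// op_norm_ge0.
rewrite -(@ler_pM2l _ `|adjoint ip T y|) ?normr_gt0// -expr2 -ip_norm -aT.
rewrite (le_trans (ler_norm _))// (le_trans (cauchy_schwarz ip_norm _ _))//.
by rewrite mulrA [X in _ <= X * _]mulrC ler_wpM2r// op_normP.
Qed.

End bounded_operators.

(** * Bounded measurable functions *)

Section bounded_functions.
Context d (T : measurableType d) (R : realType).
Implicit Types (f g : T -> R) (P : probability T R).

Definition bounded_measurable f : Prop :=
  measurable_fun setT f /\ exists M, forall x, `|f x| <= M.

Lemma bounded_measurable_integrable P f :
  bounded_measurable f -> P.-integrable setT (EFin \o f).
Proof.
move=> [mf [M fM]]; apply: measurable_bounded_integrable => //.
  exact: fin_num_fun_lty.
exists M; split; first exact: num_real.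
by move=> N MN x _; rewrite /= (le_trans (fM x))// ltW.
Qed.

Lemma bounded_measurable_cst (k : R) : bounded_measurable (fun=> k).
Proof. by split; [exact: measurable_cst|exists `|k|]. Qed.

Lemma bounded_measurableD f g : bounded_measurable f -> bounded_measurable g ->
  bounded_measurable (fun x => f x + g x).
Proof.
move=> [mf [M fM]] [mg [N gN]]; split; first exact: measurable_funD.
by exists (M + N) => x; rewrite (le_trans (ler_normD _ _))// lerD.
Qed.

Lemma bounded_measurableM f g : bounded_measurable f -> bounded_measurable g ->
  bounded_measurable (fun x => f x * g x).
Proof.
move=> [mf [M fM]] [mg [N gN]]; split; first exact: measurable_funM.
by exists (M * N) => x; rewrite normrM ler_pM.
Qed.

Lemma bounded_measurable_cos f :
  measurable_fun setT f -> bounded_measurable (fun x => cos (f x)).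
Proof.
move=> mf; split; last by exists 1 => x; rewrite ler_norml cos_geN1 cos_le1.
by apply: measurableT_comp => //; apply: continuous_measurable_fun; exact: continuous_cos.
Qed.

Lemma Rintegral_bounded_cvg P (f_ : nat -> T -> R) f (M : R) :
  (forall n, measurable_fun setT (f_ n)) -> (forall n x, `|f_ n x| <= M) ->
  (forall x, f_ n x @[n --> \oo] --> f x) ->
  bounded_measurable f /\ \int[P]_x f_ n x @[n --> \oo] --> \int[P]_x f x.
Proof.
move=> mf_ fM f_f.
have mf : measurable_fun setT f.
  by apply: (measurable_fun_cvg mf_) => // x _; exact: f_f.
have bf : bounded_measurable f.
  split => //; exists M => x.
  by apply: (cvgr_to_le (cvg_norm (f_f x))); apply: nearW => n; exact: fM.
split => //; apply: fine_cvg; rewrite fineK; last first.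
  exact: (integrable_fin_num _ (bounded_measurable_integrable P bf)).
have [] // := @dominated_convergence _ _ _ P setT measurableT (fun n => EFin \o f_ n)
  (EFin \o f) (EFin \o (fun=> M)).
- by move=> n; exact/measurable_EFinP.
- exact/measurable_EFinP.
- by apply: aeW => x _; apply: cvg_EFin; [exact: nearW|exact: f_f].
- exact: (bounded_measurable_integrable P (bounded_measurable_cst M)).
- by apply: aeW => x n _; rewrite /= lee_fin.
Qed.

Lemma RintegralDb P f g : bounded_measurable f -> bounded_measurable g ->
  \int[P]_x (f x + g x) = \int[P]_x f x + \int[P]_x g x.
Proof. by move=> bf bg; apply: RintegralD => //; exact: bounded_measurable_integrable. Qed.

Lemma RintegralZb P f (k : R) : bounded_measurable f ->
  \int[P]_x (k * f x) = k * \int[P]_x f x.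
Proof. by move=> bf; apply: RintegralZl => //; exact: bounded_measurable_integrable. Qed.

Lemma Rintegral_indic P (A : set T) : measurable A -> (\int[P]_x \1_A x)%:E = P A.
Proof. by move=> mA; rewrite /Rintegral integral_indic// setIT fineK// fin_num_measure. Qed.

End bounded_functions.

(** * Polynomial approximation of a step function *)

Section step_approximation.
Context {R : realType}.
Implicit Types w x : R.

(** This inequality gives both limits below: directly where [2 * w < 1], and
    through the bound [1 / (1 + w ^ n) ^ (2 ^ n)] where [1 < 2 * w]. *)
Lemma bernoulli_ge x m : -1 <= x -> 1 + m%:R * x <= (1 + x) ^+ m.
Proof.
move=> x1; elim: m => [|m IH]; first by rewrite mul0r addr0 expr0.
rewrite exprSr (le_trans _ (ler_wpM2r _ IH))//; last by lra.
have : 0 <= m%:R :> R by [].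
by rewrite -natr1; nra.
Qed.

Lemma cvg_step_lt w : 0 <= w < 2^-1 ->
  (1 - w ^+ n) ^+ (2 ^ n) @[n --> \oo] --> (1 : R).
Proof.
move=> /andP[w0 w1].
have wn n : 0 <= w ^+ n <= 1 by rewrite exprn_ge0//= exprn_ile1//; lra.
have h : 1 - (2 * w) ^+ n @[n --> \oo] --> (1 - 0 : R).
  apply: cvgB; first exact: cvg_cst.
  by apply: cvg_expr; rewrite ger0_norm; lra.
rewrite subr0 in h.
apply: (squeeze_cvgr _ h (cvg_cst (1 : R))); apply: nearW => n.
have /andP[a b] := wn n.
apply/andP; split; last by apply: exprn_ile1; lra.
have := @bernoulli_ge (- w ^+ n) (2 ^ n)%N.
by rewrite mulrN natrX -exprMn; apply; lra.
Qed.

Lemma cvg_step_gt w : 2^-1 < w <= 1 ->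
  (1 - w ^+ n) ^+ (2 ^ n) @[n --> \oo] --> (0 : R).
Proof.
move=> /andP[w0 w1].
have wn n : 0 <= w ^+ n <= 1 by rewrite exprn_ge0 ?exprn_ile1//; lra.
have h : ((2 * w)^-1) ^+ n @[n --> \oo] --> (0 : R).
  apply: cvg_expr; rewrite ger0_norm ?invr_ge0; last lra.
  by rewrite invf_lt1; lra.
apply: (squeeze_cvgr _ (cvg_cst (0 : R)) h); apply: nearW => n.
have /andP[a b] := wn n.
apply/andP; split; first by apply: exprn_ge0; lra.
rewrite exprVn -[leRHS]mul1r ler_pdivlMr ?exprn_gt0//; last by lra.
have h1 : (2 * w) ^+ n <= (1 + w ^+ n) ^+ (2 ^ n).
  rewrite (le_trans _ (@bernoulli_ge (w ^+ n) (2 ^ n)%N _))//; last by lra.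
  by rewrite natrX -exprMn; lra.
have h2 : (1 - w ^+ n) ^+ (2 ^ n) * (1 + w ^+ n) ^+ (2 ^ n) <= 1.
  rewrite -exprMn; apply: exprn_ile1; nra.
apply: le_trans h2; rewrite ler_wpM2l// exprn_ge0//; lra.
Qed.

End step_approximation.

(** * Measures with the same characteristic functional *)

Section characteristic_uniqueness.
Context d (T : measurableType d) (R : realType) (P1 P2 : probability T R).
Context (L : set (T -> R)).
Hypothesis L_measurable : forall l, L l -> measurable_fun setT l.
Hypothesis L0 : L (fun=> 0).
Hypothesis L_linear : forall k l m, L l -> L m -> L (fun x => k * l x + m x).
Hypothesis L_char : forall l c, L l ->
  \int[P1]_x cos (l x + c) = \int[P2]_x cos (l x + c).

(** The invariant to be propagated from the constant [1] to indicators: weighting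
    both measures by [f] keeps their characteristic functionals equal. *)
Definition same_char (f : T -> R) : Prop :=
  bounded_measurable f /\ forall l c, L l ->
    \int[P1]_x (f x * cos (l x + c)) = \int[P2]_x (f x * cos (l x + c)).

(** The functions that can be multiplied into an integrand without breaking the
    equality of the two integrals; they form an algebra closed under bounded
    pointwise limits, since a product of cosines is a sum of cosines. *)
Definition multiplier (m : T -> R) : Prop :=
  bounded_measurable m /\
  forall f, same_char f -> same_char (fun x => f x * m x).

Let bm_cos l c : L l -> bounded_measurable (fun x => cos (l x + c)).
Proof.
move=> Ll; apply: bounded_measurable_cos.
by apply: measurable_funD => //; exact: L_measurable.
Qed.

Lemma same_char1 : same_char (fun=> 1).
Proof.
split; first exact: bounded_measurable_cst.
by move=> l c Ll; under eq_Rintegral do rewrite mul1r;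
   under [RHS]eq_Rintegral do rewrite mul1r; exact: L_char.
Qed.

Lemma multiplier_ext m m' : m =1 m' -> multiplier m -> multiplier m'.
Proof. by move=> /funext->. Qed.

Lemma multiplier_cst k : multiplier (fun=> k).
Proof.
split=> [|f [bf fP]]; first exact: bounded_measurable_cst.
split=> [|l c Ll]; first by apply: bounded_measurableM => //; exact: bounded_measurable_cst.
have h (P : probability T R) : \int[P]_x (f x * k * cos (l x + c)) = k * \int[P]_x (f x * cos (l x + c)).
  rewrite -(RintegralZb P); last by apply: bounded_measurableM => //; exact: bm_cos.
  by apply: eq_Rintegral => x _; ring.
by rewrite !h fP.
Qed.

Lemma multiplierD m n : multiplier m -> multiplier n ->
  multiplier (fun x => m x + n x).
Proof.
move=> [bm mP] [bn nP]; split=> [|f sf]; first exact: bounded_measurableD.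
have [bfm fmP] := mP _ sf; have [bfn fnP] := nP _ sf.
split=> [|l c Ll].
  by apply: bounded_measurableM; [exact: sf.1|exact: bounded_measurableD].
have h (P : probability T R) : \int[P]_x (f x * (m x + n x) * cos (l x + c)) =
    \int[P]_x (f x * m x * cos (l x + c)) + \int[P]_x (f x * n x * cos (l x + c)).
  rewrite -RintegralDb; [|by apply: bounded_measurableM => //; exact: bm_cos..].
  by apply: eq_Rintegral => x _; ring.
by rewrite !h fmP// fnP.
Qed.

Lemma multiplierM m n : multiplier m -> multiplier n ->
  multiplier (fun x => m x * n x).
Proof.
move=> [bm mP] [bn nP]; split=> [|f sf]; first exact: bounded_measurableM.
have := nP _ (mP _ sf); rewrite (_ : (fun x => _) = (fun x => f x * (m x * n x)))//.
by apply/funext => x; rewrite mulrA.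
Qed.

Lemma multiplierX m n : multiplier m -> multiplier (fun x => m x ^+ n).
Proof.
move=> mm; elim: n => [|n IH]; first exact: (multiplier_cst 1).
apply: (multiplier_ext _ (multiplierM mm IH)) => x; exact/esym/exprS.
Qed.

Lemma multiplierN1 m : multiplier m -> multiplier (fun x => 1 - m x).
Proof.
move=> mm; have := multiplierD (multiplier_cst 1) (multiplierM (multiplier_cst (-1)) mm).
by apply: multiplier_ext => x; rewrite mulN1r.
Qed.

Lemma multiplier_cos l c : L l -> multiplier (fun x => cos (l x + c)).
Proof.
move=> Ll; split=> [|f [bf fP]]; first exact: bm_cos.
split=> [|l' c' Ll']; first by apply: bounded_measurableM => //; exact: bm_cos.
pose l1 x := 1 * l x + l' x; pose l2 x := -1 * l' x + l x.
have Ll1 : L l1 by exact: L_linear.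
have Ll2 : L l2 by exact: L_linear.
have h (P : probability T R) : \int[P]_x (f x * cos (l x + c) * cos (l' x + c')) =
    2^-1 * \int[P]_x (f x * cos (l1 x + (c + c'))) +
    2^-1 * \int[P]_x (f x * cos (l2 x + (c - c'))).
  have b1 := bounded_measurableM bf (bm_cos (c + c') Ll1).
  have b2 := bounded_measurableM bf (bm_cos (c - c') Ll2).
  rewrite -!(RintegralZb P)// -RintegralDb; last 2 first.
  - by apply: bounded_measurableM => //; exact: bounded_measurable_cst.
  - by apply: bounded_measurableM => //; exact: bounded_measurable_cst.
  apply: eq_Rintegral => x _.
  rewrite (_ : l1 x + _ = (l x + c) + (l' x + c')); last by rewrite /l1; ring.
  rewrite (_ : l2 x + _ = (l x + c) - (l' x + c')); last by rewrite /l2; ring.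
  by rewrite (cosD (l x + c)) (cosB (l x + c)); field.
by rewrite !h !fP.
Qed.

Lemma multiplier_cvg (m_ : nat -> T -> R) m M : (forall n, multiplier (m_ n)) ->
  (forall n x, `|m_ n x| <= M) -> (forall x, m_ n x @[n --> \oo] --> m x) ->
  multiplier m.
Proof.
move=> mm mM mcvg.
have bm : bounded_measurable m.
  by apply: (proj1 (Rintegral_bounded_cvg P1 _ mM mcvg)) => n; exact: (mm n).1.1.
split=> // f sf; have [bf fP] := sf.
split=> [|l c Ll]; first exact: bounded_measurableM.
have h (P : probability T R) : \int[P]_x (f x * m_ n x * cos (l x + c)) @[n --> \oo] -->
    \int[P]_x (f x * m x * cos (l x + c)).
  have [K fK] := bf.2; have [C cC] := (bm_cos c Ll).2.
  apply: (proj2 (@Rintegral_bounded_cvg _ _ _ P _ _ (K * M * C) _ _ _)).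
  - move=> n; apply: measurable_funM; last exact: (bm_cos c Ll).1.
    by apply: measurable_funM; [exact: bf.1|exact: (mm n).1.1].
  - by move=> n x; rewrite !normrM !ler_pM// ?mulr_ge0.
  - by move=> x; apply: cvgMl; apply: cvgMr; exact: mcvg.
have h12 : (fun n => \int[P1]_x (f x * m_ n x * cos (l x + c))) =
    (fun n => \int[P2]_x (f x * m_ n x * cos (l x + c))).
  by apply/funext => n; have [_ ->] := (mm n).2 _ sf.
have h2 := h P2; rewrite -h12 in h2.
by apply: (cvg_unique _ (h P1) h2).
Qed.

(** With [w = (1 + u) / 2], the polynomials [(1 - w ^ n) ^ (2 ^ n)] tend to [1]
    where [u < 0] and to [0] where [0 < u]. The extra factor [u] settles the
    points where [u = 0], so that [min u 0] is a multiplier; the powers of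
    [1 + min u 0] then tend to the indicator. *)
Lemma multiplier_ge0 u : multiplier u -> (forall x, `|u x| <= 1) ->
  multiplier (\1_[set x | 0 <= u x]).
Proof.
move=> mu u1; pose w x := 2^-1 * (1 + u x).
have mw : multiplier w.
  by apply: multiplierM; [exact: multiplier_cst|apply: multiplierD => //; exact: multiplier_cst].
have w01 x : 0 <= w x <= 1.
  by have := u1 x; rewrite ler_norml => /andP[a b]; rewrite /w; apply/andP; split; lra.
have q01 n x : 0 <= (1 - w x ^+ n) ^+ (2 ^ n) <= 1.
  have /andP[a b] := w01 x.
  have : 0 <= w x ^+ n <= 1 by rewrite exprn_ge0 ?exprn_ile1.
  by move=> /andP[? ?]; rewrite exprn_ge0 ?exprn_ile1//; lra.
have mneg : multiplier (fun x => Num.min (u x) 0).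
  apply: (@multiplier_cvg (fun n x => u x * (1 - w x ^+ n) ^+ (2 ^ n)) _ 1).
  - by move=> n; apply: multiplierM => //; apply/multiplierX/multiplierN1/multiplierX.
  - move=> n x; rewrite normrM mulr_ile1//.
    by have /andP[a b] := q01 n x; rewrite ger0_norm.
  - move=> x; have /andP[a b] := w01 x.
    have [ux|ux|->] := ltgtP (u x) 0.
    + rewrite -[X in _ --> X]mulr1; apply: cvgMr; apply: cvg_step_lt.
      by rewrite a/= /w; lra.
    + rewrite -[X in _ --> X](mulr0 (u x)); apply: cvgMr; apply: cvg_step_gt.
      by rewrite b andbT /w; lra.
    + by under eq_fun do rewrite mul0r; exact: cvg_cst.
apply: (@multiplier_cvg (fun n x => (1 + Num.min (u x) 0) ^+ n) _ 1).
- by move=> n; apply: multiplierX; apply: multiplierD => //; exact: multiplier_cst.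
- move=> n x; have := u1 x; rewrite ler_norml => /andP[a b].
  have v0 : Num.min (u x) 0 <= 0 by rewrite ge_min lexx orbT.
  have v1 : -1 <= Num.min (u x) 0 by rewrite le_min a lerN10.
  by rewrite ger0_norm ?exprn_ge0 ?exprn_ile1//; lra.
- move=> x; rewrite indicE; have := u1 x; rewrite ler_norml => /andP[a b].
  have [ux|ux] := ltP (u x) 0.
    rewrite memNset /=; last by move=> /le_lt_trans/(_ ux); rewrite ltxx.
    by apply: cvg_expr; rewrite ger0_norm; lra.
  rewrite mem_set//; under eq_fun do rewrite addr0 expr1n; exact: cvg_cst.
Qed.

(** Bounded functions of [l] such as [sin ((l - a) / n)] are multipliers, and for
    large [n] the argument lies in the interval where [sin] has its sign. *)
Lemma multiplier_halfspace l a : L l -> multiplier (\1_[set x | a <= l x]).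
Proof.
move=> Ll.
(* The cosine form of [sin ((l x - a) / n.+1)]. *)
pose u n x : R := cos ((n.+1%:R^-1 * l x + 0) + (- a / n.+1%:R - pi / 2)).
have uE n x : u n x = sin ((l x - a) / n.+1%:R).
  rewrite /u -cosBpihalf; congr cos; field.
  by rewrite addrC natr1 pnatr_eq0.
have mu n : multiplier (u n) by apply: multiplier_cos; exact: L_linear.
apply: (@multiplier_cvg (fun n => \1_[set x | 0 <= u n x]) _ 1).
- by move=> n; apply: multiplier_ge0 => // x; rewrite ler_norml cos_geN1 cos_le1.
- by move=> n x; rewrite indicE ger0_norm//; case: (_ \in _).
- move=> x; apply: cvg_near_cst.
  have [N Npi] : exists N : nat, forall n, (N <= n)%N -> `|(l x - a) / n.+1%:R| < pi.
    exists (Num.truncn `|(l x - a)|) => n Nn.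
    rewrite normrM normrV ?unitfE ?pnatr_eq0// normr_nat ltr_pdivrMr ?ltr0n//.
    have h : `|l x - a| < n.+1%:R.
      by rewrite (lt_le_trans (truncnS_gt _))// ler_nat ltnS.
    have := @pi_ge2 R; have : 0 <= `|l x - a| by []; nra.
  exists N => // n /= /Npi; rewrite !indicE; set y := _ / _ => ypi.
  congr (_ _)%:R; apply/idP/idP; rewrite !inE/= uE -/y.
    move=> siny; rewrite leNgt; apply/negP => la.
    have y0 : y < 0 by rewrite /y pmulr_llt0 ?invr_gt0 ?ltr0n// subr_lt0.
    have : 0 < sin (- y).
      by apply: sin_gt0_pi; rewrite oppr_gt0 y0/= -ltr0_norm.
    by rewrite sinN oppr_gt0 ltNge siny.
  move=> al; apply: sin_ge0_pi.
  have y0 : 0 <= y by rewrite /y mulr_ge0// subr_ge0.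
  by rewrite y0/= ltW// -(ger0_norm y0).
Qed.

Lemma sigma_algebra_multiplier :
  sigma_algebra setT [set A : set T | multiplier (\1_A : T -> R)].
Proof.
have mC A : multiplier (\1_A : T -> R) -> multiplier (\1_(~` A) : T -> R).
  move=> mA; apply: (multiplier_ext _ (multiplierN1 mA)) => x.
  by rewrite !indicE in_setC; case: (x \in A); rewrite ?subrr ?subr0.
split=> /=.
- by apply: (multiplier_ext _ (multiplier_cst 0)) => x; rewrite indic0.
- by move=> A mA; rewrite setTD; exact: mC.
- move=> A mA; rewrite -(setCK (\bigcup_k A k)) setC_bigcup; apply: (mC _ _).
  apply: (@multiplier_cvg (fun n => \1_(\bigcap_(k < n) ~` A k)) _ 1).
  + elim=> [|n IH].
      by apply: (multiplier_ext _ (multiplier_cst 1)) => x; rewrite bigcap_mkord big_ord0 indicT.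
    apply: (multiplier_ext _ (multiplierM IH (mC _ (mA n)))) => x.
    by rewrite !bigcap_mkord big_ord_recr/= indicI.
  + by move=> n x; rewrite indicE ger0_norm//; case: (_ \in _).
  + move=> x; apply: cvg_near_cst.
    have [xA|/existsNP[k /not_implyP[_ xA]]] := pselect ((\bigcap_k ~` A k) x).
      by apply: nearW => n; rewrite !indicE !mem_set// => k _; exact: xA.
    exists k.+1 => // n /= kn; rewrite !indicE !memNset// => h; apply: xA; exact: h.
Qed.

(** A characteristic functional determines a measure on the sigma-algebra
    generated by the linear functionals: indicators of half-spaces are
    multipliers, hence so are those of all generated sets, and multiplying the
    constant [1] by an indicator gives the measure of the set. *)
Lemma char_unique A : <<s [set [set x | a <= l x] | a in setT & l in L] >> A ->
  measurable A -> P1 A = P2 A.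
Proof.
move=> sA mA; have [_ mP] : multiplier (\1_A : T -> R).
  apply: (smallest_sub sigma_algebra_multiplier _ sA) => _ [a _ [l Ll <-]].
  exact: multiplier_halfspace.
have [_ /(_ (fun=> 0) 0 L0)] := mP _ same_char1.
under eq_Rintegral do rewrite addr0 cos0 mul1r mulr1.
under [RHS]eq_Rintegral do rewrite addr0 cos0 mul1r mulr1.
by move=> h; rewrite -!Rintegral_indic// h.
Qed.

End characteristic_uniqueness.

(** * The characteristic function of the normal distribution *)

Section normal_characteristic_function.
Context {R : realType}.
Local Notation mu := (@lebesgue_measure R).

(** On [[-n, n]] the integral is [F n - F (- n)], which is at most [2 C / n]. *)
Lemma integral_derive_eq0 (F f : R -> R) (C : R) : (forall x : R, is_derive x (1 : R) F (f x)) ->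
  continuous f -> mu.-integrable setT (EFin \o f) ->
  (forall x, `|x| * `|F x| <= C) -> (\int[mu]_x (f x)%:E)%E = 0%E.
Proof.
move=> dF cf intf FC.
have F0 (u : nat -> R) : (forall n, `|u n| = n.+1%:R) ->
    F (u n) @[n --> \oo] --> (0 : R).
  move=> un; apply/norm_cvg0P.
  have h : C * harmonic n @[n --> \oo] --> (0 : R).
    by rewrite -[X in _ --> X](mulr0 C); apply: cvgMr; exact: cvg_harmonic.
  apply: (squeeze_cvgr _ (cvg_cst (0 : R)) h); apply: nearW => n.
  by rewrite normr_ge0/= /harmonic ler_pdivlMr// mulrC -un.
have dFE (x : R) : F^`()%classic x = f x by rewrite derive1E; have [_ ->] := dF x.
have cF : continuous F.
  move=> x; apply: differentiable_continuous; apply/derivable1_diffP.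
  by have [] := dF x.
have h1 : (\int[mu]_(x in `[(- n.+1%:R)%R, n.+1%:R]) (f x)%:E)%E @[n --> \oo] --> 0%E.
  have -> : (fun n : nat => (\int[mu]_(x in `[(- n.+1%:R : R)%R, n.+1%:R]) (f x)%:E)%E) =
      (fun n : nat => (F n.+1%:R - F (- n.+1%:R))%:E).
    apply/funext => n; rewrite (@continuous_FTC2 _ f F).
    - by rewrite EFinB.
    - by apply: (@lt_trans _ _ 0); rewrite ?oppr_lt0 ltr0n.
    - exact/continuous_subspaceT.
    - split=> [x _||].
      + by have [] := dF x.
      + by apply: cvg_at_right_filter; exact: cF.
      + by apply: cvg_at_left_filter; exact: cF.
    - by move=> x _; exact: dFE.
  apply: cvg_EFin; first exact: nearW.
  rewrite -[X in _ --> X](subr0 (0 : R)); apply: cvgB; apply: F0 => n.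
    by rewrite normr_nat.
  by rewrite normrN normr_nat.
have mf : measurable_fun setT f by exact: continuous_measurable_fun.
pose fn n := (EFin \o f) \_ `[(- n.+1%:R)%R, n.+1%:R].
have h1' : (\int[mu]_x fn n x)%E @[n --> \oo] --> 0%E.
  by under eq_fun do rewrite -integral_mkcond; exact: h1.
suff [_ _ h2] : [/\ mu.-integrable setT (EFin \o f),
    [sequence (\int[mu]_x `|fn n x - (EFin \o f) x|)%E]_n @ \oo --> 0%E &
    [sequence (\int[mu]_x fn n x)%E]_n @ \oo --> (\int[mu]_x (EFin \o f) x)%E].
  exact: (cvg_unique _ h2 h1').
apply: (@dominated_convergence _ _ _ mu setT measurableT fn (EFin \o f)
  (abse \o (EFin \o f))).
- move=> n; apply/(measurable_restrictT _ _).1 => //.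
  by apply: measurable_funTS; exact/measurable_EFinP.
- exact/measurable_EFinP.
- apply: aeW => x _; apply: cvg_near_cst.
  exists (Num.truncn `|x|) => // n /= xn; rewrite /fn patchE mem_set//=.
  have : `|x| < n.+1%:R by rewrite (lt_le_trans (truncnS_gt _))// ler_nat ltnS.
  by rewrite ltr_norml in_itv/= => /andP[/ltW-> /ltW->].
- exact: integrable_abse.
- by apply: aeW => x n _; rewrite /fn patchE; case: ifP => // _; rewrite abse0 abse_ge0.
Qed.

Variable s : R.
Hypothesis s0 : s != 0.

Let g (x : R) : R := normal_pdf 0 s x.
Let s2 : 0 < s ^+ 2. Proof. by rewrite exprn_even_gt0. Qed.

Let gE x : g x = normal_peak s * expR (- (2 * s ^+ 2)^-1 * x ^+ 2).
Proof.
rewrite /g normal_pdfE// /normal_fun subr0; congr (_ * expR _).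
by rewrite -(mulr_natl (s ^+ 2)); field.
Qed.

Let dg (x : R) : is_derive x (1 : R) g (- x / s ^+ 2 * g x).
Proof.
have -> : g = (fun x => normal_peak s * expR (- (2 * s ^+ 2)^-1 * x ^+ 2)).
  by apply/funext => y; exact: gE.
apply: is_derive_eq; rewrite /GRing.scale/=.
by field.
Qed.

(** The loss of a factor [2] in the standard deviation absorbs [`|x|]. *)
Lemma normal_pdf_absM_le : exists2 C, 0 <= C &
  forall x, `|x| * normal_pdf 0 s x <= C * normal_pdf 0 (2 * s) x.
Proof.
have s20 : 2 * s != 0 by rewrite mulf_neq0// pnatr_eq0.
pose a : R := 3 / (8 * s ^+ 2).
have a0 : 0 < a by apply: divr_gt0 => //; apply: mulr_gt0.
have p1 := normal_peak_gt0 s0; have p2 := normal_peak_gt0 s20.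
exists (normal_peak s * (1 + a^-1) / normal_peak (2 * s)).
  rewrite divr_ge0 ?mulr_ge0 ?normal_peak_ge0//.
  by rewrite addr_ge0// invr_ge0 ltW.
move=> y; rewrite !normal_pdfE// /normal_fun !subr0.
rewrite [leRHS](_ : _ = normal_peak s * ((1 + a^-1) *
    expR (- y ^+ 2 / ((2 * s) ^+ 2 *+ 2)))); last by field; rewrite ?gt_eqF.
rewrite mulrCA ler_wpM2l ?(ltW p1)//.
have -> : - y ^+ 2 / (s ^+ 2 *+ 2) = - y ^+ 2 / ((2 * s) ^+ 2 *+ 2) - a * y ^+ 2.
  by rewrite /a -(mulr_natl (s ^+ 2)) -(mulr_natl ((2 * s) ^+ 2)); field.
rewrite expRD mulrCA [leRHS]mulrC ler_wpM2l ?expR_ge0//.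
rewrite expRN ler_pdivrMr ?expR_gt0//.
apply: (@le_trans _ _ ((1 + a^-1) * (1 + a * y ^+ 2))).
  have -> : (1 + a^-1) * (1 + a * y ^+ 2) = 1 + y ^+ 2 + (a^-1 + a * y ^+ 2).
    by field; rewrite gt_eqF.
  have : 0 <= a^-1 + a * y ^+ 2.
    apply: addr_ge0; first by rewrite invr_ge0 ltW.
    by rewrite mulr_ge0 ?sqr_ge0// ltW.
  have : `|y| <= 1 + y ^+ 2.
    by rewrite -(real_normK (num_real y)); have := normr_ge0 y; nra.
  lra.
by rewrite ler_wpM2l ?expR_ge1Dx// addr_ge0// invr_ge0 ltW.
Qed.

Let g_ge0 x : 0 <= g x. Proof. exact: normal_pdf_ge0. Qed.

Let integrable_gM (th : R -> R) : continuous th -> (forall x, `|th x| <= 1) ->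
  mu.-integrable setT (EFin \o (fun x => g x * th x)).
Proof.
move=> cth th1.
have := integrable_normal_pdf (0 : R) s; apply: le_integrable => //.
  apply/measurable_EFinP; apply: measurable_funM; first exact: measurable_normal_pdf.
  exact: continuous_measurable_fun.
move=> x _; rewrite /= lee_fin normrM (ger0_norm (g_ge0 x)).
by rewrite ler_piMr.
Qed.

Let integrable_abs_g : mu.-integrable setT (EFin \o (fun x => `|x| * g x)).
Proof.
have [C C0 gC] := normal_pdf_absM_le.
have := integrableZl measurableT C (integrable_normal_pdf (0 : R) (2 * s)).
apply: le_integrable => //.
  apply/measurable_EFinP; apply: measurable_funM; last exact: measurable_normal_pdf.
  exact: normr_measurable.
move=> x _; rewrite /= lee_fin !normrM normr_id (ger0_norm (g_ge0 x)).
by rewrite (ger0_norm C0) (ger0_norm (normal_pdf_ge0 _ _ _)) gC.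
Qed.

Let integrable_xgM (th : R -> R) : continuous th -> (forall x, `|th x| <= 1) ->
  mu.-integrable setT (EFin \o (fun x => x * g x * th x)).
Proof.
move=> cth th1.
have := integrable_abs_g; apply: le_integrable => //.
  apply/measurable_EFinP; apply: measurable_funM; last exact: continuous_measurable_fun.
  by apply: measurable_funM => //; exact: measurable_normal_pdf.
move=> x _; rewrite /= lee_fin !normrM normr_id.
by rewrite ler_piMr// mulr_ge0.
Qed.

Let cont_cos (t c : R) : continuous (fun x => cos (t * x + c)).
Proof.
move=> x; apply: (@continuous_comp _ _ _ (fun x => t * x + c)); last exact: continuous_cos.
by apply: cvgD; [apply: cvgMr; exact: cvg_id|exact: cvg_cst].
Qed.

Let cont_sin (t c : R) : continuous (fun x => sin (t * x + c)).
Proof.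
move=> x; apply: (@continuous_comp _ _ _ (fun x => t * x + c)); last exact: continuous_sin.
by apply: cvgD; [apply: cvgMr; exact: cvg_id|exact: cvg_cst].
Qed.

Let cos1 (x : R) : `|cos x| <= 1. Proof. by rewrite ler_norml cos_geN1 cos_le1. Qed.
Let sin1 (x : R) : `|sin x| <= 1. Proof. by rewrite ler_norml sin_geN1 sin_le1. Qed.

(** Integration by parts, as [g' x = - x / s ^ 2 * g x]. *)
Let stein (t c : R) : \int[mu]_x (x * g x * sin (t * x + c)) =
  s ^+ 2 * t * \int[mu]_x (g x * cos (t * x + c)).
Proof.
pose F x := g x * sin (t * x + c).
pose f x := - (s ^+ 2)^-1 * (x * g x * sin (t * x + c)) + t * (g x * cos (t * x + c)).
have i1 := integrable_xgM (@cont_sin t c) (fun x => sin1 _).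
have i2 := integrable_gM (@cont_cos t c) (fun x => cos1 _).
have dF (x : R) : is_derive x (1 : R) F (f x).
  have dgx := dg x.
  by apply: is_derive_eq; rewrite /GRing.scale/= /f; field.
have if1 : mu.-integrable setT (EFin \o (fun x => - (s ^+ 2)^-1 * (x * g x * sin (t * x + c)))).
  exact: (integrableZl measurableT _ i1).
have if2 : mu.-integrable setT (EFin \o (fun x => t * (g x * cos (t * x + c)))).
  exact: (integrableZl measurableT _ i2).
have fint : mu.-integrable setT (EFin \o f) by exact: (integrableD measurableT if1 if2).
have cg : continuous g by exact: continuous_normal_pdf.
have cf : continuous f.
  move=> x; apply: cvgD; apply: cvgMr.
    apply: cvgM; last exact: cont_sin.
    by apply: cvgM; [exact: cvg_id|exact: cg].
  by apply: cvgM; [exact: cg|exact: cont_cos].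
have [C C0 gC] := normal_pdf_absM_le.
have : \int[mu]_x f x = 0.
  rewrite /Rintegral (@integral_derive_eq0 F f (C * normal_peak (2 * s)) dF cf fint)//.
  move=> x; rewrite normrM mulrA (le_trans (ler_piMr _ (sin1 _)))// ?mulr_ge0//.
  rewrite ger0_norm// (le_trans (gC x))// ler_wpM2l// normal_pdf_ub//.
  by rewrite mulf_neq0// pnatr_eq0.
rewrite RintegralD// RintegralZl// RintegralZl// => h.
move/eqP: h; rewrite mulNr addrC subr_eq0 => /eqP h.
by rewrite -mulrA h mulrA mulfV ?mul1r// gt_eqF.
Qed.

(** As a function of [t] the integral satisfies [phi' = - s ^ 2 * t * phi], by
    differentiation under the integral and integration by parts. *)
Lemma normal_pdf_char t c : \int[mu]_x (g x * cos (t * x + c)) =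
  expR (- (s ^+ 2 * t ^+ 2 / 2)) * cos c.
Proof.
pose f t y := g y * cos (t * y + c).
pose phi t := \int[mu]_x f t x.
have d1f (u y : R) : is_derive u (1 : R) (f ^~ y) (- (y * g y * sin (u * y + c))).
  by apply: is_derive_eq; rewrite /GRing.scale/=; ring.
have dphi (u : R) : is_derive u (1 : R) phi (- (s ^+ 2 * u * phi u)).
  have ui : `]u - 1, u + 1[%classic u by rewrite /= in_itv/=; apply/andP; split; lra.
  have fi (x : R) : `]u - 1, u + 1[%classic x -> mu.-integrable setT (EFin \o f x).
    by move=> _; exact: (integrable_gM (@cont_cos x c) (fun x => cos1 _)).
  have fd (x y : R) : `]u - 1, u + 1[%classic x -> setT y -> derivable (f ^~ y) x 1.
    by move=> _ _; have [] := d1f x y.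
  have fG (x y : R) : `]u - 1, u + 1[%classic x -> setT y ->
      `|partial1of2 f x y| <= `|y| * g y.
    move=> _ _; rewrite partial1of2E; have [_ ->] := d1f x y.
    by rewrite normrN !normrM (ger0_norm (g_ge0 y)) ler_piMr// mulr_ge0.
  have G0 (y : R) : 0 <= `|y| * g y by rewrite mulr_ge0.
  have D1 := derivable_under_integral measurableT ui fi fd G0 integrable_abs_g fG.
  have D2 := differentiation_under_integral measurableT ui fi fd G0 integrable_abs_g fG.
  split; first exact: D1.
  rewrite -derive1E D2.
  under eq_Rintegral.
    move=> y _; rewrite partial1of2E; have [_ ->] := d1f u y.
    rewrite -mulN1r; over.
  rewrite RintegralZl//; last exact: (integrable_xgM (@cont_sin u c) (fun x => sin1 _)).
  by rewrite stein mulN1r.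
pose psi t := expR (s ^+ 2 * t ^+ 2 / 2) * phi t.
have dpsi (u : R) : is_derive u (1 : R) psi 0.
  have dpu := dphi u.
  by apply: is_derive_eq; rewrite /GRing.scale/=; field.
have := is_derive_0_is_cst t 0 dpsi; rewrite /psi.
have -> : phi 0 = cos c.
  rewrite /phi /f; under eq_Rintegral do rewrite mul0r add0r mulrC.
  rewrite RintegralZl//; last exact: integrable_normal_pdf.
  by rewrite /Rintegral integral_normal_pdf mulr1.
rewrite expr0n/= mulr0 mul0r expR0 mul1r => <-.
by rewrite mulrA -expRD addNr expR0 mul1r.
Qed.

Lemma integral_normal_prob (f : R -> \bar R) :
  measurable_fun setT f -> (normal_prob 0 s).-integrable setT f ->
  (\int[normal_prob 0 s]_x f x = \int[mu]_x (f x * (g x)%:E))%E.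
Proof.
move=> mf intf.
rewrite -(Radon_Nikodym_change_of_variables (normal_prob_dominates 0 s))//=.
apply: ae_eq_integral => //.
- apply: emeasurable_funM => //; apply: (measurable_int mu).
  by apply: Radon_Nikodym_integrable; exact: normal_prob_dominates.
- apply: emeasurable_funM => //=; apply/measurableT_comp => //=.
  exact: measurable_normal_pdf.
- apply: ae_eqe_mul2l => /=.
  rewrite Radon_NikodymE//=; first exact: normal_prob_dominates.
  move=> abmu; case: cid => /= h [h1 h2 h3].
  apply: integral_ae_eq => //=.
  + by apply/measurableT_comp =>//; exact: measurable_normal_pdf.
  + by move=> E E01 mE; rewrite -h3.
Qed.

Lemma normal_prob_char t c : \int[normal_prob 0 s]_x cos (t * x + c) =
  expR (- (s ^+ 2 * t ^+ 2 / 2)) * cos c.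
Proof.
have bc : bounded_measurable (fun x => cos (t * x + c)).
  by apply: bounded_measurable_cos; apply: measurable_funD => //; exact: measurable_funM.
rewrite -normal_pdf_char /Rintegral integral_normal_prob//.
- by congr fine; apply: eq_integral => x _; rewrite -EFinM mulrC.
- by apply/measurable_EFinP; have [] := bc.
- exact: bounded_measurable_integrable.
Qed.

End normal_characteristic_function.

Lemma gaussian1_char {R : realType} (v : R) : 0 <= v ->
  exists P : probability (measurableTypeR R) R,
    (forall A, P A = gaussian1 0 v A) /\
    forall t c, \int[P]_x cos (t * x + c) = expR (- (v * t ^+ 2 / 2)) * cos c.
Proof.
rewrite le_eqVlt => /orP[/eqP<-|v0].
  exists (@dirac _ (measurableTypeR R) 0 R : probability (measurableTypeR R) R); split=> [A|t c]; first by rewrite /gaussian1 eqxx.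
  rewrite /Rintegral integral_dirac//=.
    by rewrite indicT mul1r mulr0 add0r mul0r mul0r oppr0 expR0 mul1r.
  apply/measurable_EFinP/(bounded_measurable_cos _).1.
  by apply: measurable_funD => //; exact: measurable_funM.
exists (normal_prob 0 (Num.sqrt v)); split=> [A|t c].
  by rewrite /gaussian1 gt_eqF.
by rewrite normal_prob_char ?gt_eqF ?sqrtr_gt0// sqr_sqrtr// ltW.
Qed.

(** * Image and product probabilities *)

Section transfer.
Context {R : realType}.

Lemma bounded_measurable_comp d d' (T : measurableType d) (T' : measurableType d')
    (g : T' -> R) (f : T -> T') : bounded_measurable g -> measurable_fun setT f ->
  bounded_measurable (fun x => g (f x)).
Proof.
move=> [mg [M gM]] mf; split; last by exists M => x; exact: gM.
exact: measurableT_comp.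
Qed.

Lemma pushforward_probability d d' (T : measurableType d) (T' : measurableType d')
    (P : probability T R) (f : T -> T') : measurable_fun setT f ->
  exists P' : probability T' R, (forall A, P' A = P (f @^-1` A)) /\
  forall g : T' -> R, bounded_measurable g -> \int[P']_y g y = \int[P]_x g (f x).
Proof.
move=> mf; pose F : {mfun T >-> T'} := HB.pack f (isMeasurableFun.Build _ _ _ _ f mf).
exists (distribution P F); split=> // g bg.
rewrite /Rintegral (@integral_distribution _ _ _ _ _ _ F (EFin \o g))//.
  exact/measurable_EFinP/bg.1.
apply: (@bounded_measurable_integrable _ _ _ P (g \o f)).
exact: bounded_measurable_comp.
Qed.

Lemma Rintegral_Fubini d1 d2 (T1 : measurableType d1) (T2 : measurableType d2)
    (P1 : probability T1 R) (P2 : probability T2 R) (f : T1 * T2 -> R) :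
  bounded_measurable f ->
  \int[(P1 \x P2)%E]_z f z = \int[P1]_x \int[P2]_y f (x, y).
Proof.
move=> bf; rewrite /Rintegral -integral12_prod_meas1; last first.
  exact: (@bounded_measurable_integrable _ _ _ (P1 \x P2)%E).
congr fine; apply: eq_integral => x _; rewrite fineK//.
apply: integrable_fin_num => //.
apply: (@bounded_measurable_integrable _ _ _ P2 (fun y => f (x, y))).
have [mf [M fM]] := bf; split; last by exists M.
by apply: measurableT_comp => //; exact: measurable_pair1.
Qed.

End transfer.

(** * The coin tossing space *)

Definition cylinder (n : nat) (a : nat -> bool) : set (nat -> bool) := [set w | forall i, (i < n)%N -> w i = a i].

Definition cylinders : set (set (nat -> bool)) :=
  [set A | A = set0 \/ exists n a, A = cylinder n a].

Notation coin_space := (g_sigma_algebraType cylinders).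

Section coin_space.
Implicit Types (a w : nat -> bool) (n : nat).

Lemma measurable_cylinder n a : measurable (cylinder n a : set coin_space).
Proof. by apply: sub_sigma_algebra; right; exists n, a. Qed.

Lemma cylindersI : setI_closed cylinders.
Proof.
have I n m a b : (n <= m)%N -> cylinders (cylinder n a `&` cylinder m b).
  move=> nm; have [ab|ab] := pselect (forall i, (i < n)%N -> a i = b i).
    right; exists m, b; apply/seteqP; split => [w []//|w wb]; split => // i ni.
    by rewrite wb ?ab// (leq_trans ni).
  left; apply/seteqP; split => // w [wa wb]; apply: ab => i ni.
  by rewrite -wa// wb// (leq_trans ni).
move=> A B [->|[n [a ->]]]; first by left; rewrite set0I.
move=> [->|[m [b ->]]]; first by left; rewrite setI0.
by case/orP: (leq_total n m) => nm; [|rewrite setIC]; exact: I.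
Qed.

Lemma measurable_coin i : measurable_fun setT (fun w : coin_space => w i).
Proof.
have h : measurable [set w : coin_space | w i].
  rewrite (_ : mkset _ = \bigcup_(s : seq bool)
      (if nth false s i then cylinder i.+1 (nth false s) else set0)); last first.
    apply/seteqP; split=> [w /= wi|w [s _]].
      exists (mkseq w i.+1) => //; rewrite nth_mkseq// wi => j ji.
      by rewrite nth_mkseq.
    by case: ifP => // si /(_ i (ltnSn _)) /= ->; rewrite si.
  apply: countable_bigcupT_measurable => [|s]; first exact: countableP.
  by case: ifP => _; [exact: measurable_cylinder|exact: measurable0].
apply: (@measurable_fun_bool _ _ setT (fun w : coin_space => w i) true) => //.
by rewrite setTI; move: h; congr measurable; apply/seteqP; split => w.
Qed.

Lemma measurable_coin_fun d (T : measurableType d) (f : T -> coin_space) :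
  (forall i, measurable_fun setT (fun x => f x i)) -> measurable_fun setT f.
Proof.
move=> mf; apply: (@measurability _ _ T coin_space setT f cylinders) => //.
move=> _ [_ [->|[n [a ->]]] <-]; first by rewrite preimage_set0 setI0; exact: measurable0.
rewrite setTI (_ : _ @^-1` _ = \bigcap_(i < n) [set x | f x i = a i]); last first.
  by apply/seteqP; split => x /= h i /= ni; exact: h.
apply: bigcap_measurableType => i _.
have := mf i measurableT [set a i] _; rewrite setTI; exact.
Qed.

Lemma coin_measure_unique {R : realType} (P1 P2 : probability coin_space R) :
  (forall n a, P1 (cylinder n a) = P2 (cylinder n a)) ->
  forall A, measurable A -> P1 A = P2 A.
Proof.
move=> P12; apply: (@measure_unique _ R coin_space cylinders (fun=> cylinder 0 (fun=> false))) => //.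
- exact: cylindersI.
- by move=> _; right; exists 0%N, (fun=> false).
- by apply/seteqP; split => // w _; exists 0%N.
- by move=> A [->|[n [a ->]]]; [rewrite !measure0|exact: P12].
- by move=> _; rewrite (le_lt_trans (probability_le1 _ _)) ?ltry//; exact: measurable_cylinder.
Qed.

(** Splitting a sequence of coins into its even and odd parts is a bijection onto
    pairs of sequences, with inverse [interleave]; both preserve cylinders, hence
    fair coin tossing. *)
Definition even_part (w : coin_space) : coin_space := fun i => w i.*2.
Definition odd_part (w : coin_space) : coin_space := fun i => w i.*2.+1.
Definition interleave (z : coin_space * coin_space) : coin_space :=
  fun i => if odd i then z.2 i./2 else z.1 i./2.

Lemma measurable_even_part : measurable_fun setT even_part.
Proof. by apply: measurable_coin_fun => i; exact: measurable_coin. Qed.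

Lemma measurable_odd_part : measurable_fun setT odd_part.
Proof. by apply: measurable_coin_fun => i; exact: measurable_coin. Qed.

Lemma measurable_interleave : measurable_fun setT interleave.
Proof.
apply: measurable_coin_fun => i; rewrite /interleave; case: (odd i).
  by apply: (measurableT_comp (measurable_coin _)).
by apply: (measurableT_comp (measurable_coin _)).
Qed.

Lemma even_interleave z : even_part (interleave z) = z.1.
Proof. by apply/funext => i; rewrite /even_part /interleave odd_double doubleK. Qed.

Lemma odd_interleave z : odd_part (interleave z) = z.2.
Proof.
by apply/funext => i; rewrite /odd_part /interleave /= odd_double/= uphalf_double.
Qed.

Lemma preimage_interleave n a : interleave @^-1` cylinder n a =
  cylinder (uphalf n) (even_part a) `*` cylinder n./2 (odd_part a).
Proof.
apply/seteqP; split=> [z /= h|z [/= h1 h2] i ni].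
  split=> i /= ni.
    have := h i.*2; rewrite /interleave odd_double doubleK; apply; lia.
  have := h i.*2.+1; rewrite /interleave/= odd_double/= uphalf_double; apply; lia.
rewrite /interleave; case: ifPn => oi.
  rewrite h2 /odd_part; last by lia.
  congr a; lia.
rewrite h1 /even_part; last by lia.
congr a; lia.
Qed.

End coin_space.

(** * A sequence of independent normal variables *)

Section binary_digits.
Context {R : realType}.
Implicit Types (x : R) (a w : nat -> bool).
Local Notation mu := (@lebesgue_measure R).
Local Notation unif := (@uniform_prob R 0 1 ltr01).

Lemma uniformE (A : set R) : measurable A -> unif A = mu (A `&` `[0, 1]).
Proof.
move=> mA; transitivity (\int[unif]_x (\1_A x)%:E)%E; first by rewrite integral_indic// setIT.
rewrite integral_uniform//; last exact/measurable_EFinP/measurable_indic.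
by rewrite subr0 invr1 mul1e integral_indic.
Qed.

(** The shift on binary expansions: the digits of [x] are read off its orbit. *)
Definition doubling x : R := if x < 2^-1 then 2 * x else 2 * x - 1.

Definition digits x : coin_space := fun i => 2^-1 <= iter i doubling x.

Lemma measurable_doubling : measurable_fun setT doubling.
Proof.
apply: measurable_fun_ifT => //.
- exact: measurable_fun_ltr.
by apply: measurable_funB => //; exact: measurable_funM.
Qed.

Lemma measurable_digits : measurable_fun setT digits.
Proof.
apply: measurable_coin_fun => i; apply: measurable_fun_ler => //.
by elim: i => [|i IH] /=; [exact: measurable_id|exact: (measurableT_comp measurable_doubling)].
Qed.

Lemma doubling_itv x : 0 <= x <= 1 -> 0 <= doubling x <= 1.
Proof. by rewrite /doubling => /andP[x0 x1]; case: ltP => h; apply/andP; split; lra. Qed.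

Lemma iter_doubling_itv n x : 0 <= x <= 1 -> 0 <= iter n doubling x <= 1.
Proof. by move=> x01; elim: n => // n IH; exact: doubling_itv. Qed.

(** The digits beginning with a given word form a dyadic interval, which may or
    may not contain its right endpoint. *)
Lemma preimage_digits_cylinder n a : exists k : R, forall x, 0 <= x <= 1 ->
  (k <= x < k + 2^-1 ^+ n -> cylinder n a (digits x)) /\
  (cylinder n a (digits x) -> k <= x <= k + 2^-1 ^+ n) /\
  (0 <= k /\ k + 2^-1 ^+ n <= 1).
Proof.
elim: n a => [|n IH] a.
  by exists 0 => x /andP[x0 x1]; rewrite expr0 add0r x0 x1.
have [k kP] := IH (a \o succn).
have h0 : 0 < (2^-1 : R) ^+ n by rewrite exprn_gt0.
have [_ [_ [k0 k1]]] := kP 0 (introT andP (conj (lexx _) ler01)).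
have cS x : cylinder n.+1 a (digits x) <->
    (2^-1 <= x) = a 0%N /\ cylinder n (a \o succn) (digits (doubling x)).
  split=> [h|[h1 h2] [|i] ni]; last 2 first.
  - by rewrite /digits.
  - by rewrite /digits iterSr; exact: (h2 i ni).
  split; first exact: (h 0%N).
  by move=> i ni; have := h i.+1 ni; rewrite /digits iterSr.
exists (if a 0%N then 2^-1 * (k + 1) else 2^-1 * k) => x x01.
have /kP[kP1 [kP2 _]] := doubling_itv x01.
rewrite exprS; move: x01 => /andP[x0 x1].
split; [|split].
- move=> /andP[kx xk]; apply/cS; move: kP1; rewrite /doubling.
  by case: (a 0%N) kx xk => kx xk; case: ltP => h kP1;
    (split; [done || lra|apply: kP1; apply/andP; split; lra]) || lra.
- move=> /cS[b /kP2]; rewrite /doubling -b.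
  by case: (leP (2^-1) x) => h /andP[b1 b2]; apply/andP; split; lra.
- by case: (a 0%N); split; lra.
Qed.

Lemma coin_law_exists : exists P : probability coin_space R,
  (forall n a, P (cylinder n a) = (2^-1 ^+ n)%:E) /\
  forall g : coin_space -> R, bounded_measurable g ->
    \int[P]_w g w = \int[unif]_x g (digits x).
Proof.
have [P [PE Pint]] := pushforward_probability unif measurable_digits.
exists P; split => // n a.
have [k kP] := preimage_digits_cylinder n a.
have [_ [_ [k0 k1]]] := kP 0 (introT andP (conj (lexx _) ler01)).
have h0 : 0 < (2^-1 : R) ^+ n by rewrite exprn_gt0.
have mA : measurable (digits @^-1` cylinder n a).
  by rewrite -[X in measurable X]setTI; exact: (measurable_digits measurableT (measurable_cylinder n a)).
transitivity (mu ((digits @^-1` cylinder n a) `&` `[0, 1])).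
  by rewrite PE; exact: uniformE.
apply/eqP; rewrite eq_le; apply/andP; split.
  have -> : (2^-1 ^+ n)%:E = mu `[k, k + 2^-1 ^+ n].
    by rewrite lebesgue_measure_itv/= lte_fin ltrDl h0 -EFinD addrAC subrr add0r.
  apply: le_measure; rewrite ?inE//; first exact: measurableI.
  move=> x [/= cx]; rewrite !in_itv/= => x01.
  by have [_ [/(_ cx)]] := kP _ x01.
have -> : (2^-1 ^+ n)%:E = mu `[k, k + 2^-1 ^+ n[.
  by rewrite lebesgue_measure_itv/= lte_fin ltrDl h0 -EFinD addrAC subrr add0r.
apply: le_measure; rewrite ?inE//; first exact: measurableI.
move=> x /=; rewrite !in_itv/= => kx.
have x01 : 0 <= x <= 1 by move: kx => /andP[? ?]; apply/andP; split; lra.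
by split => //; have [/(_ kx)] := kP _ x01.
Qed.

Definition binary_sum (w : coin_space) n : R := \sum_(i < n) (w i)%:R * 2^-1 ^+ i.+1.

Definition of_digits (w : coin_space) : R := limn (binary_sum w).

Lemma binary_sum_cvg w : binary_sum w n @[n --> \oo] --> of_digits w.
Proof.
apply: nondecreasing_is_cvgn.
  apply/nondecreasing_seqP => n; rewrite /binary_sum big_ord_recr/= lerDl.
  by rewrite mulr_ge0.
exists 1 => _ [n _ <-].
suff : binary_sum w n + 2^-1 ^+ n <= 1.
  have : 0 < (2^-1 : R) ^+ n by rewrite exprn_gt0.
  lra.
elim: n => [|n IH]; first by rewrite /binary_sum big_ord0 expr0 add0r.
rewrite /binary_sum big_ord_recr/= -/(binary_sum w n) exprS.
have : 0 < (2^-1 : R) ^+ n by rewrite exprn_gt0.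
by case: (w n) => /=; lra.
Qed.

Lemma measurable_of_digits : measurable_fun setT of_digits.
Proof.
apply: (@measurable_fun_cvg _ coin_space R setT (fun n w => binary_sum w n) of_digits); last first.
  by move=> w _; exact: binary_sum_cvg.
move=> n; rewrite /binary_sum; apply: measurable_sum => i.
apply: measurable_funM => //.
rewrite (_ : (fun w : coin_space => _) = (fun w : coin_space => if w i then 1 else 0)).
  by apply: measurable_fun_ifT => //; exact: measurable_coin.
by apply/funext => w; case: (w i).
Qed.

Lemma of_digitsK x : 0 <= x <= 1 -> of_digits (digits x) = x.
Proof.
move=> x01.
have E n : x = binary_sum (digits x) n + 2^-1 ^+ n * iter n doubling x.
  elim: n => [|n IH]; first by rewrite /binary_sum big_ord0 expr0 add0r mul1r.
  rewrite {1}IH /binary_sum big_ord_recr/= -addrA; congr (_ + _).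
  rewrite /digits exprS /=; set y := iter n _ x; rewrite /doubling.
  by case: ltP => _ /=; field.
apply: (cvg_unique _ (@binary_sum_cvg (digits x))) => //.
have h : x - 2^-1 ^+ n @[n --> \oo] --> x.
  rewrite -[X in _ --> X]subr0; apply: cvgB; first exact: cvg_cst.
  by apply: cvg_expr; rewrite ger0_norm; lra.
apply: (squeeze_cvgr _ h (cvg_cst x)); apply: nearW => n.
have /andP[i0 i1] := iter_doubling_itv n x01.
have h0 : 0 < (2^-1 : R) ^+ n by rewrite exprn_gt0.
by have := E n => xE; apply/andP; split; nra.
Qed.

End binary_digits.

Section of_digits_law.
Context {R : realType} (P : probability coin_space R).
Local Notation unif := (@uniform_prob R 0 1 ltr01).
Hypothesis P_digits : forall g : coin_space -> R, bounded_measurable g ->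
  \int[P]_w g w = \int[unif]_x g (digits x).

Lemma of_digits_law (g : R -> R) : bounded_measurable g ->
  \int[P]_w g (of_digits w) = \int[unif]_x g x.
Proof.
move=> bg; rewrite (P_digits (bounded_measurable_comp bg measurable_of_digits)).
congr fine; apply: ae_eq_integral => //.
- apply/measurable_EFinP; apply: measurableT_comp; first exact: bg.1.
  by apply: measurableT_comp; [exact: measurable_of_digits|exact: measurable_digits].
- by apply/measurable_EFinP; have [] := bg.
- exists (~` `[0, 1]%classic); split; first exact: measurableC.
    transitivity (@lebesgue_measure R (~` `[0, 1] `&` `[0, 1])).
      by apply: uniformE; exact: measurableC.
    by rewrite setICl; exact: measure0.
  move=> x /= h; apply: contra_not h; rewrite in_itv/= => x01 _.
  by rewrite of_digitsK.
Qed.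

End of_digits_law.

Section quantile.
Context {R : realType} (P : probability (measurableTypeR R) R).
Local Notation mu := (@lebesgue_measure R).
Local Notation unif := (@uniform_prob R 0 1 ltr01).
Implicit Types (u x : R).

Let F x : R := fine (P `]-oo, x]%classic).

Let FE x : P `]-oo, x]%classic = (F x)%:E.
Proof. by rewrite /F fineK// fin_num_measure. Qed.

Let F01 x : 0 <= F x <= 1.
Proof. by rewrite -!lee_fin -FE measure_ge0 probability_le1. Qed.

Let F_nd x y : x <= y -> F x <= F y.
Proof.
move=> xy; rewrite -lee_fin -!FE le_measure ?inE//; exact: subitvPr.
Qed.

Let F_cvg_right x : F (x + n.+1%:R^-1) @[n --> \oo] --> F x.
Proof.
apply: fine_cvg; rewrite -FE.
have -> : `]-oo, x]%classic = \bigcap_n `]-oo, x + n.+1%:R^-1]%classic :> set R.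
  apply/seteqP; split=> [y xy n _|y h].
    by move: xy; rewrite /= !in_itv/= => /le_trans; apply; rewrite lerDl.
  rewrite /= in_itv/= leNgt; apply/negP => xy.
  have := h (Num.truncn (y - x)^-1) I; rewrite /= in_itv/= leNgt => /negP; apply.
  rewrite -ltrBrDl invf_plt ?posrE ?subr_gt0// truncnS_gt//.
apply: nonincreasing_cvg_mu => //.
- by rewrite (le_lt_trans (probability_le1 _ _)) ?ltry.
- exact: bigcap_measurable.
- move=> m n mn; apply/subsetPset => y; rewrite /= !in_itv/= => /le_trans; apply.
  by rewrite lerD2l lef_pV2 ?posrE// ler_nat.
Qed.

Let F_large u : u < 1 -> exists x, u <= F x.
Proof.
move=> u1; have h : F n%:R @[n --> \oo] --> (1 : R).
  apply: fine_cvg; rewrite -(@probability_setT _ _ _ P).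
  have -> : setT = \bigcup_n `]-oo, n%:R]%classic :> set R.
    apply/seteqP; split => // y _; exists (Num.truncn y).+1 => //=.
    by rewrite in_itv/= ltW// truncnS_gt.
  apply: nondecreasing_cvg_mu => //; first exact: bigcup_measurable.
  move=> m n mn; apply/subsetPset => y; rewrite /= !in_itv/= => /le_trans; apply.
  by rewrite ler_nat.
have /cvgrPdist_le/(_ (1 - u)) := h; rewrite subr_gt0 => /(_ u1)[N _ /(_ N (leqnn _))].
by move=> /= hN; exists N%:R; have := ler_norm (1 - F N%:R); lra.
Qed.

Let F_small u : 0 < u -> exists x, F x < u.
Proof.
move=> u0; have h : F (- n%:R) @[n --> \oo] --> (0 : R).
  apply: fine_cvg.
  have <- : P set0 = (0 : R)%:E by rewrite measure0.
  have -> : set0 = \bigcap_n `]-oo, - n%:R]%classic :> set R.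
    apply/seteqP; split => // y /(_ (Num.truncn (- y)).+1 I); rewrite /= in_itv/=.
    by rewrite leNgt ltrNl truncnS_gt.
  apply: nonincreasing_cvg_mu => //.
  - by rewrite (le_lt_trans (probability_le1 _ _)) ?ltry.
  - exact: bigcap_measurable.
  - move=> m n mn; apply/subsetPset => y; rewrite /= !in_itv/= => /le_trans; apply.
    by rewrite lerN2 ler_nat.
have /cvgrPdist_lt/(_ u u0)[N _ /(_ N (leqnn _))] := h.
move=> /= hN; exists (- N%:R); rewrite distrC subr0 in hN.
by rewrite (le_lt_trans _ hN)// ler_norm.
Qed.

(** The generalised inverse of the distribution function [F], which turns a
    uniform variable into one of law [P]; the infimum exists on the open unit
    interval only. *)
Definition quantile u : R :=
  if (0 < u) && (u < 1) then inf [set x | u <= F x] else 0.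

Let quantile_le u x : 0 < u < 1 -> (quantile u <= x) = (u <= F x).
Proof.
move=> u01; rewrite /quantile u01; case/andP: u01 => u0 u1.
have hinf : has_inf [set x | u <= F x].
  split; first exact: F_large.
  have [y Fy] := F_small u0; exists y => z /= uz; rewrite leNgt; apply/negP => zy.
  by have := F_nd (ltW zy); rewrite leNgt (lt_le_trans Fy).
apply/idP/idP => [h|h]; last by apply: ge_inf => //; exact: hinf.2.
apply: (cvgr_to_ge (@F_cvg_right x)); apply: nearW => n.
have n0 : 0 < n.+1%:R^-1 :> R by rewrite invr_gt0.
have [y /= uy yx] := inf_adherent n0 hinf.
rewrite (le_trans uy)// F_nd// ltW// (lt_le_trans yx)//.
by move: h; rewrite /quantile => h; rewrite lerD2r.
Qed.

(** The endpoints of the unit interval are excluded, as the quantile is not an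
    inverse there; they form a null set. *)
Let quantile_gt_itv x : quantile @^-1` `]x, +oo[ `&` `]0, 1[ = `]F x, 1[%classic `&` `]0, 1[.
Proof.
apply/seteqP; split=> u [/=]; rewrite !in_itv/= ?andbT => h u01.
  split => //; move: (u01) => /andP[_ ->].
  by rewrite andbT ltNge -quantile_le// -ltNge.
by move: h => /andP[h _]; split => //; rewrite ltNge quantile_le// -ltNge.
Qed.

Lemma measurable_quantile : measurable_fun setT quantile.
Proof.
apply: (@measurability _ _ _ _ setT quantile (@RGenOInfty.G R)).
  exact: RGenOInfty.measurableE.
move=> _ [_ [x ->] <-]; rewrite setTI.
rewrite -(setIT (quantile @^-1` _)) -(setvU `]0, 1[%classic) setIC setIUl setIC [X in _ `|` X]setIC.
rewrite quantile_gt_itv; apply: measurableU; last exact: measurableI.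
have [x0|x0] := ltP x 0.
  rewrite (_ : _ `&` _ = ~` `]0, 1[%classic); first exact: measurableC.
  apply/seteqP; split=> [u []//|u /= u01]; split => //.
  by rewrite /= /quantile; move: u01; rewrite in_itv/= => /negP/negbTE ->; rewrite in_itv/= andbT.
rewrite (_ : _ `&` _ = set0) //.
apply/seteqP; split => // u [/= u01]; rewrite /= in_itv/=; move: u01.
by rewrite in_itv/= andbT /quantile; case: ifPn => // _; rewrite ltNge x0.
Qed.

Lemma quantile_law (g : R -> R) : bounded_measurable g ->
  \int[unif]_u g (quantile u) = \int[P]_x g x.
Proof.
move=> bg.
have [P' [P'E P'int]] := @pushforward_probability R _ _ _ (measurableTypeR R) unif quantile measurable_quantile.
rewrite -P'int//; congr fine; apply: eq_measure_integral => A mA _.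
apply: (@measure_unique _ R (measurableTypeR R) (@RGenOInfty.G R) (fun n => `](- n%:R), +oo[%classic)).
- exact: RGenOInfty.measurableE.
- move=> _ _ [x ->] [y ->]; exists (Num.max x y).
  by apply/seteqP; split => z /=; rewrite !in_itv/= !andbT gt_max => /andP.
- by move=> n; eexists.
- apply/seteqP; split => // y _; exists (Num.truncn (- y)).+1 => //=.
  by rewrite in_itv/= andbT ltrNl truncnS_gt.
- move=> _ [x ->]; transitivity (unif (quantile @^-1` `]x, +oo[)); first exact: P'E.
  have PE : P `]x, +oo[%classic = (1 - F x)%:E.
    by rewrite -setCitvl probability_setC// EFinB FE.
  transitivity (1 - F x)%:E; last exact/esym/PE.
  have mq : measurable (quantile @^-1` `]x, +oo[).
    by rewrite -[X in measurable X]setTI; exact: measurable_quantile.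
  transitivity (mu ((quantile @^-1` `]x, +oo[) `&` `[0, 1])); first exact: uniformE.
  have /andP[F0 F1] := F01 x.
  have mFx : mu `]F x, 1[ = (1 - F x)%:E.
    rewrite lebesgue_measure_itv/= lte_fin EFinB.
    by move: F1; rewrite le_eqVlt => /orP[/eqP->|->//]; rewrite ltxx subee.
  have mFx' : mu `[F x, 1] = (1 - F x)%:E.
    rewrite lebesgue_measure_itv/= lte_fin EFinB.
    by move: F1; rewrite le_eqVlt => /orP[/eqP->|->//]; rewrite ltxx subee.
  apply/eqP; rewrite eq_le; apply/andP; split; last first.
    rewrite -mFx; apply: le_measure; rewrite ?inE//; first exact: measurableI.
    move=> u; rewrite /= in_itv/= => /andP[a b].
    have u01 : u \in `]0, 1[ by rewrite in_itv/= b (le_lt_trans F0 a).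
    have [] : (quantile @^-1` `]x, +oo[ `&` `]0, 1[) u.
      by rewrite quantile_gt_itv; split => //; rewrite /= in_itv/= a b.
    by move=> h _; split => //; rewrite /= in_itv/= (ltW b) (le_trans F0 (ltW a)).
  have : (mu ((quantile @^-1` `]x, +oo[) `&` `[0%R, 1%R]) <=
      mu (`[F x, 1%R] `|` [set 0%R; 1%R]))%E.
    apply: le_measure; rewrite ?inE//; first exact: measurableI.
      apply: measurableU => //; exact: measurableU.
    move=> u [/= h]; rewrite in_itv/= le_eqVlt => /andP[/orP[/eqP<-|u0]].
      by right; left.
    rewrite le_eqVlt => /orP[/eqP->|u1]; first by right; right.
    have [] : (`]F x, 1[%classic `&` `]0, 1[) u.
      by rewrite -quantile_gt_itv; split => //; rewrite /= in_itv/= u0.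
    by rewrite /= !in_itv/= => /andP[/ltW-> /ltW->] _; left.
  move/le_trans; apply; rewrite (le_trans (measureU2 _ _ _))//; first exact: measurableU.
  have m01 : (mu [set 0%R; 1%R] <= 0)%E.
    have m1 (r : R) : (mu [set r] <= 0)%E.
      by rewrite le_eqVlt; apply/orP; left; apply/eqP; exact: lebesgue_measure_set1.
    apply: (le_trans (measureU2 _ _ _)) => //.
    by rewrite -[leRHS]adde0; apply: leeD; exact: m1.
  rewrite -[leRHS]adde0; apply: leeD; last exact: m01.
  by rewrite le_eqVlt; apply/orP; left; apply/eqP; exact: mFx'.
- by move=> n; rewrite (le_lt_trans (probability_le1 _ _)) ?ltry.
- exact: mA.
Qed.

End quantile.

Section gaussian_sequence.
Context {R : realType}.

(** On the coin space, the even and the odd coins are independent copies of the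
    whole sequence. Hence one normal variable read off the even coins, together
    with a whole sequence read off the odd ones, gives a longer sequence. *)
Lemma iid_normal_exists : exists (P : probability coin_space R)
  (xi : nat -> coin_space -> R), (forall k, measurable_fun setT (xi k)) /\
  forall n (a : nat -> R) c,
    \int[P]_w cos (\sum_(k < n) a k * xi k w + c) =
    expR (- ((\sum_(k < n) a k ^+ 2) / 2)) * cos c.
Proof.
have [P [Pcyl Pint]] := @coin_law_exists R.
have [N [_ Nchar]] := gaussian1_char (@ler01 R).
pose q : coin_space -> R := quantile N \o of_digits.
have mq : measurable_fun setT q.
  by apply: measurableT_comp; [exact: measurable_quantile|exact: measurable_of_digits].
have Pq g : bounded_measurable g -> \int[P]_w g (q w) = \int[N]_x g x.
  move=> bg; rewrite -quantile_law//.
  by apply: (of_digits_law Pint (g := g \o quantile N)); exact: (bounded_measurable_comp bg (@measurable_quantile R N)).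
have PT (h : coin_space * coin_space -> R) : bounded_measurable h ->
    \int[P]_w h (even_part w, odd_part w) = \int[(P \x P)%E]_z h z.
  move=> bh.
  have [Q [QE Qint]] := pushforward_probability (P \x P)%E measurable_interleave.
  have QP A : measurable A -> Q A = P A.
    apply: coin_measure_unique => n a.
    transitivity (P (cylinder (uphalf n) (even_part a)) * P (cylinder n./2 (odd_part a)))%E.
      by rewrite QE preimage_interleave; apply: product_measure1E; exact: measurable_cylinder.
    rewrite !Pcyl -EFinM -exprD; congr (_ ^+ _)%:E; lia.
  transitivity (\int[Q]_w h (even_part w, odd_part w)).
    by congr fine; apply: eq_measure_integral => A mA _; exact/esym/QP.
  rewrite (Qint (fun w => h (even_part w, odd_part w))).
    by apply: eq_Rintegral => -[x y] _; rewrite even_interleave odd_interleave.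
  apply: (bounded_measurable_comp bh (f := fun w => (even_part w, odd_part w))).
  by apply/measurable_fun_pairP; split; [exact: measurable_even_part|exact: measurable_odd_part].
pose xi k : coin_space -> R := q \o even_part \o iter k odd_part.
have mxi k : measurable_fun setT (xi k).
  apply: measurableT_comp; first exact: (measurableT_comp mq measurable_even_part).
  elim: k => [|k IH]; first exact: measurable_id.
  by apply: measurableT_comp; [exact: measurable_odd_part|exact: IH].
exists P, xi; split => //; elim=> [|n IH] a c.
  under eq_Rintegral do rewrite big_ord0 add0r.
  rewrite big_ord0 mul0r oppr0 expR0 mul1r Rintegral_cst//.
  rewrite -[RHS]mulr1; congr (_ * _); transitivity (fine (1%E : \bar R)) => //.
  by congr fine; exact: probability_setT.
pose S w := \sum_(k < n) a k.+1 * xi k w.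
have mS : measurable_fun setT S.
  by apply: measurable_sum => k; exact: measurable_funM.
transitivity (\int[P]_w cos (a 0%N * q (even_part w) + S (odd_part w) + c)).
  apply: eq_Rintegral => w _; congr (cos (_ + c)).
  rewrite big_ord_recl; congr (_ + _); apply: eq_bigr => k _.
  by rewrite /xi /= /bump/= -iterSr.
have mq1 : measurable_fun setT (fun z : coin_space * coin_space => a 0%N * q z.1 + S z.2 + c).
  apply: measurable_funD => //; apply: measurable_funD.
    by apply: measurable_funM => //; exact: (measurableT_comp mq).
  exact: (measurableT_comp mS).
rewrite (PT (fun z => cos (a 0%N * q z.1 + S z.2 + c))); last exact: bounded_measurable_cos.
rewrite Rintegral_Fubini; last exact: bounded_measurable_cos.
transitivity (\int[P]_x (expR (- ((\sum_(k < n) a k.+1 ^+ 2) / 2)) * cos (a 0%N * q x + c))).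
  apply: eq_Rintegral => x _; rewrite -(IH (a \o succn)); apply: eq_Rintegral => y _.
  by rewrite /= -/(S y); congr cos; ring.
have bc : bounded_measurable (fun x : measurableTypeR R => cos (a 0%N * x + c)).
  by apply: bounded_measurable_cos; apply: measurable_funD => //; exact: measurable_funM.
rewrite RintegralZb; last exact: (bounded_measurable_comp bc).
rewrite (Pq (fun x => cos (a 0%N * x + c)))// Nchar mulrA -expRD big_ord_recl mul1r.
by congr (expR _ * _); rewrite /= mulrDl opprD addrC.
Qed.

End gaussian_sequence.

(** * Borel sets and Gaussian measures of a Hilbert space *)

Lemma dense_seq_exists {R : realType} {X : normedModType R} : separable X ->
  exists d : nat -> X, forall x (eps : R), 0 < eps -> exists n, `|x - d n| < eps.
Proof.
move=> [D [/countable_injP[g ginj] dD]].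
exists (fun n => xget 0 [set x | D x /\ g x = n]) => x eps eps0.
have [y [/= xy Dy]] := dD (ball x eps) (ex_intro _ x (ballxx x eps0)) (ball_open _ _).
exists (g y); case: xgetP => [z _ /= [Dz gz]|/(_ y)/= []//].
have -> : z = y by apply: ginj; rewrite ?inE.
by rewrite -ball_normE in xy.
Qed.

Lemma continuous_borel_measurable {R : realType} {X : ptopologicalType} (g : X -> R) :
  continuous g -> measurable_fun setT (g : borel X -> R).
Proof.
move=> cg; apply: (@measurability _ _ (borel X) _ setT _ (@RGenOInfty.G R)).
  exact: RGenOInfty.measurableE.
move=> _ [_ [a ->] <-]; rewrite setTI; apply: sub_sigma_algebra => /=.
by apply: (open_comp (f := g)) => [x _|]; [exact: cg|exact: interval_open].
Qed.

Section hilbert_borel.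
Context {R : realType} {X : completeNormedModType R} (ip : {dot X for idfun}).
Hypothesis ip_norm : forall x : X, ip x x = `|x| ^+ 2.
Hypothesis sepX : separable X.
Implicit Types (x y h : X).

Definition halfspaces : set (set X) :=
  [set [set x | a <= l x] | a in setT & l in [set (ip^~ h : X -> R) | h in setT]].

Local Notation T := (g_sigma_algebraType halfspaces).

Let measurable_ip_halfspaces h : measurable_fun setT (fun x : T => ip x h).
Proof.
apply: (@measurability _ _ T _ setT _ (@RGenCInfty.G R)).
  exact: RGenCInfty.measurableE.
move=> _ [_ [a ->] <-]; rewrite setTI; apply: sub_sigma_algebra.
exists a => //; exists (ip^~ h); first by exists h.
by apply/seteqP; split => x /=; rewrite in_itv/= andbT.
Qed.

Let measurable_ball_halfspaces y (r : R) : 0 <= r ->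
  measurable ([set x | `|x - y| < r] : set T).
Proof.
move=> r0; have [e [e_on e_total]] := basis_seq_exists ip_norm sepX.
have m : measurable_fun setT (fun x : T => ip (x - y) (x - y)).
  apply: (@measurable_fun_cvg _ T R setT
    (fun n x => \sum_(i < n) ip (x - y) (e i) * ip (x - y) (e i))).
    move=> n; apply: measurable_sum => i.
    have mi : measurable_fun setT (fun x : T => ip (x - y) (e i)).
      under eq_fun do rewrite ipBl.
      by apply: measurable_funB => //; exact: measurable_ip_halfspaces.
    exact: measurable_funM.
  by move=> x _; exact: parseval.
have := m measurableT `]-oo, r ^+ 2[%classic (measurable_itv _).
rewrite setTI; congr measurable; apply/seteqP; split => x /=;
  by rewrite in_itv/= ip_norm ltr_pXn2r ?nnegrE.
Qed.

(** Every open set is a countable union of balls, and the squared norm is a limit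
    of sums of squares of scalar products, by Parseval's identity. *)
Lemma borel_halfspacesE : (@open X).-sigma.-measurable = <<s halfspaces>>.
Proof.
have [d dP] := dense_seq_exists sepX.
apply/seteqP; split; last first.
  apply: smallest_sub; first exact: smallest_sigma_algebra.
  move=> _ [a _ [_ [h _ <-] <-]].
  have cl : closed [set x | a <= ip x h].
    rewrite (_ : [set x | _] = (fun x => ip x h) @^-1` [set y : R | a <= y])//.
    by apply: preimage_closed; [move=> x _; exact: continuous_ipl|exact: closed_ge].
  rewrite -[X in _ X]setCK; apply: (@measurableC _ (borel X)).
  by apply: sub_sigma_algebra; exact: closed_openC.
apply: smallest_sub; first exact: smallest_sigma_algebra.
move=> U oU.
pose F (p : nat * rat) : set T := [set x | `|x - d p.1| < ratr p.2].
pose G p : set T := if `[< 0 <= p.2 /\ F p `<=` U >] then F p else set0.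
have -> : U = \bigcup_p G p.
  apply/seteqP; split=> [x Ux|x [p _]]; last first.
    by rewrite /G; case: asboolP => // -[_ FU]; exact: FU.
  have : nbhs x U by exact: open_nbhs_nbhs.
  rewrite -nbhs_ballE => -[eps /= eps0 xU].
  have [q q0 qeps] : exists2 q : rat, 0 < (ratr q : R) & ratr q < eps / 2.
    have [|q] := @rat_in_itvoo R 0 (eps / 2); first by rewrite divr_gt0.
    by rewrite in_itv/= => /andP[]; exists q.
  have [n xn] := dP x _ q0.
  exists (n, q) => //; rewrite /G asboolT//=; split; first by rewrite -(@ler0q R) ltW.
  move=> z; rewrite /F /= => zd; apply: xU; rewrite -ball_normE/=.
  rewrite (_ : x - z = (x - d n) - (z - d n)); last by rewrite opprB addrA subrK.
  by rewrite (le_lt_trans (ler_normB _ _))//; lra.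
apply: (@countable_bigcupT_measurable _ T); first exact: countableP.
move=> p; rewrite /G; case: asboolP => [[p0 _]|_]; last exact: measurable0.
by apply: measurable_ball_halfspaces; rewrite ler0q.
Qed.

(** Half-spaces generate the Borel sets, so scalar products decide
    measurability. *)
Lemma measurable_to_hilbert d (S : measurableType d) (D : set S) (f : S -> X) :
  measurable D ->
  (forall h, measurable_fun D (fun t => ip (f t) h)) ->
  measurable_fun D (f : S -> borel X).
Proof.
move=> mD mf; apply: (@measurability _ _ S (borel X) D f halfspaces).
  exact: borel_halfspacesE.
move=> _ [_ [a _ [_ [h _ <-] <-]] <-].
have := mf h mD `[a, +oo[%classic (measurable_itv _); congr measurable.
by congr (_ `&` _); apply/seteqP; split => x /=; rewrite in_itv/= andbT.
Qed.

Lemma measurable_ip h : measurable_fun setT (fun x : borel X => ip x h).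
Proof. by apply: continuous_borel_measurable => x; exact: continuous_ipl. Qed.

Lemma hilbert_char_unique (nu1 nu2 : probability (borel X) R) :
  (forall h c, \int[nu1]_x cos (ip x h + c) = \int[nu2]_x cos (ip x h + c)) ->
  forall A, measurable A -> nu1 A = nu2 A.
Proof.
move=> nu12 A mA.
apply: (@char_unique _ _ _ _ _ [set (ip^~ h : borel X -> R) | h in setT]) => //.
- by move=> _ [h _ <-]; exact: measurable_ip.
- by exists 0 => //; apply/funext => x; rewrite ip0r.
- move=> k _ _ [h _ <-] [h' _ <-]; exists (k *: h + h') => //.
  by apply/funext => x; rewrite ipDr ipZr.
- by move=> _ c [h _ <-]; exact: nu12.
- by rewrite -[<<s _ >>]/(<<s halfspaces>>) -borel_halfspacesE.
Qed.

(** The scalar product with [h] transports the integral to the normal law on the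
    line. *)
Lemma gaussian_char nu (Q : X -> X) h c : 0 <= ip (Q h) h ->
  is_gaussian ip nu 0 Q ->
  \int[nu]_x cos (ip x h + c) = expR (- (ip (Q h) h / 2)) * cos c.
Proof.
move=> Qh gnu; have [P [PE Pchar]] := gaussian1_char Qh.
have [P' [P'E P'int]] := @pushforward_probability R _ _ _ (measurableTypeR R) nu _ (measurable_ip h).
have bc : bounded_measurable (fun x : measurableTypeR R => cos (1 * x + c)).
  by apply: bounded_measurable_cos; apply: measurable_funD => //; exact: measurable_funM.
transitivity (\int[P']_x cos (1 * x + c)).
  by rewrite P'int//; apply: eq_Rintegral => x _; rewrite mul1r.
transitivity (\int[P]_x cos (1 * x + c)); last by rewrite Pchar expr1n mulr1.
congr fine; apply: eq_measure_integral => A mA _.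
transitivity (nu ((fun x => ip x h) @^-1` A)); first exact: P'E.
by rewrite gnu// ip0l; exact/esym/PE.
Qed.

(** Along the multiples of [h] the functional is the characteristic function of a
    normal law, which determines the law of the scalar product with [h]. *)
Lemma char_gaussian (nu : probability (borel X) R) (Q : X -> X) :
  (forall t h, ip (Q (t *: h)) (t *: h) = t ^+ 2 * ip (Q h) h) ->
  (forall h, 0 <= ip (Q h) h) ->
  (forall h c, \int[nu]_x cos (ip x h + c) = expR (- (ip (Q h) h / 2)) * cos c) ->
  is_gaussian ip nu 0 Q.
Proof.
move=> QZ Q0 nuQ h A mA; rewrite ip0l.
have [P [PE Pchar]] := gaussian1_char (Q0 h).
have [P' [P'E P'int]] := @pushforward_probability R _ _ _ (measurableTypeR R) nu _ (measurable_ip h).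
have mt t c : measurable_fun setT (fun x : measurableTypeR R => t * x + c).
  by apply: measurable_funD => //; exact: measurable_funM.
suff key : P' A = P A.
  by transitivity (P' A); [exact/esym/P'E|rewrite key; exact: PE].
refine (@char_unique _ (measurableTypeR R) R P' P [set (fun x : measurableTypeR R => t * x : R) | t in setT] _ _ _ _ A _ mA).
- by move=> _ [t _ <-]; exact: measurable_funM.
- by exists 0 => //; apply/funext => x; rewrite mul0r.
- move=> k _ _ [t _ <-] [t' _ <-]; exists (k * t + t') => //.
  by apply/funext => x; rewrite mulrDl mulrA.
- move=> _ c [t _ <-].
  rewrite P'int; last exact: bounded_measurable_cos.
  rewrite Pchar -(mulrC (t ^+ 2)) -QZ -nuQ; apply: eq_Rintegral => x _.
  by rewrite ipZr.
- have : (@RGenCInfty.G R).-sigma.-measurable A.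
    by rewrite -RGenCInfty.measurableE; exact: mA.
  apply: sub_smallest2r; first exact: smallest_sigma_algebra.
  move=> _ [x ->]; exists x => //.
  exists (fun y : measurableTypeR R => 1 * y : R); first by exists 1.
  by apply/seteqP; split => y /=; rewrite in_itv/= andbT mul1r.
Qed.

End hilbert_borel.

(** * Cholesky factorisation and second moments *)

Section psd_forms.
Context {R : realType} {V : lmodType R}.
Implicit Types (b : V -> V -> R) (x y z : V).

Definition psd_form b : Prop :=
  [/\ forall x y, b x y = b y x,
      forall k x y z, b (k *: x + y) z = k * b x z + b y z &
      forall x, 0 <= b x x].

Lemma psd_form0 b x : psd_form b -> b 0 x = 0.
Proof.
move=> [_ lb _]; have := lb (-1) 0 0 x; rewrite scaler0 addr0 => h.
by apply/eqP; rewrite h mulN1r addNr.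
Qed.

Lemma psd_cauchy_schwarz b x y : psd_form b -> b x y ^+ 2 <= b x x * b y y.
Proof.
move=> pb; have [sb lb b0] := pb.
have h k : 0 <= k ^+ 2 * b x x + 2 * k * b x y + b y y.
  have := b0 (k *: x + y).
  rewrite lb (sb x) (sb y (k *: x + y)) !lb (sb y x) => h.
  by apply: le_trans h _; rewrite le_eqVlt; apply/orP; left; apply/eqP; ring.
have [bx|bx] := eqVneq (b x x) 0.
  have [->|bxy] := eqVneq (b x y) 0; first by rewrite expr0n mulr_ge0.
  have := h (- (b y y + 1) / (2 * b x y)); rewrite bx mulr0 add0r.
  rewrite (_ : 2 * _ * _ = - (b y y + 1)); last by field.
  by lra.
have bx0 : 0 < b x x by rewrite lt_neqAle eq_sym bx b0.
have h2 := mulr_ge0 (ltW bx0) (h (- b x y / b x x)).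
rewrite -subr_ge0; apply: le_trans h2 _.
by rewrite le_eqVlt; apply/orP; left; apply/eqP; field.
Qed.

(** One step of the Cholesky factorisation: [b] minus its rank one part along
    [e]. Division by zero gives the null form when [b e e = 0], which is right
    since then [b x e = 0] for all [x]. *)
Definition chol_vec b e x : R := b x e / Num.sqrt (b e e).

Definition chol_rest b e x y : R := b x y - chol_vec b e x * chol_vec b e y.

Lemma chol_restE b e x y : 0 <= b e e ->
  chol_rest b e x y = b x y - b x e * b y e / b e e.
Proof.
move=> b0; rewrite /chol_rest /chol_vec -[in RHS](sqr_sqrtr b0) expr2 invfM.
by congr (_ - _); ring.
Qed.

Lemma chol_vec_linear b e k x y : psd_form b ->
  chol_vec b e (k *: x + y) = k * chol_vec b e x + chol_vec b e y.
Proof. by move=> [_ lb _]; rewrite /chol_vec lb; ring. Qed.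

Lemma chol_rest_psd b e : psd_form b -> psd_form (chol_rest b e).
Proof.
move=> pb; have [sb lb b0] := pb; split=> [x y|k x y z|x].
- by rewrite /chol_rest sb mulrC.
- by rewrite /chol_rest (chol_vec_linear _ _ _ _ pb) lb; ring.
- rewrite chol_restE// subr_ge0.
  have [be|be] := eqVneq (b e e) 0; first by rewrite be invr0 mulr0.
  have be0 : 0 < b e e by rewrite lt_neqAle eq_sym be b0.
  by rewrite ler_pdivrMr// -expr2 psd_cauchy_schwarz.
Qed.

Lemma chol_rest_vanish b e x : psd_form b -> chol_rest b e x e = 0.
Proof.
move=> pb; have [sb lb b0] := pb; rewrite chol_restE//.
have [be|be] := eqVneq (b e e) 0; last by field.
have : b x e ^+ 2 <= 0 by rewrite (le_trans (psd_cauchy_schwarz _ _ pb))// be mulr0.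
rewrite le_eqVlt ltNge sqr_ge0 orbF sqrf_eq0 => /eqP->.
by rewrite !mul0r subr0.
Qed.

Lemma chol_rest_vanish_stable b e e' : psd_form b -> (forall x, b x e' = 0) ->
  forall x, chol_rest b e x e' = 0.
Proof.
by move=> [sb _ _] be x; rewrite /chol_rest /chol_vec (sb e') !be mul0r mulr0 subr0.
Qed.

Variables (b : V -> V -> R) (e : nat -> V).
Hypothesis pb : psd_form b.

Fixpoint cholesky n : V -> V -> R :=
  if n is n'.+1 then chol_rest (cholesky n') (e n') else b.

Definition chol n : V -> R := chol_vec (cholesky n) (e n).

Lemma cholesky_psd n : psd_form (cholesky n).
Proof. by elim: n => //= n IH; exact: chol_rest_psd. Qed.

Lemma cholesky_vanish n m x : (m < n)%N -> cholesky n x (e m) = 0.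
Proof.
elim: n x => // n IH x; rewrite ltnS leq_eqVlt => /orP[/eqP->|mn] /=.
  by apply: chol_rest_vanish; exact: cholesky_psd.
by apply: chol_rest_vanish_stable => [|y]; [exact: cholesky_psd|exact: IH].
Qed.

Lemma chol_linear n k x y : chol n (k *: x + y) = k * chol n x + chol n y.
Proof. by apply: chol_vec_linear; exact: cholesky_psd. Qed.

Lemma chol_lower n m : (m < n)%N -> chol n (e m) = 0.
Proof.
move=> mn; rewrite /chol /chol_vec.
by have [-> _ _] := cholesky_psd n; rewrite cholesky_vanish// mul0r.
Qed.

Lemma cholesky_sum n x y : \sum_(k < n) chol k x * chol k y = b x y - cholesky n x y.
Proof.
elim: n => [|n IH]; first by rewrite big_ord0 subrr.
by rewrite big_ord_recr/= IH /chol_rest -/(chol n x) -/(chol n y); ring.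
Qed.

Lemma chol_sum_span n (a : nat -> R) k :
  chol k (\sum_(i < n) a i *: e i) = \sum_(i < n) a i * chol k (e i).
Proof.
elim: n => [|n IH].
  by rewrite !big_ord0 /chol /chol_vec (psd_form0 _ (cholesky_psd k)) mul0r.
by rewrite !big_ord_recr/= addrC chol_linear IH addrC.
Qed.

Lemma cholesky_vanish_span n (a : nat -> R) x :
  cholesky n x (\sum_(i < n) a i *: e i) = 0.
Proof.
have [sb lb _] := cholesky_psd n; rewrite sb.
suff h m : (m <= n)%N -> cholesky n (\sum_(i < m) a i *: e i) x = 0 by exact: h.
elim: m => [|m IH] mn; first by rewrite big_ord0 (psd_form0 _ (cholesky_psd n)).
by rewrite big_ord_recr/= addrC lb (IH (ltnW mn)) (sb (e m)) cholesky_vanish// mulr0 addr0.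
Qed.

End psd_forms.

Section second_moment.
Context {R : realType} d (T : measurableType d) (P : probability T R).

Lemma cvg_sinc (y : R) : n.+1%:R * sin (y / n.+1%:R) @[n --> \oo] --> y.
Proof.
have [->|y0] := eqVneq y 0.
  by under eq_fun do rewrite mul0r sin0 mulr0; exact: cvg_cst.
have dsin : (fun h : R => h^-1 *: ((sin \o shift 0) (h *: 1) - sin 0)) @ 0^' --> (1 : R).
  have [ds Ds] := is_derive_sin (0 : R).
  have := ds; rewrite /derivable => /cvg_ex[l hl].
  have l1 : l = 1 by rewrite -cos0 -Ds /derive; apply/esym; exact: (cvg_lim _ hl).
  by rewrite l1 in hl.
have nz (n : nat) : y / n.+1%:R != 0 by rewrite mulf_neq0// invr_eq0 pnatr_eq0.
have cv : y / n.+1%:R @[n --> \oo] --> 0.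
  by rewrite -(mulr0 y); apply: cvgMr; exact: cvg_harmonic.
have h := (cvgr_dnbhsP _ _ _).1 dsin (fun n => y / n.+1%:R) (conj nz cv).
rewrite -[X in _ --> X]mulr1.
rewrite (_ : (fun n : nat => _) = (fun n : nat => y * ((y / n.+1%:R)^-1 *:
    ((sin \o shift 0) ((y / n.+1%:R) *: 1) - sin 0)))); first exact: cvgMr.
apply/funext => n /=.
rewrite sin0 subr0 addr0 /GRing.scale/= mulr1.
have n0 : n.+1%:R != 0 :> R by rewrite pnatr_eq0.
by field; rewrite y0 addrC natr1 n0.
Qed.

(** Fatou's lemma for [2 n^2 (1 - cos (f / n))], which tends to [f^2]; the mean
    of these functions is known from the characteristic function and stays
    below [q]. *)
Lemma second_moment_le (f : T -> R) (q : R) : measurable_fun setT f -> 0 <= q ->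
  (forall t, \int[P]_x cos (t * f x) = expR (- (q * t ^+ 2 / 2))) ->
  (\int[P]_x ((f x) ^+ 2)%:E <= q%:E)%E.
Proof.
move=> mf q0 fchar.
pose g n x : R := 2 * n.+1%:R ^+ 2 * (1 - cos (n.+1%:R^-1 * f x)).
have bcos n : bounded_measurable (fun x => cos (n.+1%:R^-1 * f x)).
  by apply: bounded_measurable_cos; exact: measurable_funM.
have mg n : measurable_fun setT (g n).
  by apply: measurable_funM => //; apply: measurable_funB => //; exact: (bcos n).1.
have g0 n x : 0 <= g n x.
  by rewrite /g !mulr_ge0 ?subr_ge0 ?cos_le1 ?exprn_ge0.
have gf x : g n x @[n --> \oo] --> (f x) ^+ 2.
  have h := @cvg_sinc (f x / 2).
  have -> : (fun n => g n x) =
      (fun n => 4 * (n.+1%:R * sin (f x / 2 / n.+1%:R)) ^+ 2).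
    apply/funext => n; rewrite /g.
    have -> : n.+1%:R^-1 * f x = (f x / 2 / n.+1%:R) *+ 2 by rewrite mulr2n; field; rewrite addrC natr1 pnatr_eq0.
    by rewrite cos_mulr2n cos2sin2; ring.
  have -> : (f x) ^+ 2 = 4 * ((f x / 2) * (f x / 2)) by field.
  by apply: cvgMr; under eq_fun do rewrite expr2; exact: cvgM.
have intg n : (\int[P]_x (g n x)%:E <= q%:E)%E.
  have bg : bounded_measurable (g n).
    apply: bounded_measurableM; first exact: bounded_measurable_cst.
    have [mc [M cM]] := bcos n; split; first exact: measurable_funB.
    by exists (1 + M) => x; rewrite (le_trans (ler_normB _ _))// normr1 lerD2l.
  have ig := bounded_measurable_integrable P bg.
  rewrite -(fineK (integrable_fin_num measurableT ig)) lee_fin.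
  have -> : fine (\int[P]_x (g n x)%:E) =
      2 * n.+1%:R ^+ 2 * (1 - expR (- (q * (n.+1%:R^-1) ^+ 2 / 2))).
    rewrite -fchar -/(Rintegral P setT (g n)) /g RintegralZb; last first.
      have [mc [M cM]] := bcos n; split; first exact: measurable_funB.
      by exists (1 + M) => x; rewrite (le_trans (ler_normB _ _))// normr1 lerD2l.
    congr (_ * _); rewrite RintegralB//.
    - rewrite Rintegral_cst// mul1r; congr (_ - _).
      by transitivity (fine (1%E : \bar R)) => //; congr fine; exact: probability_setT.
    - exact: (bounded_measurable_integrable P (@bounded_measurable_cst _ T R 1)).
    - exact: (bounded_measurable_integrable P (bcos n)).
  have := expR_ge1Dx (- (q * (n.+1%:R^-1) ^+ 2 / 2)) => h.
  have n0 : n.+1%:R != 0 :> R by rewrite pnatr_eq0.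
  have qE : 2 * n.+1%:R ^+ 2 * (q * n.+1%:R^-1 ^+ 2 / 2) = q.
    by field; rewrite addrC natr1.
  rewrite -[leRHS]qE.
  apply: ler_wpM2l; first by rewrite mulr_ge0 ?exprn_ge0.
  by rewrite lerBlDl -lerBlDr.
apply: (@le_trans _ _ (\int[P]_x limn_einf (fun n => (g n x)%:E))%E).
  rewrite le_eqVlt; apply/orP; left; apply/eqP; apply: eq_integral => x _.
  rewrite limn_einf_lim; apply/esym; apply: (cvg_lim (@ereal_hausdorff R)); apply: cvg_einfs.
  by apply: cvg_EFin; [exact: nearW|exact: gf].
apply: (le_trans (fatou P measurableT _ _)) => //.
- by move=> n; exact/measurable_EFinP.
- by move=> n x _; rewrite lee_fin.
rewrite limn_einf_lim; apply: lime_le; first exact: is_cvg_einfs.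
apply: nearW => n; apply: (le_trans _ (intg n)).
by apply: ereal_inf_lbound; exists n => /=.
Qed.

End second_moment.

(** * Existence of Gaussian measures *)

Section gaussian_existence.
Context {R : realType} {X : completeNormedModType R} (ip : {dot X for idfun}).
Hypothesis ip_norm : forall x : X, ip x x = `|x| ^+ 2.
Hypothesis sepX : separable X.
Context (Q : X -> X) (e : nat -> X) (C : R).
Hypothesis Q_nonneg : nonneg_op ip Q.
Hypothesis e_on : orthonormal_seq ip e.
Hypothesis e_total : total_seq ip e.
Hypothesis Q_trace : forall n, \sum_(i < n) ip (Q (e i)) (e i) <= C.

Let b x y : R := ip (Q x) y.

Let pb : psd_form b.
Proof.
have [bQ aQ Q0] := Q_nonneg; split=> [x y|k x y z|x].
- by rewrite /b aQ ipC.
- by rewrite /b (bl_add _ _ bQ) (bl_scale _ _ bQ) ipDl ipZl.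
- exact: Q0.
Qed.

(** The coordinates of the Gaussian vector are lower triangular combinations of
    independent normal variables: the Cholesky factorisation makes their
    covariances those of [Q], and the trace bound makes them square summable
    almost surely. *)
Lemma gaussian_measure_exists : exists nu, is_gaussian ip nu 0 Q.
Proof.
have [bQ aQ Q0] := Q_nonneg.
have [P [xi [mxi xichar]]] := @iid_normal_exists R.
pose L n k := chol b e k (e n).
pose G n w := \sum_(k < n.+1) L n k * xi k w.
have mG n : measurable_fun setT (G n).
  by apply: measurable_sum => k; exact: measurable_funM.
(* The factor [L] is lower triangular, so longer sums have the same value. *)
have GE n N w : (n < N)%N -> G n w = \sum_(k < N) L n k * xi k w.
  move=> nN; rewrite /G (big_ord_widen N (fun k => L n k * xi k w))// big_mkcond/=.
  apply: eq_bigr => k _; case: ifPn => //; rewrite -ltnNge => nk.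
  by rewrite /L chol_lower ?mul0r.
have Gmoment n : (\int[P]_w ((G n w) ^+ 2)%:E <= (b (e n) (e n))%:E)%E.
  apply: second_moment_le => [//||t]; first exact: Q0.
  have -> : b (e n) (e n) * t ^+ 2 = \sum_(k < n.+1) (t * L n k) ^+ 2.
    have := cholesky_sum b e n.+1 (e n) (e n).
    rewrite (cholesky_vanish e pb (e n) (ltnSn n)) subr0 => <-.
    by rewrite mulr_suml; apply: eq_bigr => k _; rewrite exprMn mulrC expr2.
  transitivity (\int[P]_w cos (\sum_(k < n.+1) (t * L n k) * xi k w + 0)).
    apply: eq_Rintegral => w _; rewrite addr0 mulr_sumr; congr cos.
    by apply: eq_bigr => k _; rewrite mulrA.
  by rewrite (xichar n.+1 (fun k => t * L n k)) cos0 mulr1.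
(* The series of squares is integrable, hence finite almost surely. *)
pose S w : \bar R := (\sum_(n <oo) ((G n w) ^+ 2)%:E)%E.
have mS : measurable_fun setT S.
  apply: ge0_emeasurable_sum => [n w _ _|n _]; first by rewrite lee_fin sqr_ge0.
  by apply/measurable_EFinP; exact: measurable_funX.
have S0 w : (0 <= S w)%E by apply: nneseries_ge0 => n _ _; rewrite lee_fin sqr_ge0.
have intS : (\int[P]_w S w <= C%:E)%E.
  rewrite integral_nneseries//; last 2 first.
  - by move=> n; apply/measurable_EFinP; exact: measurable_funX.
  - by move=> n w _; rewrite lee_fin sqr_ge0.
  apply: lime_le.
    by apply: is_cvg_nneseries => n _ _; apply: integral_ge0 => w _; rewrite lee_fin sqr_ge0.
  apply: nearW => N; rewrite (le_trans (lee_sum _ (fun n _ => Gmoment n)))//.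
  by rewrite sumEFin lee_fin big_mkord; exact: Q_trace.
pose A := [set w | (S w < +oo)%E].
have mA : measurable A.
  have := mS measurableT `](-oo)%E, (+oo)%E[%classic (emeasurable_itv _).
  rewrite setTI; congr measurable; apply/seteqP; split => w /=; rewrite in_itv/=.
    by move=> /andP[].
  by move=> ->; rewrite andbT (lt_le_trans _ (S0 w)).
have PA : P (~` A) = 0%E.
  have iS : P.-integrable setT S.
    apply/integrableP; split => //; under eq_integral do rewrite gee0_abs//.
    by rewrite (le_lt_trans intS)// ltry.
  have [N [mN N0 AN]] := integrable_ae measurableT iS.
  apply/eqP; rewrite -measure_le0 -N0 le_measure ?inE//; first exact: measurableC.
  move=> w wA; apply: AN => /= h; apply: wA; rewrite /A /= -ge0_fin_numE//.
  exact: h.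
have GA w : A w -> exists M, forall n, \sum_(i < n) (G i w) ^+ 2 <= M.
  move=> Aw; exists (fine (S w)) => n; rewrite -lee_fin fineK ?ge0_fin_numE//.
  rewrite -sumEFin -(big_mkord xpredT (fun i => ((G i w) ^+ 2)%:E)).
  by apply: nneseries_lim_ge => k _; rewrite lee_fin sqr_ge0.
pose Y w : X := if w \in A then limn (fun n => \sum_(i < n) G i w *: e i) else 0.
(* The partial sums of [Y] tested against [h], cut off where the series may
   diverge: measurable approximations of [ip (Y w) h]. *)
pose YA N h w := \1_A w * \sum_(i < N) G i w * ip (e i) h.
have YE w h : YA N h w @[N --> \oo] --> ip (Y w) h.
  rewrite /YA /Y indicE; case: ifPn => [/set_mem/GA[M GM]|_]; last first.
    by rewrite ip0l; under eq_fun do rewrite mul0r; exact: cvg_cst.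
  have cv := @cvg_sum_basis _ _ _ ip_norm _ e_on (fun i => G i w) M GM.
  have h1 : ip (\sum_(i < n) G i w *: e i) h @[n --> \oo] -->
      ip (limn (fun n => \sum_(i < n) G i w *: e i)) h by exact: cvg_ipl.
  apply: cvg_trans h1; apply: near_eq_cvg; apply: nearW => n /=.
  rewrite mul1r (ip_suml ip n (fun i => G i w *: e i)).
  by apply: eq_bigr => i _; rewrite ipZl.
have mYA N h : measurable_fun setT (YA N h).
  apply: measurable_funM => //; apply: measurable_sum => i.
  exact: measurable_funM.
have mY : measurable_fun setT (Y : _ -> borel X).
  apply: (measurable_to_hilbert ip_norm sepX) => // h.
  by apply: (measurable_fun_cvg (fun N => mYA N h)) => w _; exact: YE.
have [nu [_ nuint]] := @pushforward_probability R _ _ _ (borel X) P Y mY.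
exists nu; apply: (char_gaussian ip_norm) => // [t h|h c].
  by rewrite (bl_scale _ _ bQ) ipZl ipZr; ring.
have bc : bounded_measurable (fun x : borel X => cos (ip x h + c)).
  by apply: bounded_measurable_cos; apply: measurable_funD => //; exact: measurable_ip.
rewrite nuint//.
have lim1 : \int[P]_w cos (YA N h w + c) @[N --> \oo] --> \int[P]_w cos (ip (Y w) h + c).
  apply: (proj2 (@Rintegral_bounded_cvg _ _ _ P (fun N w => cos (YA N h w + c)) _ 1 _ _ _)).
  - by move=> N; apply: (bounded_measurable_cos _).1; exact: measurable_funD.
  - by move=> N w; rewrite ler_norml cos_geN1 cos_le1.
  - move=> w; apply: (cvg_comp _ cos); last exact: continuous_cos.
    by apply: cvgD; [exact: YE|exact: cvg_cst].
(* Only the projection of [h] on the first [N] basis vectors enters [YA N h], and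
   the factorisation of [b] is exact on their span. *)
pose PN N := \sum_(i < N) ip h (e i) *: e i.
have charN N : \int[P]_w cos (YA N h w + c) = expR (- (b (PN N) (PN N) / 2)) * cos c.
  have -> : b (PN N) (PN N) = \sum_(k < N) (chol b e k (PN N)) ^+ 2.
    have := cholesky_sum b e N (PN N) (PN N).
    rewrite (cholesky_vanish_span e pb N (fun i => ip h (e i)) (PN N)) subr0 => <-.
    by apply: eq_bigr => k _; rewrite expr2.
  rewrite -(xichar N (fun k => chol b e k (PN N))); congr fine; apply: ae_eq_integral => //.
  - apply/measurable_EFinP; apply: (bounded_measurable_cos _).1.
    exact: measurable_funD.
  - apply/measurable_EFinP; apply: (bounded_measurable_cos _).1.
    by apply: measurable_funD => //; apply: measurable_sum => k; exact: measurable_funM.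
  exists (~` A); split; [exact: measurableC|exact: PA|move=> w /= nh Aw; apply: nh => _].
  congr (cos (_ + c))%:E; rewrite /YA indicE mem_set// mul1r.
  transitivity (\sum_(i < N) \sum_(k < N) (L i k * xi k w) * ip (e i) h).
    by apply: eq_bigr => i _; rewrite (GE i N)// mulr_suml.
  rewrite exchange_big/=; apply: eq_bigr => k _.
  rewrite (chol_sum_span e pb N (fun i => ip h (e i))) mulr_suml; apply: eq_bigr => i _.
  by rewrite (ipC ip h) /L; ring.
have lim2 : expR (- (b (PN N) (PN N) / 2)) * cos c @[N --> \oo] -->
    expR (- (ip (Q h) h / 2)) * cos c.
  apply: cvgMl; apply: (cvg_comp _ expR); last exact: continuous_expR.
  apply: cvgN; apply: cvgMl.
  have PNh : PN N @[N --> \oo] --> h by exact: cvg_basis_expansion.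
  by rewrite /b; apply: cvg_ip => //; apply: (cvg_comp _ Q PNh); exact: bl_continuous.
rewrite -(funext charN) in lim2.
exact: (cvg_unique _ lim1 lim2).
Qed.

End gaussian_existence.

(** * Bochner integrals of weakly measurable functions *)

Section lower_integral.
Context d (T : measurableType d) (R : realType) (mu : {measure set T -> \bar R}).
Implicit Types (f g : T -> \bar R) (N : set T).
Local Open Scope ereal_scope.
Import HBNNSimple.

(** The integral of a nonnegative function that need not be measurable is the
    supremum of the integrals of the simple functions below it, so that null
    sets can be ignored as soon as one of the two functions is measurable. *)
Lemma le_integral_off_null_r f g N : measurable N -> mu N = 0 ->
  (forall x, 0 <= f x) -> (forall x, 0 <= g x) -> measurable_fun setT g ->
  (forall x, ~ N x -> f x <= g x) -> \int[mu]_x f x <= \int[mu]_x g x.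
Proof.
move=> mN N0 f0 g0 mg fg; rewrite ge0_integralTE//.
apply: ge_ereal_sup => _ [h /= hf <-]; rewrite -integralT_nnsfun.
apply: ae_ge0_le_integral => //.
- by move=> x _; rewrite lee_fin.
- exact/measurable_EFinP.
- exists N; split => // x /= h'; apply: contrapT => Nx; apply: h' => _.
  exact: le_trans (hf x) (fg _ Nx).
Qed.

Lemma le_integral_off_null_l f g N : measurable N -> mu N = 0 ->
  (forall x, 0 <= f x) -> (forall x, 0 <= g x) -> measurable_fun setT f ->
  (forall x, ~ N x -> f x <= g x) -> \int[mu]_x f x <= \int[mu]_x g x.
Proof.
move=> mN N0 f0 g0 mf fg.
rewrite (ge0_negligible_integral mN)// setTD integral_mkcond.
rewrite !ge0_integralTE//; last by move=> x; rewrite patchE; case: ifP.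
apply: ge_ereal_sup => _ [h /= hf <-]; apply: ereal_sup_ubound; exists h => // x.
apply: le_trans (hf x) _; rewrite patchE; case: ifPn => [/set_mem/fg//|_].
exact: g0.
Qed.

End lower_integral.

Lemma cvge0_near_lt (R : realType) (u : nat -> \bar R) (eps : R) : 0 < eps ->
  u @ \oo --> 0%E -> \forall n \near \oo, (u n < eps%:E)%E.
Proof.
move=> eps0 /fine_cvgP[uf /cvgrPdist_lt/(_ _ eps0)]; apply: filterS2 uf => n un.
by rewrite /= sub0r normrN => h; rewrite -(fineK un) lte_fin (le_lt_trans (ler_norm _)).
Qed.

Section bochner_theory.
Context {R : realType} {X : completeNormedModType R} (ip : {dot X for idfun}).
Hypothesis ip_norm : forall x : X, ip x x = `|x| ^+ 2.
Hypothesis sepX : separable X.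
Context d (T : measurableType d) (mu : {measure set T -> \bar R}).
Implicit Types (f g h : T -> X) (x y v : X) (z : T).

Definition weakly_measurable f : Prop :=
  forall y, measurable_fun setT (fun z => ip (f z) y).

Lemma measurable_norm_weak f : weakly_measurable f ->
  measurable_fun setT (fun z => `|f z|).
Proof.
move=> mf; have mfb : measurable_fun setT (f : T -> borel X).
  by apply: (measurable_to_hilbert ip_norm sepX).
apply: (measurableT_comp (f := fun x : borel X => `|x|) _ mfb).
by apply: continuous_borel_measurable; exact: norm_continuous.
Qed.

Lemma weakly_measurableB f g : weakly_measurable f -> weakly_measurable g ->
  weakly_measurable (fun z => f z - g z).
Proof.
move=> mf mg y; under eq_fun do rewrite ipBl; exact: measurable_funB.
Qed.

Lemma weakly_measurable_cst x : weakly_measurable (fun=> x).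
Proof. by move=> y; exact: measurable_cst. Qed.

Lemma norm_integrable_ip f y : weakly_measurable f ->
  (\int[mu]_z `|f z|%:E < +oo)%E -> mu.-integrable setT (fun z => (ip (f z) y)%:E).
Proof.
move=> mf fi; have mn := measurable_norm_weak mf.
have ifn : mu.-integrable setT (EFin \o (fun z => `|f z|)).
  apply/integrableP; split; first exact/measurable_EFinP.
  by under eq_integral do rewrite /= normr_id.
have := integrableZl measurableT `|y| ifn; apply: le_integrable => //.
  exact/measurable_EFinP/mf.
move=> z _; rewrite /= lee_fin normrM !normr_id mulrC; exact: cauchy_schwarz.
Qed.

Lemma integrable_simple_ip h y : integrable_simple mu h ->
  mu.-integrable setT (fun z => (ip (h z) y)%:E) /\
  ip (simple_integral mu h) y = \int[mu]_z ip (h z) y.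
Proof.
move=> [fin_h mh mu_h].
pose s : seq X := finmap.enum_fset (fset_set (range h)).
pose F (t : seq X) z := \sum_(x <- t) ip x y * \1_(h @^-1` [set x]) z.
have term x : mu.-integrable setT (EFin \o (fun z => ip x y * \1_(h @^-1` [set x]) z)) /\
    \int[mu]_z (ip x y * \1_(h @^-1` [set x]) z) = ip x y * fine (mu (h @^-1` [set x])).
  have [->|x0] := eqVneq x 0.
    rewrite ip0l mul0r; split.
      apply: (eq_integrable _ (cst 0%E)) => //; last exact: integrable0.
      by move=> z _; rewrite /= mul0r.
    by under eq_Rintegral do rewrite mul0r; rewrite /Rintegral integral0.
  have ii : mu.-integrable setT (EFin \o \1_(h @^-1` [set x])).
    apply/integrableP; split; first exact/measurable_EFinP/measurable_indic.
    under eq_integral do rewrite /= ger0_norm//.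
    by rewrite integral_indic// setIT; exact: mu_h.
  split; first exact: (integrableZl measurableT (ip x y) ii).
  by rewrite RintegralZl// /Rintegral integral_indic// setIT.
have Fi t : mu.-integrable setT (EFin \o F t) /\
    \int[mu]_z F t z = \sum_(x <- t) ip x y * fine (mu (h @^-1` [set x])).
  elim: t => [|x t [IH1 IH2]].
    split.
      apply: (eq_integrable _ (cst 0%E)) => //; last exact: integrable0.
      by move=> z _; rewrite /= /F big_nil.
    by rewrite big_nil; under eq_Rintegral do rewrite /F big_nil; rewrite /Rintegral integral0.
  have [t1 t2] := term x.
  have FE z : F (x :: t) z = ip x y * \1_(h @^-1` [set x]) z + F t z by rewrite /F big_cons.
  split.
    apply: (eq_integrable _ (fun z => (ip x y * \1_(h @^-1` [set x]) z)%:E + (F t z)%:E)%E) => //.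
      by move=> z _; rewrite /= FE EFinD.
    exact: integrableD.
  by under eq_Rintegral do rewrite FE; rewrite RintegralD// t2 IH2 big_cons.
have hF z : ip (h z) y = F s z.
  have hs : h z \in s.
    by have : h z \in fset_set (range h) by rewrite in_fset_set// inE; exists z.
  rewrite /F (big_rem _ hs)/= indicE mem_set// mulr1 big1_seq ?addr0// => x /andP[_ xs].
  rewrite indicE memNset ?mulr0// => /= hx.
  move: xs; rewrite -hx (@mem_rem_uniq _ _ s) ?finmap.fset_uniq//.
  by rewrite inE eqxx.
have [Fi1 Fi2] := Fi s; split.
  by apply: eq_integrable Fi1 => // z _; rewrite /= hF.
under eq_Rintegral do rewrite hF.
rewrite Fi2 /simple_integral fsbig_finite//= -/s.
elim: (s : seq X) => [|x t IH]; first by rewrite !big_nil ip0l.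
by rewrite !big_cons ipDl IH ipZl mulrC.
Qed.

Lemma weakly_measurable_simple h : integrable_simple mu h -> weakly_measurable h.
Proof.
by move=> ih y; have [/measurable_int/measurable_EFinP] := integrable_simple_ip y ih.
Qed.

(** Duality reduces every estimate on vector integrals to scalar ones. *)
Lemma simple_integral_dist f h y : weakly_measurable f ->
  (\int[mu]_z `|f z|%:E < +oo)%E -> integrable_simple mu h ->
  (`|ip (simple_integral mu h) y - \int[mu]_z ip (f z) y|%:E <=
   `|y|%:E * \int[mu]_z `|f z - h z|%:E)%E.
Proof.
move=> mf fi ih; have [ih1 ->] := integrable_simple_ip y ih.
have if1 := norm_integrable_ip y mf fi.
have mh := weakly_measurable_simple ih.
have mn := measurable_norm_weak (weakly_measurableB mf mh).
rewrite -RintegralB//.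
have ihf : mu.-integrable setT (EFin \o (fun z => ip (h z) y - ip (f z) y)).
  by apply: (eq_integrable _ (fun z => (ip (h z) y)%:E - (ip (f z) y)%:E)%E) => //; exact: integrableB.
rewrite (le_trans (y := (\int[mu]_z `|ip (h z) y - ip (f z) y|%:E)%E))//.
  rewrite EFin_normr_Rintegral//; exact: le_abse_integral (measurable_int _ ihf).
rewrite -ge0_integralZl//; last exact/measurable_EFinP.
apply: ge0_le_integral => //.
- apply/measurable_EFinP; apply: measurableT_comp => //.
  by apply/measurable_EFinP; exact: measurable_int ihf.
- by apply: measurable_funeM; exact/measurable_EFinP.
- by move=> z _; rewrite -EFinM lee_fin -ipBl distrC mulrC cauchy_schwarz.
Qed.

(** The approximations run through a dense sequence and keep the closest point
    seen so far. Starting from [0] makes [`|f|] a bound for the error, so that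
    dominated convergence applies and the simple functions are integrable. *)
Lemma approx_simple f : weakly_measurable f -> (\int[mu]_z `|f z|%:E < +oo)%E ->
  exists h_ : nat -> T -> X, [/\ forall n, integrable_simple mu (h_ n),
    forall z, h_ n z @[n --> \oo] --> f z &
    (\int[mu]_z `|f z - h_ n z|%:E)%E @[n --> \oo] --> 0%E].
Proof.
move=> mf fi; have [D DP] := dense_seq_exists sepX.
pose fix h (n : nat) (z : T) {struct n} : X := if n is k.+1 then
  (if `|f z - D k| < `|f z - h k z| then D k else h k z) else 0.
have mh n : weakly_measurable (h n).
  elim: n => [|n IH] y /=; first exact: measurable_cst.
  under eq_fun do rewrite (fun_if (fun x => ip x y)).
  have m1 : measurable_fun setT (fun z => `|f z - D n|).
    apply: measurable_norm_weak.
    by apply: weakly_measurableB => //; exact: weakly_measurable_cst.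
  have m2 : measurable_fun setT (fun z => `|f z - h n z|).
    by apply: measurable_norm_weak; exact: weakly_measurableB.
  exact: (measurable_fun_ifT (measurable_fun_ltr m1 m2) (measurable_cst _) (IH y)).
have h_dec n z : `|f z - h n.+1 z| <= `|f z - h n z|.
  by rewrite /=; case: ifPn => // /ltW.
have h_le n m z : (n <= m)%N -> `|f z - h m z| <= `|f z - h n z|.
  elim: m => [|m IH]; first by rewrite leqn0 => /eqP->.
  rewrite leq_eqVlt => /orP[/eqP->//|]; rewrite ltnS => /IH.
  exact: le_trans (h_dec _ _).
have h_le0 n z : `|f z - h n z| <= `|f z|.
  by have := h_le 0%N n z (leq0n _); rewrite /= subr0.
have h_leD k z : `|f z - h k.+1 z| <= `|f z - D k|.
  by rewrite /=; case: ltP.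
have hcvg z : h n z @[n --> \oo] --> f z.
  apply/cvgrPdist_lt => eps eps0; have [k fk] := DP (f z) _ eps0.
  exists k.+1 => // n /= kn; rewrite (le_lt_trans (h_le _ _ _ kn))//.
  by rewrite (le_lt_trans (h_leD _ _)).
have h_fin n : finite_set (range (h n)).
  elim: n => [|n IH].
    by apply: (sub_finite_set _ (finite_set1 (0 : X))) => _ [z _ <-].
  apply: (@sub_finite_set _ _ (range (h n) `|` [set D n])).
    move=> _ [z _ <-] /=; case: ifP => _; [by right|left].
    by exists z.
  by rewrite finite_setU; split.
have mset n x : measurable (h n @^-1` [set x]).
  have m := measurable_norm_weak (weakly_measurableB (mh n) (weakly_measurable_cst x)).
  have := m measurableT [set 0] (measurable_set1 _); rewrite setTI.
  congr measurable; apply/seteqP; split => z /=.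
    by move/eqP; rewrite normr_eq0 subr_eq0 => /eqP.
  by move=> ->; rewrite subrr normr0.
have mnf := measurable_norm_weak mf.
exists h; split => //.
  move=> n; split => // x x0; set E := h n @^-1` [set x].
  have c0 : 0 < `|x| / 2 by rewrite divr_gt0// normr_gt0.
  have : ((`|x| / 2)%:E * mu E <= \int[mu]_z `|f z|%:E)%E.
    have mE : measurable_fun setT (fun z => (\1_E z : R)%:E).
      by apply/measurable_EFinP; apply: measurable_indic; exact: mset.
    rewrite -(setIT E) -(integral_indic mu measurableT (mset n x)).
    rewrite -(ge0_integralZl mu measurableT mE)//.
    apply: ge0_le_integral => //.
    - exact: measurable_funeM.
    - exact/measurable_EFinP.
    - move=> z _; rewrite -EFinM lee_fin indicE.
      have [/set_mem zE|_] := boolP (z \in E); last by rewrite mulr0.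
      rewrite mulr1; have := h_le0 n z; rewrite [h n z]zE => fx.
      have := ler_normB (f z) (f z - x); rewrite opprB addrCA subrr addr0.
      by lra.
  move=> /le_lt_trans/(_ fi); have := measure_ge0 mu E.
  case: (mu E) => [r _ _|_|//]; first exact: ltry.
  by rewrite gt0_muley ?lte_fin// ltxx.
have mg n : measurable_fun setT (fun z => `|f z - h n z|).
  by apply: measurable_norm_weak; exact: weakly_measurableB.
have ifn : mu.-integrable setT (EFin \o (fun z => `|f z|)).
  apply/integrableP; split; first exact/measurable_EFinP.
  by under eq_integral do rewrite /= normr_id.
suff [_ _] : [/\ mu.-integrable setT (cst 0%E : T -> \bar R),
    [sequence (\int[mu]_z `| `|f z - h n z|%:E - cst 0 z |)%E]_n @ \oo --> 0%E &
    [sequence (\int[mu]_z `|f z - h n z|%:E)%E]_n @ \oo --> (\int[mu]_z cst 0 z)%E].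
  by rewrite integral0.
apply: (@dominated_convergence _ _ _ mu setT measurableT
  (fun n z => `|f z - h n z|%:E) (cst 0%E) (EFin \o (fun z => `|f z|))).
- by move=> n; exact/measurable_EFinP.
- exact: measurable_cst.
- apply: aeW => z _; apply: cvg_EFin; first exact: nearW.
  apply/cvgrPdist_lt => eps eps0; have /cvgrPdist_lt/(_ _ eps0) := hcvg z.
  by apply: filterS => n; rewrite /= sub0r normrN normr_id.
- exact: ifn.
- by apply: aeW => z n _; rewrite /= lee_fin normr_id.
Qed.

Lemma bochner_integral_exists f : weakly_measurable f ->
  (\int[mu]_z `|f z|%:E < +oo)%E -> exists (h_ : nat -> T -> X) v, [/\ forall n, integrable_simple mu (h_ n),
    forall z, h_ n z @[n --> \oo] --> f z,
    (\int[mu]_z `|f z - h_ n z|%:E)%E @[n --> \oo] --> 0%E &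
    simple_integral mu (h_ n) @[n --> \oo] --> v].
Proof.
move=> mf fi; have [h_ [hs hf hi]] := approx_simple mf fi.
exists h_; pose I n := simple_integral mu (h_ n).
suff /cvg_ex[/= v Iv] : cvgn I by exists v.
apply/cauchy_cvgP; apply: cauchy_exP => eps eps0.
have e2 : 0 < eps / 2 by rewrite divr_gt0.
have [N _ NP] : \forall n \near \oo, (\int[mu]_z `|f z - h_ n z|%:E < (eps / 2)%:E)%E.
  exact: cvge0_near_lt.
exists (I N); exists N => // n /= Nn; rewrite -ball_normE/=.
have dist m y : (N <= m)%N -> y != 0 ->
    `|ip (I m) y - \int[mu]_z ip (f z) y| < `|y| * (eps / 2).
  move=> Nm y0; rewrite -lte_fin (le_lt_trans (simple_integral_dist y mf fi (hs m)))//.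
  by rewrite EFinM lte_pmul2l// ?lte_fin ?normr_gt0//; exact: NP.
have [->|y0] := eqVneq (I N - I n) 0; first by rewrite normr0.
rewrite -(@ltr_pM2l _ `|I N - I n|) ?normr_gt0// -expr2 -ip_norm.
rewrite {1}ipBl (_ : ip (I N) _ - ip (I n) _ =
  (ip (I N) (I N - I n) - \int[mu]_z ip (f z) (I N - I n)) -
  (ip (I n) (I N - I n) - \int[mu]_z ip (f z) (I N - I n))); last by ring.
rewrite (le_lt_trans (ler_norm _))// (le_lt_trans (ler_normB _ _))//.
rewrite [eps in ltRHS]splitr mulrDr ltrD// dist//.
Qed.

(** Sequences that approximate the measurable version [f1] of [f] approximate [f]
    as well, which gives existence. Conversely every approximating sequence of
    [f] has the same limit against [y], since [simple_integral_dist] compares it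
    with [f1]. *)
Lemma bochner_ip (D : set T) f f1 N y : measurable N -> mu N = 0%E ->
  (forall z, ~ N z -> f1 z = if z \in D then f z else 0) ->
  weakly_measurable f1 -> (\int[mu]_z `|f1 z|%:E < +oo)%E ->
  ip (bochner mu D f) y = \int[mu]_z ip (f1 z) y.
Proof.
move=> mN N0 f1f mf fi; rewrite /bochner.
set F := fun z => if z \in D then f z else 0.
have mn h : integrable_simple mu h -> measurable_fun setT (fun z => (`|f1 z - h z|)%:E).
  move=> hs; apply/measurable_EFinP; apply: measurable_norm_weak.
  by apply: weakly_measurableB => //; exact: weakly_measurable_simple.
case: xgetP => [v _ /= [h_ [hs hF hi hv]]|noF]; last first.
  have [h_ [v [hs hf hi hv]]] := bochner_integral_exists mf fi.
  case: (noF v); exists h_; split => //.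
    exists N; split => // z /= nz; apply: contrapT => Nz; apply: nz.
    by rewrite -/(F z) /F -f1f//; exact: hf.
  apply: (squeeze_cvge _ (cvg_cst 0%E) hi); apply: nearW => n.
  apply/andP; split; first by apply: integral_ge0 => z _; rewrite lee_fin.
  apply: (le_integral_off_null_r mN N0) => //; first exact: mn.
  by move=> z Nz; rewrite lee_fin f1f.
have ipv : ip (simple_integral mu (h_ n)) y @[n --> \oo] --> ip v y by exact: cvg_ipl.
apply: (cvg_unique _ ipv) => //.
have h0 : (`|y|%:E * \int[mu]_z `|F z - h_ n z|%:E)%E @[n --> \oo] --> 0%E.
  by rewrite -(mule0 `|y|%:E); exact: cvgeZl.
apply/cvgrPdist_lt => eps eps0.
have : \forall n \near \oo, (`|y|%:E * \int[mu]_z `|F z - h_ n z|%:E < eps%:E)%E.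
  exact: cvge0_near_lt.
apply: filterS => n; rewrite -lte_fin distrC; apply: le_lt_trans.
rewrite (le_trans (simple_integral_dist y mf fi (hs n)))//.
apply: lee_wpmul2l; first by rewrite lee_fin.
apply: (le_integral_off_null_l mN N0) => //; first exact: mn.
by move=> z Nz; rewrite lee_fin f1f.
Qed.

End bochner_theory.

(** * Lebesgue measurable functions of the time *)

Section real_line.
Context {R : realType}.
Local Notation mu := (@lebesgue_measure R).
Local Notation TR := (measurableTypeR R).

(** Countably many Lebesgue measurable functions are simultaneously Borel off
    a single null set, because rational superlevel sets determine a function. *)
Lemma lebesgue_borel_off_null (I : countType) (f : I -> R -> R) :
  (forall i (q : rat), completed_algebra_gen mu [set r | ratr q < f i r]) ->
  exists N : set TR, [/\ measurable N, mu N = 0%E &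
    forall i, measurable_fun (~` N) (f i : TR -> R)].
Proof.
move=> mf.
have ex (p : I * rat) : exists AN : set TR * set TR, [/\ measurable AN.1,
    measurable AN.2, mu AN.2 = 0%E &
    forall r, ~ AN.2 r -> ([set r | ratr p.2 < f p.1 r] r <-> AN.1 r)].
  have [A mA [M [N [mN N0 MN]] AM]] := mf p.1 p.2; exists (A, N); split => //= r Nr.
  by rewrite -/([set r | ratr p.2 < f p.1 r] r) -AM; split=> [[//|/MN]//|]; left.
have {ex} [AN ANP] := choice ex.
exists (\bigcup_p (AN p).2); split.
- apply: countable_bigcupT_measurable; first exact: countableP.
  by move=> p; have [] := ANP p.
- apply/eqP; rewrite eq_le measure_ge0 andbT.
  pose F (n : nat) : set TR :=
    if @choice.unpickle (I * rat)%type n is Some p then (AN p).2 else set0.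
  have H := measure_sigma_subadditive mu (F := F) (A := \bigcup_p (AN p).2).
  apply: le_trans (H _ _ _) _ => {H}; rewrite /F.
  + by move=> n; case: choice.unpickle => // p; have [] := ANP p.
  + apply: countable_bigcupT_measurable; first exact: countableP.
    by move=> p; have [] := ANP p.
  + by move=> r [p _ pr]; exists (choice.pickle p) => //=; rewrite choice.pickleK.
  + rewrite eseries0// => n _ _.
    by case: choice.unpickle => [p|]; [have [] := ANP p|rewrite measure0].
- move=> i; have mN : measurable (\bigcup_p (AN p).2 : set TR).
    apply: countable_bigcupT_measurable; first exact: countableP.
    by move=> p; have [] := ANP p.
  apply: (@measurability _ _ TR _ _ _ (@RGenOInfty.G R)).
    exact: RGenOInfty.measurableE.
  move=> _ [_ [a ->] <-].
  rewrite (_ : _ `&` _ = ~` (\bigcup_p (AN p).2) `&`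
    \bigcup_(q in [set q : rat | a < ratr q]) (AN (i, q)).1).
    apply: measurableI; first exact: measurableC.
    rewrite bigcup_mkcond; apply: countable_bigcupT_measurable => [|q].
      exact: countableP.
    by case: ifP => // _; have [] := ANP (i, q).
  apply/seteqP; split => r [Nr] /=; rewrite in_itv/= andbT.
    move=> /rat_in_itvoo[q]; rewrite in_itv/= => /andP[aq qf]; split => //.
    exists q => //; have [_ _ _ /(_ r)[|h _]] := ANP (i, q); last exact: h.
    by move=> ?; apply: Nr; exists (i, q).
  move=> [q /= aq qr]; split => //; apply: lt_trans aq _.
  have [_ _ _ /(_ r)[|_ h]] := ANP (i, q); last exact: h.
  by move=> ?; apply: Nr; exists (i, q).
Qed.

Lemma integral_exp_tail (a t : R) : 0 < a ->
  (\int[mu]_(r in `]-oo, t]) (expR (- (a * (t - r))))%:E = (a^-1)%:E)%E.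
Proof.
move=> a0; have cE b c : continuous (fun x : R => b * expR (- (a * (c + x)))).
  move=> x; apply: cvgM; first exact: cvg_cst.
  apply: continuous_comp; last exact: continuous_expR.
  apply: cvgN; apply: cvgM; first exact: cvg_cst.
  by apply: cvgD; [exact: cvg_cst|exact: cvg_id].
have cG : continuous (fun r : R => expR (- (a * (t - r)))).
  move=> x; apply: continuous_comp; last exact: continuous_expR.
  apply: cvgN; apply: cvgM; first exact: cvg_cst.
  by apply: cvgB; [exact: cvg_cst|exact: cvg_id].
have := @ge0_integration_by_substitutionNy R (fun r => expR (- (a * (t - r)))) (- t).
rewrite opprK => ->; last 2 first.
- exact: continuous_subspaceT.
- by move=> x _; exact: expR_ge0.
have dF (x : R) : is_derive x (1 : R) (fun x : R => - a^-1 * expR (- (a * (t + x))))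
    (expR (- (a * (t + x)))).
  apply: is_derive_eq.
  by rewrite /GRing.scale/= add0r mulr1; field; rewrite gt_eqF.
rewrite (@ge0_continuous_FTC2y R _ (fun x => - a^-1 * expR (- (a * (t + x)))) (- t) 0).
- by rewrite subrr mulr0 oppr0 expR0 mulr1 -EFinB sub0r opprK.
- by move=> x _; exact: expR_ge0.
- apply: continuous_subspaceT => x.
  rewrite (_ : _ \o _ = fun y => 1 * expR (- (a * (t + y)))); first exact: cE.
  by apply/funext => y; rewrite /= opprK mul1r.
- rewrite -(mulr0 (- a^-1)); apply: cvgM; first exact: cvg_cst.
  apply: (cvg_comp _ _ _ (@cvgr_expR R)).
  have : (fun x : R => a * (t + x)) x @[x --> +oo] --> +oo.
    apply/cvgryPge => A; near=> x; rewrite mulrC -ler_pdivrMr// -lerBlDl.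
    by near: x; apply: nbhs_pinfty_ge; exact: num_real.
  by [].
- by move=> x _; have [] := dF x.
- by apply: cvg_at_right_filter; exact: (cE (- a^-1) t (- t)).
- by move=> x _; rewrite derive1E; have [_ ->] := dF x; rewrite /= opprK.
Unshelve. all: end_near. Qed.

End real_line.

(** * Weak form of the covariance operators *)

Section covariance_integrals.
Context {R : realType} {X : completeNormedModType R} (ip : {dot X for idfun}).
Hypothesis ip_norm : forall x : X, ip x x = `|x| ^+ 2.
Hypothesis sepX : separable X.
Local Notation mu := (@lebesgue_measure R).
Local Notation TR := (measurableTypeR R).
Variables (U : R -> R -> X -> X) (B : R -> X -> X) (M K a : R).
Hypothesis U_bl : forall s t, s <= t -> bounded_linear_op (U t s).
Hypothesis U_cont : forall x, {within [set p : R * R | p.2 <= p.1],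
  continuous (fun p : R * R => U p.1 p.2 x)}.
Hypotheses (M0 : 0 <= M) (a0 : 0 < a).
Hypothesis U_decay : forall s t, s <= t -> op_norm (U t s) <= M * expR (- (a * (t - s))).
Hypothesis B_bl : forall t, bounded_linear_op (B t).
Hypothesis B_le : forall t, op_norm (B t) <= K.

(** The vector [B(r)^* U(t,r)^* x]: the integrands of the covariance operators
    are the Gram forms of these vectors. *)
Definition dual_observation t r x := adjoint ip (B r) (adjoint ip (U t r) x).
Local Notation obs := dual_observation.

Let K0 : 0 <= K.
Proof. exact: le_trans (op_norm_ge0 (B_bl 0)) (B_le 0). Qed.

Lemma dual_observation_ip t r x y : r <= t ->
  ip (obs t r x) y = ip x (U t r (B r y)).
Proof.
move=> rt; rewrite ipC -(adjointP ip_norm sepX (B_bl r)).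
by rewrite -(adjointP ip_norm sepX (U_bl rt)) ipC.
Qed.

Lemma norm_dual_observation t r x : r <= t ->
  `|obs t r x| <= M * K * expR (- (a * (t - r))) * `|x|.
Proof.
move=> rt; have h := norm_adjoint_le ip_norm sepX x (U_bl rt).
apply: (le_trans (norm_adjoint_le ip_norm sepX _ (B_bl r))).
rewrite (_ : M * K * _ * _ = K * (M * expR (- (a * (t - r))) * `|x|)); last by ring.
apply: ler_pM => //; first exact: op_norm_ge0.
by apply: le_trans h _; rewrite ler_wpM2r// U_decay.
Qed.

Lemma covariance_integrand_ip t r x y : r <= t ->
  ip (U t r (B r (obs t r x))) y = ip (obs t r x) (obs t r y).
Proof. by move=> rt; rewrite (ipC ip _ y) -dual_observation_ip// ipC. Qed.

Lemma norm_covariance_integrand t r x : r <= t ->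
  `|U t r (B r (obs t r x))| <=
  (M * K) ^+ 2 * `|x| * expR (- (2 * a * (t - r))).
Proof.
move=> rt; apply: (le_trans (op_normP _ (U_bl rt))).
rewrite (_ : _ * expR _ = M * expR (- (a * (t - r))) *
   (K * (M * K * expR (- (a * (t - r))) * `|x|))); last first.
  by rewrite (_ : - (2 * a * (t - r)) = - (a * (t - r)) - (a * (t - r)));
    [rewrite expRD; ring|ring].
apply: ler_pM => //; [by apply: op_norm_ge0; exact: U_bl|exact: U_decay|].
apply: (le_trans (op_normP _ (B_bl r))).
by apply: ler_pM => //; [exact: op_norm_ge0|exact: norm_dual_observation].
Qed.

Lemma measurable_evolution_ip t x y :
  measurable_fun (`]-oo, t]%classic : set TR) (fun r => ip x (U t r y)).
Proof.
apply: subspace_continuous_measurable_fun; first exact: measurable_itv.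
apply/subspace_continuousP => r; rewrite /= in_itv/= => rt.
under eq_fun do rewrite ipC; rewrite ipC; apply: cvg_ipl => //.
move: (@U_cont y) => /subspace_continuousP/(_ (t, r) rt) h; apply: (cvg_comp (fun r : R => (t, r)) _ _ h) => A /= [].
move=> [P Q] /= [Pt Qr] PQ; rewrite /within/=.
apply: filterS Qr => r' Qr'; rewrite in_itv/= => r't.
by apply: (PQ (t, r')) => //; split => //=; exact: nbhs_singleton.
Qed.

Section off_null_set.
Variables (N : set TR) (e : nat -> X).
Hypotheses (mN : measurable N) (N0 : mu N = 0%E).
Hypotheses (e_on : orthonormal_seq ip e) (e_total : total_seq ip e).
Hypothesis B_meas : forall n m, measurable_fun (~` N) (fun r : TR => ip (B r (e n)) (e m)).

Let past t : set TR := `]-oo, t] `\` N.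

Let measurable_past t : measurable (past t).
Proof. by apply: measurableD => //; exact: measurable_itv. Qed.

(** Coordinatewise, [B^* U^* x] is a series of products of a measurable and a
    continuous function of the time. *)
Lemma measurable_dual_observation t x n :
  measurable_fun (past t) (fun r => ip (obs t r x) (e n)).
Proof.
apply: (@measurable_fun_cvg _ TR R _ (fun k r => \sum_(i < k) ip x (U t r (e i)) * ip (B r (e n)) (e i))).
  move=> k; apply: measurable_sum => i; apply: measurable_funM.
    by apply: (measurable_funS _ _ (@measurable_evolution_ip t x (e i))) => // r [].
  apply: (measurable_funS _ _ (B_meas n i)); first exact: measurableC.
  by move=> r [].
move=> r [/=]; rewrite in_itv/= => rt _.
have h := @parseval _ _ _ ip_norm _ e_on e_total (adjoint ip (U t r) x) (B r (e n)).
rewrite dual_observation_ip// ipC (adjointP ip_norm sepX (U_bl rt)) ipC.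
apply: cvg_trans h; apply: near_eq_cvg; apply: nearW => k; apply: eq_bigr => i _.
by rewrite ipC -(adjointP ip_norm sepX (U_bl rt)) ipC.
Qed.

Lemma measurable_dual_observation_ip t x y :
  measurable_fun (past t) (fun r => ip (obs t r x) (obs t r y)).
Proof.
apply: (@measurable_fun_cvg _ TR R _ (fun k r => \sum_(i < k) ip (obs t r x) (e i) * ip (obs t r y) (e i))).
  by move=> k; apply: measurable_sum => i; apply: measurable_funM; exact: measurable_dual_observation.
by move=> r _; exact: (@parseval _ _ _ ip_norm _ e_on e_total).
Qed.

Variables (t : R) (J : set TR).
Hypotheses (mJ : measurable J) (Jt : forall r, J r -> r <= t).

Definition covariance_density x y r :=
  if r \in J `\` N then ip (obs t r x) (obs t r y) else 0.

Let F x r := if r \in J `\` N then U t r (B r (obs t r x)) else 0.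

Let FE x y r : ip (F x r) y = covariance_density x y r.
Proof.
rewrite /F /covariance_density; case: ifPn => [/set_mem[/Jt rt _]|_]; last by rewrite ip0l.
exact: covariance_integrand_ip.
Qed.

Lemma measurable_covariance_density x y :
  measurable_fun setT (covariance_density x y : TR -> R).
Proof.
have mJN : measurable (J `\` N : set TR) by exact: measurableD.
have := (measurable_restrictT (fun r : TR => ip (obs t r x) (obs t r y)) mJN).1.
rewrite /patch => h; apply: h.
apply: (measurable_funS _ _ (@measurable_dual_observation_ip t x y)) => //.
by move=> r [Jr Nr]; split => //=; rewrite in_itv/= Jt.
Qed.

Let wF x : weakly_measurable ip (F x : TR -> X).
Proof. by move=> y; under eq_fun do rewrite FE; exact: measurable_covariance_density. Qed.

Let cst := (M * K) ^+ 2 / (2 * a).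

Let intF x : (\int[mu]_r `|F x r|%:E <= (cst * `|x|)%:E)%E.
Proof.
have mE : measurable_fun setT (fun r : TR => (expR (- (2 * a * (t - r))))%:E).
  apply/measurable_EFinP; apply: continuous_measurable_fun => r.
  apply: continuous_comp; last exact: continuous_expR.
  apply: cvgN; apply: cvgM; first exact: cvg_cst.
  by apply: cvgB; [exact: cvg_cst|exact: cvg_id].
have a20 : 0 < 2 * a by rewrite mulr_gt0.
have mt : measurable (`]-oo, t]%classic : set TR) by exact: measurable_itv.
have c0 : (0 <= ((M * K) ^+ 2 * `|x|)%:E)%E by rewrite lee_fin mulr_ge0// exprn_ge0// mulr_ge0.
rewrite (_ : (cst * `|x|)%:E = ((M * K) ^+ 2 * `|x|)%:E * ((2 * a)^-1)%:E)%E; last first.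
  by rewrite -EFinM /cst; congr EFin; ring.
rewrite -(integral_exp_tail t a20) -(ge0_integralZl mu mt (measurable_funTS mE))//.
rewrite [leRHS]integral_mkcond; apply: ge0_le_integral => //.
- by apply/measurable_EFinP; exact: (measurable_norm_weak ip_norm sepX (wF x)).
- have h := (measurable_restrictT (fun r : TR => ((((M * K) ^+ 2 * `|x|)%R)%:E *
    (expR (- (2 * a * (t - r))))%:E)%E) mt).1.
  by apply: h; apply: measurable_funTS; exact: measurable_funeM.
- move=> r _; rewrite patchE /F.
  have -> : (r \in J `\` N) = (r \in J `\` N) && (r \in `]-oo, t]%classic).
    case: (boolP (r \in J `\` N)) => //= /set_mem[/Jt rt _].
    by apply/esym/mem_set; rewrite /= in_itv.
  case: (r \in J `\` N) => /=.
    case: ifPn => [/set_mem/=|_]; last by rewrite normr0.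
    by rewrite in_itv/= => rt; rewrite -EFinM lee_fin; exact: norm_covariance_integrand.
  rewrite normr0; case: ifP => _ //.
  by rewrite mule_ge0.
Qed.

Let intF_lty x : (\int[mu]_r `|F x r|%:E < +oo)%E.
Proof. exact: le_lt_trans (intF x) (ltry _). Qed.

Lemma integrable_covariance_density x y :
  mu.-integrable setT (EFin \o covariance_density x y : TR -> \bar R).
Proof.
have := norm_integrable_ip ip_norm sepX y (wF x) (intF_lty x).
by apply: eq_integrable => // r _ /=; rewrite FE.
Qed.

(** All properties of the covariance operators are read off these scalar
    integrals. *)
Lemma covariance_ip x y :
  ip (Defs.covariance ip U B t J x) y = \int[mu]_r covariance_density x y r.
Proof.
rewrite /Defs.covariance (@bochner_ip _ _ _ ip_norm sepX _ _ _ _ _ (F x) N y)//.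
- by apply: eq_Rintegral => r _; rewrite FE.
- move=> r Nr; rewrite /F; congr (if _ then _ else _).
  by apply/idP/idP => /set_mem h; apply/mem_set => //; case: h.
Qed.

Lemma covariance_ip_le x y :
  `|ip (Defs.covariance ip U B t J x) y| <= (M * K) ^+ 2 / (2 * a) * `|x| * `|y|.
Proof.
rewrite covariance_ip -lee_fin EFin_normr_Rintegral//; last exact: integrable_covariance_density.
have mf := measurable_norm_weak ip_norm sepX (wF x).
apply: (le_trans (le_abse_integral mu measurableT _)).
  exact: (measurable_int mu (integrable_covariance_density x y)).
apply: (@le_trans _ _ (`|y|%:E * \int[mu]_r `|F x r|%:E)%E).
  rewrite -(ge0_integralZl mu measurableT)//; last exact/measurable_EFinP.
  apply: ge0_le_integral => //.
  - apply/measurable_EFinP; apply: measurableT_comp => //.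
    exact: measurable_covariance_density.
  - by apply: measurable_funeM; exact/measurable_EFinP.
  - by move=> r _; rewrite -EFinM lee_fin -FE mulrC cauchy_schwarz.
by rewrite (mulrC _ `|y|) EFinM; apply: lee_wpmul2l; rewrite ?lee_fin//; exact: intF.
Qed.

Lemma covariance_nonneg_op : nonneg_op ip (Defs.covariance ip U B t J).
Proof.
have sym x y : ip (Defs.covariance ip U B t J x) y = ip (Defs.covariance ip U B t J y) x.
  by rewrite !covariance_ip; apply: eq_Rintegral => r _; rewrite /covariance_density ipC.
split.
- split.
    move=> k x y; apply: (ip_extl ip_norm) => z.
    by rewrite sym ipDr ipZr ipDl ipZl !(sym z).
  exists cst => x; set v := Defs.covariance _ _ _ _ _ _.
  have [->|v0] := eqVneq v 0.
    by rewrite normr0 mulr_ge0// divr_ge0 ?exprn_ge0 ?mulr_ge0// ltW.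
  have := covariance_ip_le x v; rewrite -/v ip_norm ger0_norm ?exprn_ge0//.
  by rewrite expr2 ler_pM2r// normr_gt0.
- by move=> x y; rewrite sym ipC.
- move=> x; rewrite covariance_ip; apply: Rintegral_ge0 => // r _.
  by rewrite /covariance_density; case: ifP => // _; rewrite ip_norm exprn_ge0.
Qed.

End off_null_set.
End covariance_integrals.

(** * Splitting and traces of the covariance operators *)

(** The trace is a sum over an unspecified basis; [e] enumerates that same basis,
    with zeros filling the unused indices. *)
Lemma sum_basis_le_op_trace {R : realType} {X : completeNormedModType R}
    (ip : {dot X for idfun}) (T : X -> X) (e : nat -> X) n :
  (forall x, 0 <= ip (T x) x) -> orthonormal_seq ip e ->
  (forall k, e k = 0 \/ xget set0 [set E | orthonormal_basis ip E] (e k)) ->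
  ((\sum_(i < n) ip (T (e i)) (e i))%:E <= op_trace ip T)%E.
Proof.
move=> T0 [_ e_orth] eE; pose r := [seq e i | i <- iota 0 n & e i != 0].
have r_uniq : uniq r.
  rewrite map_inj_in_uniq ?filter_uniq ?iota_uniq// => i j.
  rewrite !mem_filter => /andP[ei _] _ eij; apply/eqP; apply: contraNT ei => ij.
  case: (eE i) => [->//|Eei]; case: xgetP Eei => // E _ [E1 _ _] Eei.
  by have := e_orth _ _ ij; rewrite -eij E1// => /eqP; rewrite oner_eq0.
apply: esum_ge; exists [set` r].
  split; first exact: finite_seq.
  move=> x /mapP[i]; rewrite mem_filter => /andP[ei _] ->.
  by case: (eE i) => // e0; rewrite e0 eqxx in ei.
rewrite -fsbig_seq// big_map big_filter -sumEFin -(big_mkord xpredT (fun i => (ip (T (e i)) (e i))%:E)).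
rewrite /index_iota subn0 [leRHS]big_mkcond/=; apply: lee_sum => i _.
by case: eqVneq => [->|//]; rewrite ip0r.
Qed.

Section evolution_covariance.
Context {R : realType} {X : completeNormedModType R} (ip : {dot X for idfun}).
Hypothesis ip_norm : forall x : X, ip x x = `|x| ^+ 2.
Hypothesis sepX : separable X.
Local Notation mu := (@lebesgue_measure R).
Local Notation TR := (measurableTypeR R).

Lemma weak_borel_off_null (B : R -> X -> X) (e : nat -> X) :
  (forall x, lebesgue_measurable_fun (fun t => B t x)) ->
  exists N : set TR, [/\ measurable N, mu N = 0%E &
    forall n m, measurable_fun (~` N) (fun r : TR => ip (B r (e n)) (e m))].
Proof.
move=> mB.
have [[n m] q|N [mN N0 BN]] := @lebesgue_borel_off_null R (nat * nat)%type
    (fun p r => ip (B r (e p.1)) (e p.2)).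
  rewrite -g_sigma_completed_algebra_genE /=.
  have := mB (e n) measurableT [set z | ratr q < ip z (e m)].
  rewrite setTI; apply; apply: sub_sigma_algebra.
  apply: (open_comp (f := fun z => ip z (e m)) (D := [set y : R | ratr q < y])).
    by move=> z _; exact: continuous_ipl.
  exact: open_gt.
by exists N; split => // n m; exact: (BN (n, m)).
Qed.

Variables (U : R -> R -> X -> X) (B : R -> X -> X) (M K a : R).
Hypothesis U_bl : forall s t, s <= t -> bounded_linear_op (U t s).
Hypothesis U_comp : forall s r t x, s <= r -> r <= t -> U t s x = U t r (U r s x).
Hypothesis U_cont : forall x, {within [set p : R * R | p.2 <= p.1],
  continuous (fun p : R * R => U p.1 p.2 x)}.
Hypotheses (M0 : 0 <= M) (a0 : 0 < a).
Hypothesis U_decay : forall s t, s <= t -> op_norm (U t s) <= M * expR (- (a * (t - s))).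
Hypothesis B_bl : forall t, bounded_linear_op (B t).
Hypothesis B_le : forall t, op_norm (B t) <= K.
Hypothesis B_measurable : forall x, lebesgue_measurable_fun (fun t => B t x).
Implicit Types (x y : X).

Let Cgrowth := (M * K) ^+ 2 / (2 * a).

Lemma Qcov_nonneg_op s t : nonneg_op ip (Qcov ip U B t s).
Proof.
have [e [e_on e_total]] := basis_seq_exists ip_norm sepX.
have [N [mN N0 BN]] := weak_borel_off_null e B_measurable.
apply: (covariance_nonneg_op ip_norm sepX U_bl U_cont M0 a0 U_decay B_bl B_le mN N0 e_on e_total BN).
- exact: measurable_itv.
- by move=> r /=; rewrite in_itv => /andP[].
Qed.

Lemma Qcov_ninfty_nonneg_op t : nonneg_op ip (Qcov_ninfty ip U B t).
Proof.
have [e [e_on e_total]] := basis_seq_exists ip_norm sepX.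
have [N [mN N0 BN]] := weak_borel_off_null e B_measurable.
apply: (covariance_nonneg_op ip_norm sepX U_bl U_cont M0 a0 U_decay B_bl B_le mN N0 e_on e_total BN).
- exact: measurable_itv.
- by move=> r /=; rewrite in_itv.
Qed.

Lemma Qcov_ninfty_le t x : ip (Qcov_ninfty ip U B t x) x <= Cgrowth * `|x| ^+ 2.
Proof.
have [e [e_on e_total]] := basis_seq_exists ip_norm sepX.
have [N [mN N0 BN]] := weak_borel_off_null e B_measurable.
apply: (le_trans (ler_norm _)); rewrite expr2 mulrA.
apply: (covariance_ip_le ip_norm sepX U_bl U_cont M0 a0 U_decay B_bl B_le mN N0 e_on e_total BN).
- exact: measurable_itv.
- by move=> r /=; rewrite in_itv.
Qed.

Lemma dual_observation_comp t s r x : r <= s -> s <= t ->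
  dual_observation ip U B t r x = dual_observation ip U B s r (adjoint ip (U t s) x).
Proof.
move=> rs st; apply: (ip_extl ip_norm) => y.
rewrite !(dual_observation_ip ip_norm sepX U_bl B_bl)// ?(le_trans rs)//.
by rewrite (U_comp _ rs st) ipC (adjointP ip_norm sepX (U_bl st)) ipC.
Qed.

(** What happened before time [s] is transported by [U t s]. *)
Lemma Qcov_ninfty_split t s x y : s <= t ->
  ip (Qcov_ninfty ip U B t x) y = ip (Qcov ip U B t s x) y +
  ip (Qcov_ninfty ip U B s (adjoint ip (U t s) x)) (adjoint ip (U t s) y).
Proof.
move=> st; have [e [e_on e_total]] := basis_seq_exists ip_norm sepX.
have [N' [mN' N'0 BN']] := weak_borel_off_null e B_measurable.
(* Adding [s] to the null set makes the two time intervals disjoint. *)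
pose N := N' `|` [set s] : set TR.
have mN : measurable N by apply: measurableU => //; exact: measurable_set1.
have s0 : mu [set s] = 0%E by exact: lebesgue_measure_set1.
have N0 : mu N = 0%E.
  by rewrite -[RHS]N'0; exact: (measureU0 mN' (measurable_set1 s) s0).
have BN n m : measurable_fun (~` N) (fun r : TR => ip (B r (e n)) (e m)).
  apply: (measurable_funS _ _ (BN' n m)); first exact: measurableC.
  by move=> r /= Nr N'r; apply: Nr; left.
have cov := covariance_ip ip_norm sepX U_bl U_cont M0 a0 U_decay B_bl B_le mN N0 e_on e_total BN.
have int := integrable_covariance_density ip_norm sepX U_bl U_cont M0 a0 U_decay B_bl B_le mN e_on e_total BN.
have mI := @measurable_itv R.
have J1 u r : `]-oo, u]%classic r -> r <= u by rewrite /= in_itv.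
have J2 r : `[s, t]%classic r -> r <= t by rewrite /= in_itv => /andP[].
rewrite /Qcov_ninfty /Qcov !cov//; try exact: J1.
rewrite -RintegralD//; first last.
- by apply: int => //; exact: J1.
- exact: int.
apply: eq_Rintegral => r _; rewrite /covariance_density.
have [/set_mem Nr|/negP Nr] := boolP (r \in N).
  by rewrite !memNset ?addr0// => -[].
have mem J : (r \in J `\` N) = (r \in J).
  by apply/idP/idP => [/set_mem[Jr _]|/set_mem Jr]; rewrite inE//; split => // /mem_set.
have memI (i : interval R) : (r \in [set` i]) = (r \in i) by rewrite mem_setE.
rewrite !mem !memI !in_itv/=.
have rs : r != s by apply/negP => /eqP rs; apply: Nr; apply/mem_set; right.
have [sr|rs'] := ltP s r; first by rewrite (ltW sr)/= addr0.
have {}rs : r < s by rewrite lt_neqAle rs.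
rewrite (le_trans rs' st) (leNgt s r) rs/= add0r.
by rewrite !(dual_observation_comp _ rs' st).
Qed.

Hypothesis Q_trace_bounded : forall t,
  (ereal_sup [set op_trace ip (Qcov ip U B t s) | s in [set s | (s <= t)%R]] < +oo)%E.
Variable e : nat -> X.
Hypotheses (e_on : orthonormal_seq ip e) (e_total : total_seq ip e).
Hypothesis e_basis :
  forall k, e k = 0 \/ xget set0 [set E | orthonormal_basis ip E] (e k).

Lemma sum_Qcov_bounded t : exists C : R, forall s n, s <= t ->
  \sum_(i < n) ip (Qcov ip U B t s (e i)) (e i) <= C.
Proof.
have := Q_trace_bounded t; set S := ereal_sup _ => Slty.
have ub s n : s <= t -> ((\sum_(i < n) ip (Qcov ip U B t s (e i)) (e i))%:E <= S)%E.
  move=> st; have [_ _ Q0] := Qcov_nonneg_op s t.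
  apply: (le_trans (sum_basis_le_op_trace n Q0 e_on e_basis)).
  by apply: ereal_sup_ubound; exists s.
exists (fine S) => s n st; have := ub s n st.
have : (0 <= S)%E by have := ub t 0%N (lexx t); rewrite big_ord0.
by case: S Slty {ub} => // r _ _; rewrite lee_fin.
Qed.

(** By the splitting at time [s], the part of the trace that [Qcov t s] misses
    is at most [n] exponentially small terms. *)
Lemma sum_Qcov_ninfty_bounded t : exists C : R, forall n,
  \sum_(i < n) ip (Qcov_ninfty ip U B t (e i)) (e i) <= C.
Proof.
have [C Cub] := sum_Qcov_bounded t; exists (C + 1) => n.
have C0 : 0 <= Cgrowth by rewrite divr_ge0 ?exprn_even_ge0// mulr_ge0 ?ltW.
have D0 : 0 <= Cgrowth * M ^+ 2 by rewrite mulr_ge0// exprn_ge0.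
set D := _ * _ in D0.
have a20 : 0 < 2 * a by rewrite mulr_gt0.
(* With this lag, [n * D * expR (- (2 * a * u)) <= 1] since [1 + y <= expR y]. *)
pose u := n%:R * D / (2 * a); have u0 : 0 <= u by exact: divr_ge0 (mulr_ge0 (ler0n _ _) D0) (ltW a20).
have st : t - u <= t by rewrite gerBl.
under eq_bigr do rewrite (Qcov_ninfty_split _ _ st).
rewrite big_split lerD//=; first exact: Cub.
have term (i : 'I_n) : ip (Qcov_ninfty ip U B (t - u) (adjoint ip (U t (t - u)) (e i)))
    (adjoint ip (U t (t - u)) (e i)) <= D * expR (- (2 * a * u)).
  apply: (le_trans (Qcov_ninfty_le _ _)).
  rewrite (_ : D * _ = Cgrowth * (M * expR (- (a * u))) ^+ 2); last first.
    rewrite /D exprMn -mulrA -expRM_natl; congr (_ * (_ * expR _)).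
    by ring.
  apply: (ler_wpM2l C0); rewrite ler_pXn2r ?nnegrE ?mulr_ge0 ?expR_ge0//.
  apply: (le_trans (norm_adjoint_le ip_norm sepX _ (U_bl st))).
  have h := U_decay st; rewrite (_ : t - (t - u) = u) in h; last by ring.
  apply: (le_trans (y := op_norm (U t (t - u)) * 1)); last by rewrite mulr1.
  apply: ler_wpM2l; first by apply: op_norm_ge0; exact: U_bl.
  rewrite -(@ler_pXn2r _ 2)// ?nnegrE// expr1n -ip_norm.
  by case: (e_on.1 i) => ->; rewrite ?ip0l ?ler01.
apply: (le_trans (ler_sum _ (fun i _ => term i))).
rewrite sumr_const card_ord -mulrnAl expRN (_ : D *+ n = n%:R * D); last by rewrite mulr_natl.
rewrite ler_pdivrMr ?expR_gt0// mul1r; apply: le_trans (expR_ge1Dx _).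
rewrite /u (_ : 2 * a * _ = n%:R * D); last by rewrite mulrCA mulfV ?mulr1// gt_eqF.
by rewrite lerDr.
Qed.

Lemma Qcov_gaussian_exists s t : s <= t ->
  exists nu, is_gaussian ip nu 0 (Qcov ip U B t s).
Proof.
move=> st; have [C Cub] := sum_Qcov_bounded t.
apply: (@gaussian_measure_exists _ _ ip ip_norm sepX _ e C) => // [|n].
  exact: Qcov_nonneg_op.
exact: Cub.
Qed.

Lemma Qcov_ninfty_gaussian_exists t :
  exists nu, is_gaussian ip nu 0 (Qcov_ninfty ip U B t).
Proof.
have [C Cub] := sum_Qcov_ninfty_bounded t.
apply: (@gaussian_measure_exists _ _ ip ip_norm sepX _ e C) => //.
exact: Qcov_ninfty_nonneg_op.
Qed.

End evolution_covariance.

(** * Affine images of Gaussian vectors *)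

Lemma bounded_fun_le {R : realType} {T : Type} {V : normedModType R} (f : T -> V) :
  bounded_fun f -> exists M, forall x, `|f x| <= M.
Proof.
by move=> [M [_ fM]]; exists (M + 1) => x; apply: (fM (M + 1)) => //; rewrite ltrDl.
Qed.

Lemma measurable_Rintegral_section {R : realType} d1 d2 (T1 : measurableType d1)
    (T2 : measurableType d2) (P1 : probability T1 R) (P2 : probability T2 R)
    (f : T1 * T2 -> R) : bounded_measurable f ->
  measurable_fun setT (fun x => \int[P2]_y f (x, y)).
Proof.
move=> bf; apply: (measurableT_comp (f := fine)) => //.
apply: (measurable_int P1).
exact: integrable_fubini_F (@bounded_measurable_integrable _ _ _ (P1 \x P2)%E _ bf).
Qed.

Section gaussian_convolution.
Context {R : realType} {X : completeNormedModType R} (ip : {dot X for idfun}).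
Hypothesis ip_norm : forall x : X, ip x x = `|x| ^+ 2.
Hypothesis sepX : separable X.
Implicit Types (x y h : X) (nu : probability (borel X) R).

Lemma gaussian_measureP (m : X) (Q : X -> X) : (exists nu, is_gaussian ip nu m Q) ->
  is_gaussian ip (gaussian_measure ip m Q) m Q.
Proof.
by move=> ex; rewrite /gaussian_measure; case: pselect => // ex'; exact: projT2 (cid ex').
Qed.

Lemma measurable_affine (T : X -> X) : bounded_linear_op T ->
  measurable_fun setT (fun p : borel X * borel X => T p.1 + p.2 : borel X).
Proof.
move=> bT; apply: (measurable_to_hilbert ip_norm sepX) => // h.
under eq_fun do rewrite ipDl (adjointP ip_norm sepX bT).
apply: measurable_funD.
  exact: (measurableT_comp (measurable_ip ip_norm (adjoint ip T h)) measurable_fst).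
exact: (measurableT_comp (measurable_ip ip_norm h) measurable_snd).
Qed.

(** If [x] and [y] are independent Gaussian vectors, then so is [T x + y], with
    covariance [T Q1 T^* + Q2]: the characteristic functionals multiply. *)
Lemma gaussian_affine_integral nu1 nu2 nu (Q1 Q2 Q T : X -> X) (f : borel X -> R) :
  is_gaussian ip nu1 0 Q1 -> is_gaussian ip nu2 0 Q2 -> is_gaussian ip nu 0 Q ->
  (forall h, 0 <= ip (Q1 h) h) -> (forall h, 0 <= ip (Q2 h) h) ->
  bounded_linear_op T ->
  (forall h, ip (Q h) h = ip (Q2 h) h + ip (Q1 (adjoint ip T h)) (adjoint ip T h)) ->
  bounded_measurable f ->
  \int[nu1]_x \int[nu2]_y f (T x + y) = \int[nu]_z f z.
Proof.
move=> g1 g2 g Q1_ge0 Q2_ge0 bT QE bf.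
have mT := measurable_affine bT.
have [P [PE Pint]] :=
  @pushforward_probability R _ _ _ (borel X) (nu1 \x nu2)%E _ mT.
have Q_ge0 h : 0 <= ip (Q h) h by rewrite QE addr_ge0.
have Pnu : forall A, measurable A -> P A = nu A.
  apply: (hilbert_char_unique ip_norm sepX) => h c.
  have mh : measurable_fun setT (fun x : borel X => ip x h + c).
    by apply: measurable_funD => //; exact: measurable_ip.
  have bc := bounded_measurable_cos mh.
  rewrite (gaussian_char ip_norm _ (Q_ge0 h) g) Pint// Rintegral_Fubini; last first.
    exact: (bounded_measurable_comp bc mT).
  have inner x : \int[nu2]_y cos (ip (T x + y) h + c) =
      expR (- (ip (Q2 h) h / 2)) * cos (ip x (adjoint ip T h) + c).
    rewrite -(gaussian_char ip_norm _ (Q2_ge0 h) g2); apply: eq_Rintegral => y _.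
    by rewrite ipDl (adjointP ip_norm sepX bT); congr cos; ring.
  under eq_Rintegral do rewrite inner.
  rewrite RintegralZb; last first.
    apply: bounded_measurable_cos; apply: measurable_funD => //; exact: measurable_ip.
  rewrite (gaussian_char ip_norm _ (Q1_ge0 _) g1) mulrA -expRD QE; congr (expR _ * _).
  by rewrite mulrDl opprD.
transitivity (\int[P]_z f z).
  by rewrite Pint// Rintegral_Fubini//; exact: (bounded_measurable_comp bf mT).
by congr fine; apply: eq_measure_integral => A mA _; exact: Pnu.
Qed.

Lemma bochner_probability_ip d (S : measurableType d) (P : probability S R)
    (F : S -> X) (C : R) h :
  weakly_measurable ip F -> (forall z, `|F z| <= C) ->
  ip (bochner P setT F) h = \int[P]_z ip (F z) h.
Proof.
move=> wF FC; apply: (@bochner_ip _ _ _ ip_norm sepX _ _ _ _ _ _ set0) => //.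
- by move=> z _; rewrite in_setT.
- have bF : bounded_measurable (fun z => `|F z|).
    split; first exact: (measurable_norm_weak ip_norm sepX).
    by exists C => z; rewrite normr_id.
  have /integrableP[_ +] := bounded_measurable_integrable P bF.
  apply: le_lt_trans; rewrite le_eqVlt; apply/orP; left; apply/eqP.
  by apply: eq_integral => z _; rewrite /= normr_id.
Qed.

Lemma continuous_weakly_measurable (F : X -> X) : continuous F ->
  weakly_measurable ip (F : borel X -> X).
Proof.
move=> cF h; apply: continuous_borel_measurable => x.
by apply: cvg_ipl => //; exact: cF.
Qed.

(** Testing against all vectors reduces the vector identity to the scalar one. *)
Lemma gaussian_affine_bochner nu1 nu2 nu (Q1 Q2 Q T F : X -> X) :
  is_gaussian ip nu1 0 Q1 -> is_gaussian ip nu2 0 Q2 -> is_gaussian ip nu 0 Q ->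
  (forall h, 0 <= ip (Q1 h) h) -> (forall h, 0 <= ip (Q2 h) h) ->
  bounded_linear_op T ->
  (forall h, ip (Q h) h = ip (Q2 h) h + ip (Q1 (adjoint ip T h)) (adjoint ip T h)) ->
  continuous F -> bounded_fun F ->
  bochner nu1 setT (fun x => bochner nu2 setT (fun y => F (T x + y))) =
  bochner nu setT F.
Proof.
move=> g1 g2 g Q1_ge0 Q2_ge0 bT QE cF /bounded_fun_le[C FC].
have C0 : 0 <= C by exact: le_trans (normr_ge0 _) (FC 0).
have bFh h : bounded_measurable (fun z : borel X => ip (F z) h).
  split; first exact: (continuous_weakly_measurable cF).
  exists (C * `|h|) => z; apply: (le_trans (cauchy_schwarz ip_norm _ _)).
  by rewrite ler_wpM2r.
have inner x h : ip (bochner nu2 setT (fun y => F (T x + y))) h =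
    \int[nu2]_y ip (F (T x + y)) h.
  apply: (@bochner_probability_ip _ _ _ _ C) => //; apply: continuous_weakly_measurable.
  move=> y; apply: continuous_comp; last exact: cF.
  by apply: cvgD; [exact: cvg_cst|exact: cvg_id].
have mT := measurable_affine bT.
apply: (ip_extl ip_norm) => h.
rewrite (@bochner_probability_ip _ _ nu _ C h (continuous_weakly_measurable cF))//.
rewrite (@bochner_probability_ip _ _ nu1 _ C).
- under eq_Rintegral do rewrite inner.
  exact: (gaussian_affine_integral g1 g2 g Q1_ge0 Q2_ge0 bT QE (bFh h)).
- move=> k; under eq_fun do rewrite inner.
  apply: (@measurable_Rintegral_section _ _ _ _ _ nu1 nu2 (fun p => ip (F (T p.1 + p.2)) k)).
  exact: (bounded_measurable_comp (bFh k) mT).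
- move=> x; set v := bochner _ _ _.
  have [->|v0] := eqVneq v 0; first by rewrite normr0.
  rewrite -(@ler_pM2r _ `|v|) ?normr_gt0// -expr2 -ip_norm [in leLHS]/v inner.
  have bv : bounded_measurable (fun y : borel X => ip (F (T x + y)) v).
    have mx : measurable_fun setT (fun y : borel X => T x + y : borel X).
      exact: (measurableT_comp mT (measurable_pair1 x)).
    exact: (bounded_measurable_comp (bFh v) mx).
  have bC := @bounded_measurable_cst _ (borel X) _ (C * `|v|).
  apply: (le_trans (y := \int[nu2]_y (C * `|v|))).
    apply: le_Rintegral => //; try exact: bounded_measurable_integrable.
    move=> y _; apply: (le_trans (ler_norm _)).
    apply: (le_trans (cauchy_schwarz ip_norm _ _)).
    by rewrite ler_wpM2r.
  by rewrite Rintegral_cst//; rewrite [X in fine X](probability_setT nu2) mulr1.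
Qed.

End gaussian_convolution.

(** * Invariance *)

Theorem proposition19 (R : realType) (X : completeNormedModType R)
  (ip : {dot X for idfun})
  (ip_norm : forall x : X, ip x x = `|x| ^+ 2)
  (X_separable : separable X)
  (DA : R -> set X) (A : R -> X -> X) (U : R -> R -> X -> X)
  (U_evolution : generates_evolution DA A U)
  (U_growth : growth_bounds U !=set0)
  (U_stable : (growth_rate U < 0)%E)
  (B : R -> X -> X)
  (B_op : forall t, bounded_linear_op (B t))
  (B_bounded : exists K : R, forall t, op_norm (B t) <= K)
  (B_measurable : forall x, lebesgue_measurable_fun (fun t => B t x))
  (Q_trace_class : forall s t, s <= t -> trace_class ip (Qcov ip U B t s))
  (Q_trace_bounded : forall t,
    (ereal_sup [set op_trace ip (Qcov ip U B t s) | s in [set s | (s <= t)%R]]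
      < +oo)%E)
  (controllability : forall s t, s < t ->
    range (U t s) `<=` range (sqrt_op ip (Qcov ip U B t s)))
  (s t : R) (st : s < t) :
  (forall phi : X -> R, continuous phi -> bounded_fun phi ->
     \int[invariant_family ip U B s]_x transition ip U B s t phi x =
     \int[invariant_family ip U B t]_x phi x) /\
  (forall Phi : X -> X, continuous Phi -> bounded_fun Phi ->
     bochner (invariant_family ip U B s) setT (vtransition ip U B s t Phi) =
     bochner (invariant_family ip U B t) setT Phi).
Proof.
have [_ [U_bl _ U_comp _ U_cont]] := U_evolution.
have [K B_le] := B_bounded.
have [_ [w [M M0 U_le] <-]] : exists2 x, (EFin @` growth_bounds U) x & (x < 0)%E.
  by exact: ereal_inf_lt.
rewrite lte_fin => w0; have a0 : 0 < - w by rewrite oppr_gt0.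
have U_decay r u : r <= u -> op_norm (U u r) <= M * expR (- (- w * (u - r))).
  by rewrite mulNr opprK; exact: U_le.
have [E0 oE0] := orthonormal_basis_exists ip_norm.
have oE : orthonormal_basis ip (xget set0 [set E | orthonormal_basis ip E]).
  by case: xgetP => [E _ //|/(_ E0)].
have [e [e_on e_total e_basis]] := orthonormal_basis_enum ip_norm X_separable oE.
have gQ r u : r <= u -> is_gaussian ip (gaussian_measure ip 0 (Qcov ip U B u r)) 0 (Qcov ip U B u r).
  move=> ru; apply: gaussian_measureP.
  exact: (Qcov_gaussian_exists ip_norm X_separable U_bl U_cont (ltW M0) a0
    U_decay B_op B_le B_measurable Q_trace_bounded e_on e_total e_basis ru).
have gQoo r : is_gaussian ip (invariant_family ip U B r) 0 (Qcov_ninfty ip U B r).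
  apply: gaussian_measureP.
  exact: (Qcov_ninfty_gaussian_exists ip_norm X_separable U_bl U_comp U_cont (ltW M0) a0
    U_decay B_op B_le B_measurable Q_trace_bounded e_on e_total e_basis).
have Q_ge0 h : 0 <= ip (Qcov ip U B t s h) h.
  by have [_ _] := Qcov_nonneg_op ip_norm X_separable U_bl U_cont (ltW M0) a0
    U_decay B_op B_le B_measurable s t.
have Qoo_ge0 r h : 0 <= ip (Qcov_ninfty ip U B r h) h.
  by have [_ _] := Qcov_ninfty_nonneg_op ip_norm X_separable U_bl U_cont (ltW M0) a0
    U_decay B_op B_le B_measurable r.
have split h := Qcov_ninfty_split ip_norm X_separable U_bl U_comp U_cont (ltW M0) a0
  U_decay B_op B_le B_measurable h h (ltW st).
split=> [phi cphi /bounded_fun_le[C phiC]|Phi cPhi bPhi].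
  apply: (gaussian_affine_integral ip_norm X_separable (gQoo s) (gQ _ _ (ltW st))
    (gQoo t) (Qoo_ge0 s) Q_ge0 (U_bl _ _ (ltW st)) split).
  by split; [exact: continuous_borel_measurable|exists C].
exact: (gaussian_affine_bochner ip_norm X_separable (gQoo s) (gQ _ _ (ltW st))
  (gQoo t) (Qoo_ge0 s) Q_ge0 (U_bl _ _ (ltW st)) split cPhi bPhi).
Qed.
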